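(* (1) Let $\Lambda$ be an artin algebra and let $A$ be a $\Lambda$-module with finite syzygy type. Then $\operatorname{cx}_\Lambda(A) = [b^n n^\ell]$ for some integer $\ell \ge 0$ and some real number $b \ge 0$. Moreover, for each integer $s$ with $0 \le s \le \ell$, there is an integer $m \ge 0$ and a direct summand $B$ of $\Omega^m A$ with $\operatorname{cx}_\Lambda(B) = [b^n n^s]$. (2) Conversely, given an integer $\ell \ge 0$ and a real number $b \ge 0$, there exist an artin algebra $\Lambda$ and a $\Lambda$-module $A$ with finite syzygy type and $\operatorname{cx}_\Lambda(A) = [b^n n^\ell]$ if and only if $b$ is an algebraic integer and no (complex) root of its irreducible polynomial over $\mathbb{Q}$ has modulus greater than $b$.
   Context: An artin algebra $\Lambda$ is an algebra over a commutative artinian ring $k$ that is finitely generated as a $k$-module. All $\Lambda$-modules are finitely generated left modules. $\Omega A$ denotes the kernel of a projective cover of $A$; $\Omega^0 A = A$ and $\Omega^{n+1}A = \Omega(\Omega^n A)$. A $\Lambda$-module $A$ has finite syzygy type if there is a finite list of $\Lambda$-modules $A_1,\dots,A_r$ such that for every integer $n \ge 0$, $\Omega^n A$ is isomorphic to a (finite) direct sum of copies of the $A_i$. For a sequence $f:\mathbb{N}\to\mathbb{R}_{\ge 0}$ (with $0\in\mathbb{N}$), its complexity class $[f(n)]$ is the set of all $g:\mathbb{N}\to\mathbb{R}_{\ge 0}$ for which there are real $c_1,c_2>0$ with $c_1 g(n)\le f(n)\le c_2 g(n)$ for all but finitely many $n$. The complexity of a $\Lambda$-module $A$ is $\operatorname{cx}_\Lambda(A)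 = [\ell_k(\Omega^n A)]$, where $\ell_k$ is composition length over $k$. The irreducible polynomial of an algebraic number over $\mathbb{Q}$ is its monic minimal polynomial. *)

(* Defs.v *)
From HB Require Import structures.
From mathcomp Require Import all_boot all_order all_algebra.
From mathcomp Require Import complex.
From mathcomp Require Import boolp classical_sets reals.

Set Implicit Arguments.
Unset Strict Implicit.
Unset Printing Implicit Defensive.

Import Order.TTheory GRing.Theory Num.Theory.

Local Open Scope classical_set_scope.
Local Open Scope ring_scope.

Definition submodule (R : pzRingType) (M : lmodType R) (U : set M) : Prop :=
  submod_closed [in U].

Definition fin_gen (R : pzRingType) (M : lmodType R) : Prop :=
  exists (n : nat) (g : 'I_n -> M),
    forall x, exists c : 'I_n -> R, x = \sum_(i < n) c i *: g i.

Definition iso_mod (R : pzRingType) (M N : lmodType R) : Prop :=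
  exists f : {linear M -> N}, bijective f.

Definition direct_summand (R : pzRingType) (B M : lmodType R) : Prop :=
  exists C : lmodType R, iso_mod M (B * C)%type.

(* The empty sum is the zero module of row vectors of size 0. *)
Fixpoint direct_sum (R : pzRingType) (I : Type) (As : I -> lmodType R)
    (s : seq I) : lmodType R :=
  if s is i :: s' then (As i * direct_sum As s')%type else 'rV[R]_0.

(* Since submodules correspond to submodules of a quotient, the factor
   c i.+1 / c i is simple iff c i is a maximal proper submodule of c i.+1. *)
Definition composition_series (R : pzRingType) (M : lmodType R) (n : nat)
    (c : nat -> set M) : Prop :=
  [/\ c 0%N = [set 0],
      c n = setT,
      forall i, (i <= n)%N -> submodule (c i) &
      forall i, (i < n)%N ->
        c i `<` c i.+1 /\
        forall U, submodule U -> c i `<=` U -> U `<=` c i.+1 ->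
          U = c i \/ U = c i.+1].

(* Unique by Jordan-Holder when a composition series exists; 0 otherwise. *)
Definition comp_length (R : pzRingType) (M : lmodType R) : nat :=
  xget 0%N [set n | exists c : nat -> set M, composition_series n c].

(* Ideals of the commutative ring k are the submodules of k over itself. *)
Definition artinian (k : comPzRingType) : Prop :=
  forall I : nat -> set k^o,
    (forall n, submodule (I n)) -> (forall n, I n.+1 `<=` I n) ->
    exists N, forall n, (N <= n)%N -> I n = I N.

(* An L-module viewed as a k-module along the ring morphism phi. *)
Definition restrict_scalars (k L : pzRingType) (phi : {rmorphism k -> L})
  (M : lmodType L) : Type := M.

Section Restrict.
Variables (k L : pzRingType) (phi : {rmorphism k -> L}) (M : lmodType L).
Local Notation MR := (restrict_scalars phi M).

HB.instance Definition _ := GRing.Zmodule.on MR.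

Definition restrict_scale (a : k) (x : MR) : MR := phi a *: (x : M).

Lemma restrict_scaleA a b x :
  restrict_scale a (restrict_scale b x) = restrict_scale (a * b) x.
Proof. by rewrite /restrict_scale scalerA rmorphM. Qed.

Lemma restrict_scale1 : left_id 1 restrict_scale.
Proof. by move=> x; rewrite /restrict_scale rmorph1 scale1r. Qed.

Lemma restrict_scaleDr : right_distributive restrict_scale +%R.
Proof. by move=> a x y; rewrite /restrict_scale scalerDr. Qed.

Lemma restrict_scaleDl x : {morph restrict_scale^~ x : a b / a + b}.
Proof. by move=> a b; rewrite /restrict_scale rmorphD scalerDl. Qed.

HB.instance Definition _ := GRing.Zmodule_isLmodule.Build k MR
  restrict_scaleA restrict_scale1 restrict_scaleDr restrict_scaleDl.

End Restrict.

(* The k-algebra structure on L is a ring morphism phi : k -> L with central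
   image. The library's algType is not used because it excludes L = 0. *)
Definition artin_algebra (k : comPzRingType) (L : pzRingType)
    (phi : {rmorphism k -> L}) : Prop :=
  [/\ artinian k,
      forall a x, phi a * x = x * phi a &
      fin_gen (restrict_scalars phi L^o)].

Definition projective (L : pzRingType) (P : lmodType L) : Prop :=
  forall (M N : lmodType L) (g : {linear M -> N}) (h : {linear P -> N}),
    (forall y, exists x, g x = y) ->
    exists h' : {linear P -> M}, forall x, g (h' x) = h x.

Definition superfluous (R : pzRingType) (M : lmodType R) (U : set M) : Prop :=
  forall V : set M, submodule V ->
    (forall x, exists u v, [/\ U u, V v & x = u + v]) -> V = setT.

Definition projective_cover (L : pzRingType) (P A : lmodType L)
    (f : {linear P -> A}) : Prop :=
  [/\ fin_gen P, projective P,
      forall y, exists x, f x = y &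
      superfluous (f @^-1` [set 0])].

Definition is_syzygy (L : pzRingType) (A S : lmodType L) : Prop :=
  exists (P : lmodType L) (f : {linear P -> A}) (i : {linear S -> P}),
    [/\ projective_cover f, injective i & range i = f @^-1` [set 0]].

(* Omega A is determined up to isomorphism. The default value is irrelevant for
   finitely generated modules over an artin algebra: these have projective
   covers. *)
Definition Omega (L : pzRingType) (A : lmodType L) : lmodType L :=
  if pselect (exists S, is_syzygy A S) is left ex then sval (cid ex)
  else 'rV[L]_0.

Fixpoint syzygy (L : pzRingType) (n : nat) (A : lmodType L) : lmodType L :=
  if n is n'.+1 then Omega (syzygy n' A) else A.

Definition finite_syzygy_type (L : pzRingType) (A : lmodType L) : Prop :=
  exists (r : nat) (As : 'I_r -> lmodType L),
    (forall i, fin_gen (As i)) /\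
    forall n, exists s : seq 'I_r, iso_mod (syzygy n A) (direct_sum As s).

Definition complexity_class (R : realType) (f : nat -> R) : set (nat -> R) :=
  [set g | (forall n, 0 <= g n) /\
    exists c1 c2 : R, [/\ 0 < c1, 0 < c2 &
      exists N, forall n, (N <= n)%N -> c1 * g n <= f n <= c2 * g n]].

Definition cx (R : realType) (k L : pzRingType) (phi : {rmorphism k -> L})
    (A : lmodType L) : set (nat -> R) :=
  complexity_class
    (fun n => (comp_length (restrict_scalars phi (syzygy n A)))%:R).

(* The convention 0 ^+ 0 = 1 only affects n = 0, hence not the class. *)
Definition exp_poly_class (R : realType) (b : R) (l : nat) : set (nat -> R) :=
  complexity_class (fun n => b ^+ n * n%:R ^+ l).

Definition is_minimal_poly (R : realType) (b : R) (p : {poly rat}) : Prop :=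
  [/\ p \is monic,
      root (map_poly (ratr : rat -> R) p) b &
      forall q : {poly rat}, q != 0 -> root (map_poly (ratr : rat -> R) q) b ->
        (size p <= size q)%N].

Definition algebraic_integer (R : realType) (b : R) : Prop :=
  integralOver (intr : int -> R) b.

(* Main.v *)
(* By the Krull-Schmidt argument, the indecomposable summands of the syzygies
   of A fall into finitely many isomorphism classes, so the lengths of the
   syzygies are the row sums of the powers of a nonnegative integer matrix T.
   On a strongly connected class of indices these sums are quasi-multiplicative,
   hence of order r^n; running through the classes, each step of the recursion
   convolves r^n with growth b^n n^l, which gives r^n, b^n n^l or, when r = b,
   b^n n^(l+1).

   If b > 0 were not an eigenvalue of T, then b - T would be invertible and the
   telescoping sum of T^n w / b^(n+1) would be O(n^l), although its terms are of
   order n^l.  All eigenvalues of T have modulus at most b, so b is an algebraic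
   integer whose conjugates have modulus at most b.

   Conversely, if the conjugates of b have modulus at most b, then those of
   modulus b become equal to b^m after raising to a suitable power m, so
   mu = b^m strictly dominates its other conjugates (a Perron number).  The
   elements q of Z[mu] with |q(w)| <= q(mu) <= K for all conjugates w of mu form
   a finite set Y, and mu * q is a sum of elements of Y for q in Y (divide the
   coefficients by a large integer): this is a nonnegative integer matrix with
   positive eigenvector and eigenvalue mu.  Cyclic blocks extract an m-th root,
   a chain of l + 1 copies produces the factor n^l, and the quiver algebra with
   radical square zero attached to the matrix has simple modules whose syzygies
   are counted by it. *)
Require Import Defs.
From HB Require Import structures.
From mathcomp Require Import all_boot all_order all_algebra all_field.
From mathcomp Require Import complex.
From mathcomp Require Import zify ring lra.
From mathcomp Require Import boolp classical_sets reals.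

Set Implicit Arguments.
Unset Strict Implicit.
Unset Printing Implicit Defensive.

Import Order.TTheory GRing.Theory Num.Theory.

Local Open Scope classical_set_scope.
Local Open Scope ring_scope.

(** * Modules of finite length *)

(** Krull-Schmidt enters in this form: an indecomposable retract of a finite direct sum of
    indecomposables is isomorphic to one of them. The matrix therefore records one chosen
    decomposition of each first syzygy. The growth estimates rest on one comparison principle: since
    [T] is nonnegative, an inequality between two orbits at time 0 persists for all times. Strictly
    positive initial values make any two orbits comparable up to constants, so the vertices have to
    be nonzero modules. [A] itself is kept as a vertex, possibly decomposable, because its lengths
    are the ones to be estimated. For the realization, the positive eigenvector gives an explicit
    orbit with which the lengths are compared. Lengths are taken over [k], so the artinian ring [k]
    must first be shown to have finite length over itself; this yields projective covers by
    minimality of length. On the arithmetic side, field automorphisms are replaced by substitution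
    of one root of a minimal polynomial for another, and a resultant provides the root to
    substitute. *)

Lemma submoduleP (R : pzRingType) (M : lmodType R) (U : set M) :
  submodule U <-> U 0 /\ forall (a : R) x y, U x -> U y -> U (a *: x + y).
Proof.
split=> -[U0 UD]; split.
- by move: U0; rewrite in_setE.
- by move=> a x y Ux Uy; have := UD a x y; rewrite !in_setE; apply.
- by rewrite in_setE.
- by move=> a x y; rewrite !in_setE; apply: UD.
Qed.

Section Submodules.
Variables (R : pzRingType) (M : lmodType R).
Implicit Types (U V : set M).

Lemma sub0 U : submodule U -> U 0.
Proof. by case/submoduleP. Qed.

Lemma subZD U a x y : submodule U -> U x -> U y -> U (a *: x + y).
Proof. by case/submoduleP=> _; apply. Qed.

Lemma subD U x y : submodule U -> U x -> U y -> U (x + y).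
Proof. by move=> sU Ux Uy; rewrite -[x]scale1r; apply: subZD. Qed.

Lemma subZ U a x : submodule U -> U x -> U (a *: x).
Proof. by move=> sU Ux; rewrite -[_ *: _]addr0; apply: subZD => //; apply: sub0. Qed.

Lemma subN U x : submodule U -> U x -> U (- x).
Proof. by move=> sU Ux; rewrite -scaleN1r; apply: subZ. Qed.

Lemma subB U x y : submodule U -> U x -> U y -> U (x - y).
Proof. by move=> sU Ux Uy; apply: subD => //; apply: subN. Qed.

Lemma submoduleT : submodule (@setT M).
Proof. by apply/submoduleP. Qed.

Lemma submodule0 : submodule [set 0 : M].
Proof.
by apply/submoduleP; split=> // a x y -> ->; rewrite /set1 /= scaler0 addr0.
Qed.

Lemma submoduleI U V : submodule U -> submodule V -> submodule (U `&` V).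
Proof.
move=> sU sV; apply/submoduleP; split; first by split; apply: sub0.
by move=> a x y [? ?] [? ?]; split; apply: subZD.
Qed.

Definition sum_set U V : set M := [set x | exists u v, [/\ U u, V v & x = u + v]].

Lemma submodule_sum U V : submodule U -> submodule V -> submodule (sum_set U V).
Proof.
move=> sU sV; apply/submoduleP; split.
  by exists 0, 0; rewrite addr0; split=> //; apply: sub0.
move=> a _ _ [u [v [Uu Vv ->]]] [u' [v' [Uu' Vv' ->]]].
exists (a *: u + u'), (a *: v + v'); split; try exact: subZD.
by rewrite scalerDr addrACA.
Qed.

End Submodules.

Section Linear.
Variables (R : pzRingType) (M N : lmodType R).

Definition mklin (f : M -> N) (f_lin : linear f) : {linear M -> N} :=
  HB.pack f (GRing.isLinear.Build R M N *:%R f f_lin).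

Lemma submodule_preim (f : {linear M -> N}) (U : set N) :
  submodule U -> submodule (f @^-1` U).
Proof.
move=> sU; apply/submoduleP; split; first by rewrite /preimage /= linear0; apply: sub0.
by move=> a x y Ux Uy; rewrite /preimage /= linearP; apply: subZD.
Qed.

Lemma submodule_im (f : {linear M -> N}) (U : set M) :
  submodule U -> submodule (f @` U).
Proof.
move=> sU; apply/submoduleP; split; first by exists 0; [apply: sub0|rewrite linear0].
move=> a _ _ [x Ux <-] [y Uy <-]; exists (a *: x + y); first exact: subZD.
by rewrite linearP.
Qed.

End Linear.

Section SubLmod.
Variables (R : pzRingType) (M : lmodType R) (U : set M).
Definition sub_lmod (sU : submodule U) : Type := {x : M | x \in U}.
Variable sU : submodule U.
HB.instance Definition _ := SubChoice.on (sub_lmod sU).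
HB.instance Definition _ := GRing.SubChoice_isSubLmodule.Build R M [in U]
  (sub_lmod sU) (GRing.submod_closed_semi sU).

Lemma sub_valP (x : sub_lmod sU) : U (val x).
Proof. by have := valP x; rewrite in_setE. Qed.

Definition sub_mk (x : M) (Ux : U x) : sub_lmod sU := Sub x (mem_set Ux).

Lemma sub_mkK x (Ux : U x) : val (sub_mk Ux) = x.
Proof. exact: SubK. Qed.

Definition sub_incl : {linear sub_lmod sU -> M} := val.

Lemma range_sub_incl : range sub_incl = U.
Proof.
apply/seteqP; split=> [_ [x _ <-]|x Ux]; first exact: sub_valP.
by exists (sub_mk Ux) => //; apply: sub_mkK.
Qed.

Lemma sub_incl_inj : injective sub_incl.
Proof. exact: val_inj. Qed.

Definition corestrict (N : lmodType R) (f : {linear N -> M})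
  (fU : forall x, U (f x)) : N -> sub_lmod sU := fun x => sub_mk (fU x).

Lemma corestrict_linear (N : lmodType R) (f : {linear N -> M}) (fU : forall x, U (f x)) :
  linear (corestrict fU).
Proof.
by move=> a x y; apply: val_inj; rewrite /= /corestrict linearP.
Qed.

End SubLmod.

(* A strictly monotone rank function on submodules: a form of finite length
   that passes to submodules, quotients and products. *)
Definition rank_function (R : pzRingType) (M : lmodType R) (rho : set M -> nat) :=
  forall U V, submodule U -> submodule V -> U `<` V -> (rho U < rho V)%N.

Definition ranked (R : pzRingType) (M : lmodType R) :=
  exists rho : set M -> nat, rank_function rho.

Section Ranked.
Variable R : pzRingType.
Implicit Types M N : lmodType R.

Lemma rank_le M (rho : set M -> nat) U V : rank_function rho ->
  submodule U -> submodule V -> U `<=` V -> (rho U <= rho V)%N.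
Proof.
move=> rhoP sU sV UV; case: (pselect (V `<=` U)) => VU.
  by have -> : U = V by apply/seteqP.
by apply/ltnW/rhoP.
Qed.

Lemma rank_eq M (rho : set M -> nat) U V : rank_function rho ->
  submodule U -> submodule V -> U `<=` V -> (rho V <= rho U)%N -> U = V.
Proof.
move=> rhoP sU sV UV le; apply/seteqP; split=> //; apply: contrapT => VU.
by have := rhoP _ _ sU sV (conj UV VU); rewrite ltnNge le.
Qed.

Lemma ranked_inj M N (f : {linear M -> N}) : injective f -> ranked N -> ranked M.
Proof.
move=> f_inj [rho rhoP]; exists (fun U => rho (f @` U)) => U V sU sV [UV VU].
apply: rhoP; try exact: submodule_im; split; first exact: image_subset.
move=> fVU; apply: VU => x Vx; have [|y Uy /f_inj <- //] := fVU (f x).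
by exists x.
Qed.

Lemma ranked_surj M N (f : {linear M -> N}) :
  (forall y, exists x, f x = y) -> ranked M -> ranked N.
Proof.
move=> f_surj [rho rhoP]; exists (fun U => rho (f @^-1` U)) => U V sU sV [UV VU].
apply: rhoP; try exact: submodule_preim.
split=> [x|fVU]; first exact: UV.
by apply: VU => y Vy; have [x fx] := f_surj y; rewrite -fx; apply: fVU; rewrite /preimage /= fx.
Qed.

Lemma prod_scaleE M N a (x : M * N) : a *: x = (a *: x.1, a *: x.2).
Proof. by []. Qed.

Lemma pair_addE M N (x x' : M) (y y' : N) : (x, y) + (x', y') = (x + x', y + y').
Proof. by []. Qed.

Lemma pair_subE M N (x x' : M) (y y' : N) : (x, y) - (x', y') = (x - x', y - y').
Proof. by []. Qed.

(** By the modular law, nested submodules of the product coincide as soon as they have the same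
    intersection with [M] and the same image in [N]; so the sum of the two ranks is strictly
    monotone. *)
Lemma ranked_prod M N : ranked M -> ranked N -> ranked (M * N)%type.
Proof.
move=> [r1 r1P] [r2 r2P].
pose A (U : set (M * N)%type) := [set x : M | U (x, 0)].
pose B (U : set (M * N)%type) := [set y : N | exists x, U (x, y)].
have sA U : submodule U -> submodule (A U).
  move=> sU; apply/submoduleP; split; first exact: sub0 sU.
  move=> a x y Ux Uy; have := subZD a sU Ux Uy.
  by rewrite prod_scaleE /A /= scaler0 pair_addE addr0.
have sB U : submodule U -> submodule (B U).
  move=> sU; apply/submoduleP; split; first by exists 0; exact: sub0 sU.
  by move=> a x y [x' Ux] [y' Uy]; have := subZD a sU Ux Uy; exists (a *: x' + y').
exists (fun U => r1 (A U) + r2 (B U))%N => U V sU sV [UV VU].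
have AUV : A U `<=` A V by move=> x; apply: UV.
have BUV : B U `<=` B V by move=> y [x Ux]; exists x; apply: UV.
have leA := rank_le r1P (sA _ sU) (sA _ sV) AUV.
have leB := rank_le r2P (sB _ sU) (sB _ sV) BUV.
rewrite ltnNge; apply/negP => le; apply: VU.
have eA : A U = A V.
  apply: (rank_eq r1P) => //; [exact: sA|exact: sA|].
  by rewrite -(leq_add2r (r2 (B U))); apply: leq_trans le; rewrite leq_add2l.
have eB : B U = B V.
  apply: (rank_eq r2P) => //; [exact: sB|exact: sB|].
  by rewrite -(leq_add2l (r1 (A U))); apply: leq_trans le; rewrite leq_add2r.
move=> [x y] Vxy.
have [x' Ux'y] : B U y by rewrite eB; exists x.
have Ud : A U (x - x').
  rewrite eA /A /=; have := subB sV Vxy (UV _ Ux'y).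
  by rewrite pair_subE subrr.
have := subD sU Ud Ux'y.
by rewrite pair_addE subrK add0r.
Qed.

End Ranked.

(** * Composition series and the invariance of their length *)

Section CompositionSeries.
Variable R : pzRingType.
Implicit Types M N : lmodType R.

(** A composition series of the submodule [U], taken inside [M], so that the induction in
    [ranked_series] never changes the ambient module. *)
Definition series_to M (U : set M) (n : nat) (c : nat -> set M) : Prop :=
  [/\ c 0%N = [set 0],
      c n = U,
      forall i, (i <= n)%N -> submodule (c i) &
      forall i, (i < n)%N ->
        c i `<` c i.+1 /\
        forall U, submodule U -> c i `<=` U -> U `<=` c i.+1 ->
          U = c i \/ U = c i.+1].

(* The number of factors c i.+1 / c i to which D contributes. *)
Definition series_rank M (n : nat) (c : nat -> set M) (D : set M) : nat :=
  \sum_(i < n) `[< exists x, [/\ D x, c i.+1 x & ~ c i x] >].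

Lemma series_rank_le M n (c : nat -> set M) D : (series_rank n c D <= n)%N.
Proof.
by rewrite -[leqRHS]card_ord -sum1_card; apply: leq_sum => i _; case: asbool.
Qed.

(** If [D] contributes to every factor to which the larger [E] does, then [E] meets each [c k]
    inside [D], by induction on [k]. An element of [D] in [c k.+1] outside [c k] generates [c k.+1]
    modulo [c k] by simplicity of the factor, so an element of [E] in [c k.+1] can be corrected by
    one of [D] to lie in [c k]. *)
Lemma series_rankP M n (c : nat -> set M) :
  composition_series n c -> rank_function (series_rank n c).
Proof.
move=> [c0 cn csub ccov] D E sD sE [DE ED].
have mono i : `[< exists x, [/\ D x, c i.+1 x & ~ c i x] >] ->
    `[< exists x, [/\ E x, c i.+1 x & ~ c i x] >].
  move=> /asboolP[x [Dx cx ncx]]; apply/asboolP; exists x; split=> //.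
  exact: DE.
rewrite ltnNge; apply/negP => le; apply: ED.
have same (i : 'I_n) : (exists x, [/\ E x, c i.+1 x & ~ c i x]) ->
    exists x, [/\ D x, c i.+1 x & ~ c i x].
  move=> Ei; apply: contrapT => nDi.
  have := le; rewrite leqNgt => /negP; apply.
  rewrite /series_rank (bigD1 i) //= [X in (_ < X)%N](bigD1 i) //=.
  rewrite (asboolT Ei) (asboolF nDi) add0n add1n ltnS.
  by apply: leq_sum => j _; case: asbool (@mono j) => // ->.
suff H k : (k <= n)%N -> E `&` c k `<=` D.
  by move=> x Ex; apply: (H n) => //; rewrite cn.
elim: k => [_ x [_]|k IHk ltk x [Ex cx]]; first by rewrite c0 => ->; apply: sub0.
case: (pselect (c k x)) => [ckx|nckx]; first by apply: IHk => //; apply: ltnW.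
have [|d [Dd cd ncd]] := same (Ordinal ltk); first by exists x.
have [[ckc _] cov] := ccov _ ltk.
have sck := csub _ (ltnW ltk); have sck' := csub _ ltk.
have sW := submodule_sum (submoduleI sD sck') sck.
case: (cov _ sW).
- by move=> y cy; exists 0, y; rewrite add0r; split=> //; split; apply: sub0.
- by move=> _ [u [v [[_ cu] cv ->]]]; apply: subD => //; apply: ckc.
- move=> eW; case: ncd; rewrite /= -eW; exists d, 0; rewrite addr0; split=> //.
  exact: sub0.
move=> eW; have: c k.+1 x by []. 
rewrite -eW => -[u [v [[Du cu] cv xE]]].
rewrite xE; apply: subD => //; apply: IHk; first exact: ltnW.
split=> //; rewrite [v](_ : _ = x - u); first by apply: subB => //; apply: DE.
by rewrite xE addrC addKr.
Qed.

(** The rank attached to one series increases strictly along the other and is at most [n], so the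
    second series cannot be longer; the situation is symmetric. *)
Lemma series_rank_unique M n m (c d : nat -> set M) :
  composition_series n c -> composition_series m d -> n = m.
Proof.
wlog suff H : n m c d / composition_series n c -> composition_series m d ->
    (m <= n)%N.
  by move=> C D; apply/eqP; rewrite eqn_leq (H _ _ _ _ C D) (H _ _ _ _ D C).
move=> C [_ _ dsub dcov]; have rhoP := series_rankP C.
suff H k : (k <= m)%N -> (k <= series_rank n c (d k))%N.
  by apply: leq_trans (H m _) (series_rank_le _ _ _).
elim: k => // k IHk ltk; apply: leq_ltn_trans (IHk (ltnW ltk)) _.
by apply: rhoP; [apply/dsub/ltnW|apply: dsub|case: (dcov _ ltk)].
Qed.

Lemma comp_lengthE M n (c : nat -> set M) :
  composition_series n c -> comp_length M = n.
Proof.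
move=> C; rewrite /comp_length.
have [|d D] := @xgetPex _ 0%N [set n | exists c : nat -> set M, composition_series n c].
  by exists n, c.
exact: series_rank_unique D C.
Qed.

(** A proper submodule of [U] of largest rank is maximal in [U], so it can serve as the last step
    below [U]. *)
Lemma ranked_series M : ranked M -> exists n c, @composition_series R M n c.
Proof.
move=> [rho rhoP].
suff H k (U : set M) : (rho U <= k)%N -> submodule U ->
    exists n c, series_to U n c.
  exact: H (leqnn _) (submoduleT M).
elim: k U => [|k IHk] U leU sU; have s0 := submodule0 M.
  exists 0%N, (fun=> [set 0]); split=> //; apply: (rank_eq rhoP) => //.
    by move=> _ ->; apply: sub0.
  by apply: leq_trans leU _.
case: (pselect (U = [set 0])) => [->|U0].
  by exists 0%N, (fun=> [set 0]); split.
have lt0U : [set 0] `<` U.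
  split; first by move=> _ ->; apply: sub0.
  move=> U0'; apply: U0; apply/seteqP; split=> // _ ->; exact: sub0.
pose P m := `[< exists V, [/\ submodule V, V `<` U & rho V = m] >].
have exP : exists m, P m by exists (rho [set 0]); apply/asboolP; exists [set 0].
have bP m : P m -> (m <= rho U)%N.
  by move=> /asboolP[V [sV VU <-]]; apply/ltnW/rhoP.
case: (ex_maxnP exP bP) => _ /asboolP[V [sV VU <-]] Vmax.
have [|n [c [c0 cn csub ccov]]] := IHk V _ sV.
  by rewrite -ltnS; apply: leq_trans (rhoP _ _ sV sU VU) leU.
exists n.+1, (fun i => if (i <= n)%N then c i else U); split=> //.
- by rewrite ltnn.
- by move=> i _; case: leqP => [/csub|].
move=> i; rewrite ltnS => lein; rewrite lein ltnNge.
move: lein; rewrite leq_eqVlt => /orP[/eqP ->|ltin]; last first.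
  by rewrite -ltnNge ltin; apply: ccov.
rewrite leqnn /= cn; split=> // W sW VW WU.
case: (pselect (U `<=` W)) => UW; first by right; apply/seteqP.
left; apply/esym/(rank_eq rhoP) => //; apply: Vmax; apply/asboolP.
by exists W; split.
Qed.

Lemma series_preim M N (f : {linear M -> N}) n (c : nat -> set N) : bijective f ->
  composition_series n c -> composition_series n (fun i => f @^-1` c i).
Proof.
move=> f_bij [c0 cn csub ccov]; have f_inj := bij_inj f_bij.
have [g fK gK] := f_bij; split.
- rewrite c0; apply/seteqP; split=> x; rewrite /preimage /set1 /=.
    by move=> fx0; apply: f_inj; rewrite fx0 linear0.
  by move=> ->; rewrite linear0.
- by rewrite cn.
- by move=> i lein; apply/submodule_preim/csub.
move=> i ltin; have [[cc ncc] cov] := ccov i ltin; split.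
  split=> [x|H]; first exact: cc.
  by apply: ncc => y cy; rewrite -[y]gK; apply: H; rewrite /preimage /= gK.
move=> U sU cU Uc; have eU : U = f @^-1` (f @` U).
  apply/seteqP; split=> [x Ux|x]; first by exists x.
  by move=> [y Uy /f_inj <-].
rewrite eU; case: (cov _ (submodule_im f sU)) => [| |->|->]; [| |by left|by right].
  by move=> y cy; exists (g y); rewrite ?gK //; apply: cU; rewrite /preimage /= gK.
by move=> _ [x Ux <-]; apply: Uc.
Qed.

Lemma comp_length_iso M N : iso_mod M N -> comp_length M = comp_length N.
Proof.
move=> [f f_bij]; rewrite /comp_length; congr xget; apply/seteqP; split=> n [c C].
  have [g fK gK] := f_bij.
  have g_lin : linear g.
    by move=> a x y; apply: (bij_inj f_bij); rewrite linearP !gK.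
  exists (fun i => mklin g_lin @^-1` c i); apply: series_preim C.
  by exists f.
by exists (fun i => f @^-1` c i); apply: series_preim C.
Qed.

Lemma series_prod M N n m (c : nat -> set M) (d : nat -> set N) :
  composition_series n c -> composition_series m d ->
  composition_series (n + m) (fun i => if (i < n)%N then c i `*` [set 0]
                              else setT `*` d (i - n)%N : set (M * N)%type).
Proof.
move=> [c0 cn csub ccov] [d0 dm dsub dcov].
have sX (A : set M) (B : set N) : submodule A -> submodule B ->
    submodule (A `*` B : set (M * N)%type).
  move=> sA sB; apply/submoduleP; split; first by split; apply: sub0.
  by move=> a [x y] [x' y'] [/= ? ?] [/= ? ?]; split; apply: subZD.
have eA i (len : (i <= n)%N) : (if (i < n)%N then c i `*` [set 0]
    else setT `*` d (i - n)%N) = (c i `*` [set 0] : set (M * N)%type).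
  case: ltnP => // leni; have -> : i = n by apply/eqP; rewrite eqn_leq len leni.
  by rewrite cn subnn d0.
split.
- by rewrite eA // c0; apply/seteqP; split=> [[x y] [/= -> ->]|_ ->].
- by rewrite ltnNge leq_addr /= addKn dm; apply/seteqP; split=> -[].
- move=> i leinm; case: ltnP => [ltin|leni].
    by apply: sX; [apply/csub/ltnW|apply: submodule0].
  by apply: sX; [apply: submoduleT|apply: dsub; rewrite leq_subLR].
move=> i ltinm; case: (ltnP i n) => [ltin|leni].
  rewrite eA //; have [[cc ncc] cov] := ccov i ltin; split.
    split=> [[x y] [/= cx y0]|H]; first by split=> //; apply: cc.
    by apply: ncc => x cx; have [] := H (x, 0).
  move=> U sU cU Uc; pose A := [set x : M | U (x, 0)].
  have sA : submodule A.
    apply/submoduleP; split; first exact: sub0 sU.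
    move=> a x y Ux Uy; have := subZD a sU Ux Uy.
    by rewrite prod_scaleE /A /= scaler0 pair_addE addr0.
  have eU : U = A `*` [set 0].
    apply/seteqP; split=> [[x y] Uxy|[x y] [/= Ax ->] //].
    by have [/= _ y0] := Uc _ Uxy; split=> //; rewrite /A /= -y0.
  case: (cov _ sA) => [x cx|x Ax|eA'|eA']; first by apply: cU.
  - by have [] := Uc (x, 0) Ax.
  - by left; rewrite eU eA'.
  - by right; rewrite eU eA'.
rewrite ltnNge (leq_trans leni) // subSn //=.
have ltj : (i - n < m)%N by rewrite ltn_subLR.
have [[dd ndd] cov] := dcov _ ltj; split.
  split=> [[x y] [/= _ dy]|H]; first by split=> //; apply: dd.
  by apply: ndd => y dy; have [] := H (0, y).
move=> U sU dU Ud; pose B := [set y : N | U (0, y)].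
have sB : submodule B.
  apply/submoduleP; split; first exact: sub0 sU.
  move=> a x y Ux Uy; have := subZD a sU Ux Uy.
  by rewrite prod_scaleE /B /= scaler0 pair_addE addr0.
have U0 x : U (x, 0) by apply: dU; split=> //=; apply: sub0; apply: dsub; apply: ltnW.
have eU : U = setT `*` B.
  apply/seteqP; split=> [[x y] Uxy|[x y] [/= _ By]].
    by split=> //; have := subB sU Uxy (U0 x); rewrite pair_subE subrr subr0.
  by have := subD sU (U0 x) By; rewrite pair_addE add0r addr0.
case: (cov _ sB) => [y dy|y By|eB|eB]; first by apply: dU.
- by have [] := Ud (0, y) By.
- by left; rewrite eU eB.
- by right; rewrite eU eB.
Qed.

Lemma comp_length_prod M N : ranked M -> ranked N ->
  comp_length (M * N)%type = (comp_length M + comp_length N)%N.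
Proof.
move=> /ranked_series[n [c C]] /ranked_series[m [d D]].
by rewrite (comp_lengthE C) (comp_lengthE D) (comp_lengthE (series_prod C D)).
Qed.

Lemma comp_length0P M : ranked M -> comp_length M = 0%N <-> forall x : M, x = 0.
Proof.
move=> /ranked_series[n [c C]]; rewrite (comp_lengthE C); split=> [n0 x|M0].
  have [c0 cn _ _] := C; have : c n x by rewrite cn.
  by rewrite n0 c0.
case: C => c0 _ csub ccov; case: n csub ccov => // n csub ccov.
have [//|[_ ncc] _] := ccov 0%N; case: ncc => x _.
by rewrite (M0 x) c0.
Qed.

End CompositionSeries.

(** * Commutative artinian rings *)

Lemma max_submodule_avoiding (R : pzRingType) (M : lmodType R) (U : set M) x :
  submodule U -> ~ U x ->
  exists V, [/\ submodule V, U `<=` V, ~ V x &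
    forall W, submodule W -> V `<` W -> W x].
Proof.
move=> sU nUx.
(* The union with [U] lets the empty chain, whose union is empty, satisfy the condition of Zorn's
   lemma. *)
pose P (A : set M) := submodule (A `|` U) /\ ~ (A `|` U) x.
have [F FP Ftot|A [[sA nAx] Amax]] := @Zorn_bigcup _ P.
  split; last by move=> [[A FA Ax]|//]; case: (FP _ FA) => _; apply; left.
  apply/submoduleP; split; first by right; apply: sub0.
  have key A B a u v : F A -> F B -> A `<=` B ->
      (A `|` U) u -> (B `|` U) v -> (\bigcup_(X in F) X `|` U) (a *: u + v).
    move=> FA FB AB Au Bv; have [sB _] := FP _ FB.
    have Bu : (B `|` U) u by case: Au => [/AB|]; [left|right].
    by case: (subZD a sB Bu Bv) => ?; [left; exists B|right].
  move=> a u v [[A FA Au]|Uu] [[B FB Bv]|Uv].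
  - case: (Ftot _ _ FA FB) => [AB|BA]; first by apply: (key A B) => //; left.
    have [sA _] := FP _ FA.
    have Av : (A `|` U) v by left; apply: BA.
    by case: (subZD a sA (or_introl Au : (A `|` U) u) Av) => ?; [left; exists A|right].
  - by apply: (key A A a u v FA FA) => //; [left|right].
  - by apply: (key B B a u v FB FB) => //; [right|left].
  - by right; apply: subZD.
exists (A `|` U); split=> // W sW [AW nWA].
apply: contrapT => nWx; apply: (Amax W).
  by split=> [y Ay|WA]; [apply: AW; left|apply: nWA => y /WA; left].
have -> : P W = (submodule W /\ ~ W x) by rewrite /P setUidl // => y Uy; apply: AW; right.
by split.
Qed.

Section Artinian.
Variable k : comPzRingType.
Hypothesis k_artinian : artinian k.

Lemma artinian_min (F : set (set k^o)) : (forall I, F I -> submodule I) ->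
  F !=set0 -> exists I, F I /\ forall J, F J -> J `<=` I -> J = I.
Proof.
move=> Fsub [I0 FI0]; apply: contrapT => nomin.
have step (I : {I | F I}) : {J : {I | F I} | sval J `<` sval I}.
  apply: cid; case: I => I FI /=; apply: contrapT => nJ; apply: nomin.
  exists I; split=> // J FJ JI; apply: contrapT => neJ; apply: nJ.
  by exists (exist _ J FJ); split=> //= IJ; apply: neJ; apply/seteqP.
have [f [_ fS]] := dependent_choice step (exist _ I0 FI0).
have [||N /(_ N.+1 (leqnSn _)) eN] := k_artinian (I := fun n => sval (f n)).
- by move=> n; apply: Fsub; apply: svalP.
- by move=> n; case: (fS n).
by have [_] := fS N; apply; rewrite -eN.
Qed.

(** The ideals of finite colength, by descending chains with simple factors that start at the whole
    ring. *)
Let reach (I : set k^o) := exists (n : nat) (c : nat -> set k^o),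
  [/\ c 0%N = setT, c n = I, forall i, (i <= n)%N -> submodule (c i) &
      forall i, (i < n)%N -> c i.+1 `<` c i /\
        forall U, submodule U -> c i.+1 `<=` U -> U `<=` c i ->
          U = c i.+1 \/ U = c i].

Lemma reach_step (I J : set k^o) : reach I -> submodule J -> J `<` I ->
  (forall U, submodule U -> J `<=` U -> U `<=` I -> U = J \/ U = I) -> reach J.
Proof.
move=> [n [c [c0 cn csub ccov]]] sJ JI cov.
exists n.+1, (fun i => if (i <= n)%N then c i else J); split=> //.
- by rewrite ltnn.
- by move=> i _; case: leqP => [/csub|].
move=> i; rewrite ltnS => lein; rewrite lein.
move: lein; rewrite leq_eqVlt => /orP[/eqP ->|ltin]; last first.
  by rewrite ltin; apply: ccov.
by rewrite ltnn cn.
Qed.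

(** A minimal ideal [I] of finite colength exists by the descending chain condition. If it is zero,
    the chain leading down to it is a composition series of [k]. If not, [I = m I] for every maximal
    ideal [m] contradicts a Nakayama-type argument on an ideal minimal among those that do not
    annihilate [I]. *)
Lemma artinian_ranked : ranked k^o.
Proof.
have [||I [[n [c [c0 cn csub ccov]]] Imin]] := @artinian_min reach.
- by move=> I [n [c [_ <- csub _]]]; apply: csub.
- by exists setT, 0%N, (fun=> setT); split=> // *; apply: submoduleT.
have sI : submodule I by rewrite -cn; apply: csub.
have rI : reach I by exists n, c.
(* By minimality I has no maximal submodule, so m I = I for m maximal. *)
have mulI (m : set k^o) (P : set k^o) : submodule m -> ~ m 1 ->
    (forall W, submodule W -> m `<` W -> W 1) -> submodule P ->
    (forall (a : k) (y : k^o), m a -> I y -> P (a *: y)) -> I `<=` P.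
  move=> sm nm1 mmax sP mP x Ix; apply: contrapT => nPx.
  have [V [sV PV nVx Vmax]] := max_submodule_avoiding sP nPx.
  have sIV := submoduleI sI sV.
  suff: I `&` V = I by move=> e; apply: nVx; rewrite -e in Ix; case: Ix.
  have decomp y : I y -> ~ V y -> exists c u, [/\ V u, I u & x = u + c *: y].
    move=> Iy nVy; pose Y : set k^o := [set z | exists c, z = c *: y].
    have sY : submodule Y.
      apply/submoduleP; split; first by exists 0; rewrite scale0r.
      by move=> a _ _ [b ->] [d ->]; exists (a * b + d); rewrite scalerDl scalerA.
    have : sum_set V Y x.
      apply: Vmax; first exact: submodule_sum.
      split=> [v Vv|H].
        by exists v, 0; rewrite addr0; split=> //; apply: sub0.
      apply: nVy; apply: H; exists 0, y; rewrite add0r; split=> //; first exact: sub0.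
      by exists 1; rewrite scale1r.
    move=> [u [_ [Vu [d ->] xE]]]; exists d, u; split=> //.
    rewrite (_ : u = x - d *: y); first by apply: subB => //; apply: subZ.
    by rewrite xE addrK.
  apply: Imin; last by move=> y [].
  apply: (reach_step rI) => //; first by split=> [y []|IV] //; case: (IV x Ix).
  move=> W sW IVW WI; case: (pselect (W `<=` V)) => [WV|].
    by left; apply/seteqP; split=> // y Wy; split; [apply: WI|apply: WV].
  move=> /existsNP[y /not_implyP[Wy nVy]].
  right; apply/seteqP; split=> // z Iz.
  have Wx : W x.
    have [c' [u [Vu Iu ->]]] := decomp y (WI _ Wy) nVy.
    by apply: subD => //; [apply: IVW|apply: subZ].
  case: (pselect (V z)) => [Vz|nVz]; first by apply: IVW.
  have [d [u [Vu Iu xE]]] := decomp z Iz nVz.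
  (* Since [m I] lies in [V], the scalar [d] is invertible modulo [m]; solving [x = u + d *: z] for
     [z] then puts [z] in [W], and so the intersection of [I] and [V] is maximal in [I]. *)
  have nmd : ~ m d.
    by move=> md; apply: nVx; rewrite xE; apply: subD => //; apply/PV/mP.
  pose D : set k^o := [set t | exists e, t = e *: (d : k^o)].
  have sD : submodule D.
    apply/submoduleP; split; first by exists 0; rewrite scale0r.
    by move=> a _ _ [b ->] [e ->]; exists (a * b + e); rewrite scalerDl scalerA.
  have [||t [_ [mt [e ->] e1]]] := mmax (sum_set m D).
  - exact: submodule_sum.
  - split=> [v Vv|H]; first by exists v, 0; rewrite addr0; split=> //; apply: sub0.
    apply: nmd; apply: H; exists 0, d; rewrite add0r; split=> //; first exact: sub0.
    by exists 1; rewrite scale1r.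
  have -> : z = t *: z + e *: (x - u).
    rewrite xE [u + _]addrC addrK scalerA -scalerDl.
    by rewrite (_ : t + e * d = 1) ?scale1r.
  apply: subD => //; first by apply: IVW; split; [apply: subZ|apply/PV/mP].
  by apply: subZ => //; apply: subB => //; apply: IVW.
suff I0 : I = [set 0].
  have cs : composition_series n (fun i => c (n - i)%N).
    split; rewrite ?subn0 ?subnn ?cn //.
    - by move=> i _; apply: csub; apply: leq_subr.
    - move=> i ltin; have := ccov (n - i.+1)%N.
      by rewrite subnSK //; apply; apply: leq_subr.
  by exists (series_rank n (fun i => c (n - i)%N)); apply: series_rankP.
apply: contrapT => In0.
have [x Ix x0] : exists2 x, I x & x <> 0.
  apply: contrapT => nx; apply: In0; apply/seteqP; split=> [x Ix|_ ->].
    by apply: contrapT => x0; apply: nx; exists x.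
  exact: sub0.
(* The ideals that do not annihilate [I]. For a minimal one, [J], and [a] in [J] with [a I] nonzero,
   the ideal [m a] is again of this kind because [m I = I]. Hence [m a = J], so [a = b * a] with [b]
   in [m], and [1 - b] annihilates [a]. *)
pose S : set (set k^o) := [set J : set k^o | submodule J /\ exists (a : k) (y : k^o), [/\ J a,
  I y & a *: y <> 0]].
have [J [] //||J [[sJ [a [y [Ja Iy ay0]]]] Jmin]] := @artinian_min S.
  exists setT; split; first exact: submoduleT.
  by exists 1, x; rewrite scale1r.
pose A : set k^o := [set b | (b : k) * a = 0].
have sA : submodule A.
  apply/submoduleP; split; first by rewrite /A /= mul0r.
  move=> e b d Ab Ad; change ((e * (b : k) + d) * a = 0).
  by rewrite mulrDl -mulrA Ab Ad mulr0 addr0.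
have [|m [sm Am nm1 mmax]] := @max_submodule_avoiding k k^o A 1 sA.
  by rewrite /A /= mul1r => a0; apply: ay0; rewrite a0 scale0r.
pose K : set k^o := [set z | exists2 b : k, m b & z = b * a].
have sK : submodule K.
  apply/submoduleP; split; first by exists 0; rewrite ?mul0r //; exact: (sub0 sm).
  move=> e _ _ [b mb ->] [d md ->]; have h := @subZD k k^o m e b d sm mb md.
  exists (e * b + d) => //.
  by change (e * (b * a) + d * a = (e * b + d) * a); rewrite mulrDl mulrA.
have KJ : K = J.
  apply: Jmin; last by move=> _ [b mb ->]; exact: (subZ b sJ Ja).
  split=> //; apply: contrapT => nK; apply: ay0.
  pose P : set k^o := [set z | a * (z : k) = 0].
  have : P y.
    apply: (mulI m P) => //.
      apply/submoduleP; split; first by rewrite /P /= mulr0.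
      move=> e u v Pu Pv; change (a * (e * (u : k) + v) = 0).
      by rewrite mulrDr mulrCA Pu Pv mulr0 addr0.
    move=> b z mb Iz; apply: contrapT => abz; apply: nK; exists (b * a), z.
    split=> //; first by exists b.
    move=> h; apply: abz; change (a * (b * (z : k)) = 0).
    by rewrite mulrA [a * b]mulrC; exact: h.
  by [].
move: Ja; rewrite -KJ => -[b mb ab]; apply: nm1.
rewrite -[1](subrK b); apply: (@subD k k^o m (1 - b) b sm _ mb); apply: Am.
by change ((1 - b) * a = 0); rewrite mulrBl mul1r -ab subrr.
Qed.

End Artinian.

(** * Isomorphisms and direct summands *)

Section Isomorphisms.
Variable R : pzRingType.
Implicit Types A B C D M N : lmodType R.

Lemma bij_inj_surj (S T : Type) (f : S -> T) :
  injective f -> (forall y, exists x, f x = y) -> bijective f.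
Proof.
move=> f_inj f_surj; pose g y := sval (cid (f_surj y)).
have gK : cancel g f by move=> y; apply: svalP (cid (f_surj y)).
by exists g => // x; apply: f_inj; rewrite gK.
Qed.

Lemma linear_injP M N (f : {linear M -> N}) :
  (forall x, f x = 0 -> x = 0) -> injective f.
Proof.
move=> f0 x y fxy; apply/eqP; rewrite -subr_eq0; apply/eqP/f0.
by rewrite linearB fxy subrr.
Qed.

Lemma iso_refl M : iso_mod M M.
Proof. by exists idfun; exists id. Qed.

Lemma iso_sym M N : iso_mod M N -> iso_mod N M.
Proof.
move=> [f f_bij]; have [g fK gK] := f_bij.
have g_lin : linear g.
  by move=> a x y; apply: (bij_inj f_bij); rewrite linearP !gK.
by exists (mklin g_lin); exists f.
Qed.

Lemma iso_trans M N D : iso_mod M N -> iso_mod N D -> iso_mod M D.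
Proof. by move=> [f fb] [g gb]; exists (g \o f : {linear _ -> _}); apply: bij_comp. Qed.

Lemma copair_linear A M N (f : {linear M -> A}) (g : {linear N -> A}) :
  linear (fun x : (M * N)%type => f x.1 + g x.2).
Proof. by move=> a x y; rewrite !linearP scalerDr addrACA. Qed.

Lemma prod_map_linear A B M N (f : {linear A -> M}) (g : {linear B -> N}) :
  linear (fun x : (A * B)%type => (f x.1, g x.2) : (M * N)%type).
Proof. by move=> a x y; rewrite !linearP. Qed.

Lemma inl_linear M N : linear (fun x : M => (x, 0) : (M * N)%type).
Proof. by move=> a x y; rewrite prod_scaleE /= scaler0 pair_addE addr0. Qed.

Lemma inr_linear M N : linear (fun x : N => (0, x) : (M * N)%type).
Proof. by move=> a x y; rewrite prod_scaleE /= scaler0 pair_addE addr0. Qed.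

Lemma fst_linear M N : linear (fun x : (M * N)%type => x.1).
Proof. by []. Qed.

Lemma snd_linear M N : linear (fun x : (M * N)%type => x.2).
Proof. by []. Qed.

Lemma iso_prod A B M N : iso_mod A M -> iso_mod B N -> iso_mod (A * B)%type (M * N)%type.
Proof.
move=> [f [f' fK f'K]] [g [g' gK g'K]]; exists (mklin (prod_map_linear f g)).
exists (fun x => (f' x.1, g' x.2)) => -[x y] /=; first by rewrite fK gK.
by rewrite f'K g'K.
Qed.

Lemma iso_prodA A B M : iso_mod (A * (B * M))%type ((A * B) * M)%type.
Proof.
have lin : linear (fun x : (A * (B * M))%type => ((x.1, x.2.1), x.2.2) : ((A * B) * M)%type).
  by [].
by exists (mklin lin); exists (fun x => (x.1.1, (x.1.2, x.2))) => [[? []]|[[]]].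
Qed.

Lemma iso_prod0l A B : (forall x : A, x = 0) -> iso_mod (A * B)%type B.
Proof.
move=> A0; exists (mklin (@snd_linear A B)); exists (fun y => (0, y)) => // -[x y] /=.
by rewrite (A0 x).
Qed.

Lemma iso_zero A B : (forall x : A, x = 0) -> (forall x : B, x = 0) -> iso_mod A B.
Proof.
move=> A0 B0; have lin : linear (fun _ : A => 0 : B).
  by move=> a x y; rewrite scaler0 addr0.
exists (mklin lin).
by exists (fun=> 0) => x; rewrite ?[RHS]A0 // [RHS]B0.
Qed.

Lemma rV0_eq0 (x : 'rV[R]_0) : x = 0.
Proof. by apply/rowP => -[]. Qed.

Section DirectSums.
Variables (I : Type) (X : I -> lmodType R).

Lemma direct_sum_cat s t :
  iso_mod (direct_sum X (s ++ t)) (direct_sum X s * direct_sum X t)%type.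
Proof.
elim: s => [|i s IHs] /=.
  by apply: iso_sym; apply: iso_prod0l; apply: rV0_eq0.
exact: iso_trans (iso_prod (iso_refl _) IHs) (iso_prodA _ _ _).
Qed.

Lemma direct_sum_iso (J : Type) (Y : J -> lmodType R) (h : I -> J) s :
  (forall i, iso_mod (X i) (Y (h i))) ->
  iso_mod (direct_sum X s) (direct_sum Y (map h s)).
Proof.
move=> XY; elim: s => [|i s IHs] /=; first exact: iso_refl.
exact: iso_prod.
Qed.

End DirectSums.

(** Equivalent to [direct_summand] by [retract_sumP], but composable without constructing
    complements. *)
Definition retract B M :=
  exists (i : {linear B -> M}) (p : {linear M -> B}), cancel i p.

Lemma retract_trans A B M : retract A B -> retract B M -> retract A M.
Proof.
move=> [i [p ipK]] [j [q jqK]]; exists (j \o i : {linear _ -> _}).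
by exists (p \o q : {linear _ -> _}) => x /=; rewrite jqK ipK.
Qed.

Lemma retract_iso B M : iso_mod B M -> retract B M.
Proof.
move=> Biso; have [f [g fK gK]] := Biso; exists f.
have g_lin : linear g by move=> a x y; apply: (can_inj fK); rewrite linearP !gK.
by exists (mklin g_lin).
Qed.

Lemma retract_prodl M N : retract M (M * N)%type.
Proof. by exists (mklin (@inl_linear M N)), (mklin (@fst_linear M N)). Qed.

Lemma retract_prodr M N : retract N (M * N)%type.
Proof. by exists (mklin (@inr_linear M N)), (mklin (@snd_linear M N)). Qed.

Lemma iso_complement M (U V : set M) (sU : submodule U) (sV : submodule V) :
  (forall x, U x -> V x -> x = 0) -> sum_set U V = setT ->
  iso_mod M (sub_lmod sU * sub_lmod sV)%type.
Proof.
move=> UV0 UVT; apply: iso_sym.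
exists (mklin (copair_linear (sub_incl sU) (sub_incl sV))).
apply: bij_inj_surj.
  apply: linear_injP => -[u v] /= uv0.
  have u0 : val u = 0.
    apply: UV0; first exact: sub_valP.
    have -> : val u = - val v by apply/eqP; rewrite -addr_eq0; apply/eqP.
    by apply: subN => //; apply: sub_valP.
  have v0 : val v = 0 by rewrite /sub_incl /= u0 add0r in uv0.
  by congr pair; apply: val_inj.
move=> x; have : sum_set U V x by rewrite UVT.
by move=> [u [v [Uu Vv ->]]]; exists (sub_mk sU Uu, sub_mk sV Vv).
Qed.

Lemma retract_sumP B M : retract B M <-> direct_summand B M.
Proof.
split=> [[i [p ipK]]|[C MBC]]; last first.
  exact: retract_trans (retract_prodl _ _) (retract_iso (iso_sym MBC)).
have sK : submodule (p @^-1` [set 0]) by apply/submodule_preim/submodule0.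
exists (sub_lmod sK); apply: iso_sym.
exists (mklin (copair_linear i (sub_incl sK))); apply: bij_inj_surj.
  apply: linear_injP => -[b c] /= bc0; have pc : p (val c) = 0 := sub_valP c.
  have b0 : b = 0.
    by have := congr1 p bc0; rewrite linear0 linearD ipK [p _]pc addr0.
  by congr pair => //; apply: val_inj; rewrite b0 linear0 add0r in bc0.
move=> x; have px : (p @^-1` [set 0]) (x - i (p x)).
  by rewrite /preimage /set1 /= linearB ipK subrr.
by exists (p x, sub_mk sK px) => /=; rewrite addrC subrK.
Qed.

End Isomorphisms.

(** * Fitting's lemma and decomposition into indecomposables *)

Section Fitting.
Variable R : pzRingType.
Implicit Types A B M N P : lmodType R.

Fixpoint iter_lin M (f : {linear M -> M}) (n : nat) : {linear M -> M} :=
  if n is n'.+1 then (f \o iter_lin f n' : {linear M -> M}) else idfun.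

Lemma iter_linE M (f : {linear M -> M}) n x : iter_lin f n x = iter n f x.
Proof. by elim: n => //= n ->. Qed.

(** The common core of the stabilization of images and of kernels of powers: [mu] is a potential
    that drops at each step where [P] fails. *)
Lemma descent_stable (mu : nat -> nat) (P : nat -> Prop) :
  (forall n, ~ P n -> (mu n.+1 < mu n)%N) -> (forall n, P n -> P n.+1) ->
  forall n, (mu 0 <= n)%N -> P n.
Proof.
move=> dec stab n len; apply: contrapT => nPn.
have nP k : (k <= n)%N -> ~ P k.
  move=> lekn Pk; apply: nPn; rewrite -(subnKC lekn).
  by elim: (n - k)%N => [|j IHj]; rewrite ?addn0 ?addnS //; apply: stab.
have H k : (k <= n.+1)%N -> (mu k + k <= mu 0)%N.
  elim: k => [_|k IHk ltk]; first by rewrite addn0.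
  apply: leq_trans (IHk (ltnW ltk)); rewrite addnS -addSn leq_add2r.
  exact/dec/nP.
have := leq_trans (H _ (leqnn _)) len.
by rewrite addnS ltnNge leq_addl.
Qed.

(** The two clauses say that the kernel and the image of the iterate meet in zero and together span
    [M]. The exponent is a successor so that every vector killed by [f] is killed by the iterate. *)
Lemma fitting M (f : {linear M -> M}) : ranked M ->
  exists n, (forall x, iter n.+1 f (iter n.+1 f x) = 0 -> iter n.+1 f x = 0) /\
    (forall x, exists y, iter n.+1 f x = iter n.+1 f (iter n.+1 f y)).
Proof.
move=> [rho rhoP]; set r := rho setT.
pose D n := range (iter_lin f n); pose K n := iter_lin f n @^-1` [set 0].
have sD n : submodule (D n) by apply/submodule_im/submoduleT.
have sK n : submodule (K n) by apply/submodule_preim/submodule0.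
have ler U : submodule U -> (rho U <= r)%N.
  by move=> sU; apply: (rank_le rhoP sU (submoduleT M)).
have Dstab : forall n, (r <= n)%N -> D n `<=` D n.+1.
  suff H : forall n, (rho (D 0) <= n)%N -> D n `<=` D n.+1.
    by move=> n lern; apply: H; apply: leq_trans lern; apply: ler.
  apply: (descent_stable (mu := fun n => rho (D n))) => n.
    move=> nP; apply: rhoP => //; split=> // _ [x _ <-]; exists (f x) => //.
    by rewrite !iter_linE -iterSr.
  move=> Pn _ [x _ <-].
  have [|y _ yE] := Pn (iter_lin f n x); first by exists x.
  by exists y => //=; rewrite -yE.
have Kstab : forall n, (r <= n)%N -> K n.+1 `<=` K n.
  suff H : forall n, (r - rho (K 0) <= n)%N -> K n.+1 `<=` K n.
    by move=> n lern; apply: H; apply: leq_trans lern; apply: leq_subr.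
  apply: (descent_stable (mu := fun n => (r - rho (K n)))%N) => n.
    move=> nP; have lt : (rho (K n) < rho (K n.+1))%N.
      apply: rhoP => //; split=> // x; rewrite /K /preimage /set1 /= => ->.
      by rewrite linear0.
    by apply: ltn_sub2l => //; apply: leq_trans lt (ler _ (sK _)).
  move=> Pn x; rewrite /K /preimage /set1 /= => x0.
  have := Pn (f x); rewrite /K /preimage /set1 /= !iter_linE -!iterSr !iterS.
  by rewrite iter_linE in x0; apply.
have DD k n : (r <= n)%N -> D n `<=` D (k + n)%N.
  by move=> lern; elim: k => // k IHk x /IHk; apply: Dstab; apply: leq_trans (leq_addl _ _).
have KK k n : (r <= n)%N -> K (k + n)%N `<=` K n.
  move=> lern; elim: k => // k IHk x Kx; apply/IHk/Kstab => //.
  by apply: leq_trans (leq_addl _ _).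
exists r; split=> x.
  by rewrite -iterD -!iter_linE; apply: KK.
have [|y _ yE] := DD r.+1 r.+1 (leqnSn _) (iter_lin f r.+1 x); first by exists x.
by exists y; rewrite -iterD -!iter_linE.
Qed.

Lemma inj_endo_surj M (f : {linear M -> M}) : ranked M ->
  injective f -> forall y, exists x, f x = y.
Proof.
move=> Mr f_inj y; have [n [_ im]] := fitting f Mr.
have it_inj m : injective (iter m f) by elim: m => // m IHm x z /f_inj /IHm.
have [x /it_inj ->] := im y.
by exists (iter n f (iter 0 f x)).
Qed.

Lemma surj_endo_inj M (f : {linear M -> M}) : ranked M ->
  (forall y, exists x, f x = y) -> injective f.
Proof.
move=> Mr f_surj; have [n [ker _]] := fitting f Mr.
have it_surj m y : exists x, iter m f x = y.
  elim: m y => [|m IHm] y; first by exists y.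
  by have [z <-] := f_surj y; have [x <-] := IHm z; exists x.
apply: linear_injP => x fx.
have [z zE] := it_surj n.+1 x.
rewrite -zE; apply: ker; by rewrite zE iterSr fx -iter_linE linear0.
Qed.

(** Phrased with internal complements, so that it applies directly to the kernel and the image of an
    iterate. *)
Definition indecomposable M := (exists x : M, x <> 0) /\
  forall U V : set M, submodule U -> submodule V ->
    (forall x, U x -> V x -> x = 0) -> sum_set U V = setT ->
    (forall x, U x -> x = 0) \/ (forall x, V x -> x = 0).

(* Fitting's lemma makes one of e and 1 - e bijective. *)
Lemma indec_retract_prod B M N : ranked B -> indecomposable B ->
  retract B (M * N)%type -> retract B M \/ retract B N.
Proof.
move=> Br [_ Bindec] [i [p ipK]].
pose i1 := mklin (@fst_linear R M N) \o i : {linear B -> M}.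
pose i2 := mklin (@snd_linear R M N) \o i : {linear B -> N}.
pose p1 := p \o mklin (@inl_linear R M N) : {linear M -> B}.
pose p2 := p \o mklin (@inr_linear R M N) : {linear N -> B}.
have e12 x : p1 (i1 x) + p2 (i2 x) = x.
  by rewrite -[RHS]ipK /= -linearD pair_addE addr0 add0r -surjective_pairing.
have retr (A : lmodType R) (j : {linear B -> A}) (q : {linear A -> B}) :
    injective (q \o j) -> retract B A.
  move=> qj_inj; pose e := q \o j : {linear B -> B}.
  have e_bij : bijective e := bij_inj_surj qj_inj (inj_endo_surj (f := e) Br qj_inj).
  have [g gK Kg] := e_bij.
  have g_lin : linear g.
    by move=> a x y; apply: (bij_inj e_bij); rewrite (linearP e) !Kg.
  by exists j, (mklin g_lin \o q : {linear _ -> _}) => x /=; apply: gK.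
have [n [ker im]] := fitting (p1 \o i1 : {linear B -> B}) Br.
set e := p1 \o i1 in ker im.
pose g := iter_lin (p1 \o i1 : {linear B -> B}) n.+1.
have gE x : g x = iter n.+1 e x by rewrite /g iter_linE.
have [||x x0 gx0||x0|x0] := Bindec (g @^-1` [set 0]) (range g).
- by apply/submodule_preim/submodule0.
- by apply/submodule_im/submoduleT.
- case: gx0 => y _ yE; move: x0; rewrite -yE /preimage /set1 /= !iter_linE.
  exact: ker.
- apply/seteqP; split=> // x _; have [y xy] := im x.
  exists (x - g y), (g y); split; [|by exists y|by rewrite subrK].
  change (g (x - g y) = 0); rewrite linearB !gE xy; exact: subrr.
- left; apply: (retr _ i1 p1); apply: (linear_injP (f := p1 \o i1 : {linear B -> B})).
  move=> x ex0; apply: x0; change (g x = 0).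
  by rewrite gE iterSr (_ : e x = 0) // -(iter_linE (p1 \o i1 : {linear B -> B})) linear0.
(* Here the iterate of [e] vanishes. A vector killed by [p2 \o i2] is fixed by [e], hence lies in
   the range of the iterate and is zero. *)
right; apply: (retr _ i2 p2); apply: (linear_injP (f := p2 \o i2 : {linear B -> B})).
move=> x e2x0; have ex : e x = x by have := e12 x; rewrite [p2 _]e2x0 addr0.
rewrite -[LHS](iter_fix n.+1 ex) -gE; apply: x0; by exists x.
Qed.
End Fitting.

Fixpoint all_prop (T : Type) (P : T -> Prop) (s : seq T) : Prop :=
  if s is x :: s' then P x /\ all_prop P s' else True.

Lemma all_prop_cat (T : Type) (P : T -> Prop) s t :
  all_prop P s -> all_prop P t -> all_prop P (s ++ t).
Proof. by elim: s => //= x s IHs [Px Ps] Pt; split=> //; apply: IHs. Qed.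

Lemma all_prop_nth (T : Type) (P : T -> Prop) x0 s i :
  all_prop P s -> (i < size s)%N -> P (nth x0 s i).
Proof. by elim: s i => // x s IHs [|i] /= [Px Ps] // lti; apply: IHs. Qed.

(** * Finite generation and finite length *)

Section FiniteGeneration.
Variable R : pzRingType.
Implicit Types M N : lmodType R.

Lemma ranked_zero M : (forall x : M, x = 0) -> ranked M.
Proof.
move=> M0; exists (fun=> 0%N) => U V sU sV [_ VU]; case: VU => x _.
by rewrite (M0 x); apply: sub0.
Qed.

Definition lincomb M n (g : 'I_n -> M) (v : 'rV[R]_n) : M := \sum_i v 0 i *: g i.

Lemma lincomb_linear M n (g : 'I_n -> M) : linear (lincomb g).
Proof.
move=> a x y; rewrite /lincomb scaler_sumr -big_split /=.
by apply: eq_bigr => i _; rewrite !mxE scalerDl scalerA.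
Qed.

Lemma row_cons_linear n :
  linear (fun x : (R^o * 'rV[R]_n)%type => row_mx (x.1%:M : 'M_1) x.2 : 'rV[R]_(1 + n)).
Proof.
by move=> a [x v] [y w] /=; rewrite scale_row_mx add_row_mx scale_scalar_mx -raddfD.
Qed.

Lemma row_cons_surj n (v : 'rV[R]_(1 + n)) :
  exists x : (R^o * 'rV[R]_n)%type, row_mx (x.1%:M : 'M_1) x.2 = v.
Proof.
exists (lsubmx v 0 0, rsubmx v) => /=; rewrite -[RHS]hsubmxK; congr row_mx.
by apply/matrixP=> i j; rewrite !ord1 !mxE mulr1n.
Qed.

Lemma ranked_rV n : ranked R^o -> ranked 'rV[R]_n.
Proof.
move=> Rr; elim: n => [|n IHn]; first exact/ranked_zero/rV0_eq0.
exact: (ranked_surj (f := mklin (@row_cons_linear n)) (@row_cons_surj n)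
  (ranked_prod Rr IHn)).
Qed.

Lemma fin_gen_surj M : fin_gen M ->
  exists n (f : {linear 'rV[R]_n -> M}), forall y, exists x, f x = y.
Proof.
move=> [n [g gP]]; exists n, (mklin (lincomb_linear g)) => y.
have [c ->] := gP y; exists (\row_i c i).
by apply: eq_bigr => i _; rewrite mxE.
Qed.

Lemma fin_gen_ranked M : ranked R^o -> fin_gen M -> ranked M.
Proof. by move=> Rr /fin_gen_surj[n [f /ranked_surj]]; apply; apply: ranked_rV. Qed.

(** Take a finite family whose span has the largest rank: adjoining any [x] leaves the rank, hence
    the span, unchanged. *)
Lemma ranked_fin_gen M : ranked M -> fin_gen M.
Proof.
move=> [rho rhoP].
pose S n (g : 'I_n -> M) := range (mklin (lincomb_linear g)).
have sS n g : submodule (@S n g) by apply/submodule_im/submoduleT.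
pose P m := `[< exists n (g : 'I_n -> M), rho (S n g) = m >].
have exP : exists m, P m by exists (rho (S 0 (fun=> 0))); apply/asboolP; exists 0%N, (fun=> 0).
have bP m : P m -> (m <= rho setT)%N.
  move=> /asboolP[n [g <-]]; exact: (rank_le rhoP (sS n g) (submoduleT M)).
case: (ex_maxnP exP bP) => _ /asboolP[n [g <-]] gmax.
exists n, g => x; suff [v _ <-] : S n g x by exists (v 0).
pose g' i : M := if unlift ord0 i is Some j then g j else x.
have gS (v : 'rV_n) (a : R) : lincomb g' (row_mx (a%:M : 'M_1) v) = a *: x + lincomb g v.
  rewrite /lincomb big_ord_recl /g' unlift_none; congr (_ *: _ + _).
    have -> : ord0 = lshift n (ord0 : 'I_1) by apply: val_inj.
    by rewrite (@row_mxEl _ 1 1 n) mxE mulr1n.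
  apply: eq_bigr => i _; rewrite liftK; congr (_ *: _).
  have -> : lift ord0 i = rshift 1 i by apply: val_inj.
  by rewrite (@row_mxEr _ 1 1 n).
have -> : S n g = S n.+1 g'.
  apply: (rank_eq rhoP) => //; last by apply: gmax; apply/asboolP; exists n.+1, g'.
  move=> _ [v _ <-]; exists (row_mx (0%:M : 'M_1) v) => //=.
  by rewrite gS scale0r add0r.
exists (row_mx (1%:M : 'M_1) 0) => //=.
by rewrite gS scale1r /lincomb big1 ?addr0 // => i _; rewrite mxE scale0r.
Qed.

End FiniteGeneration.

(** * Length over the base ring and indecomposable summands *)

Section ArtinAlgebra.
Variables (k : comPzRingType) (L : pzRingType) (phi : {rmorphism k -> L}).
Hypothesis artL : artin_algebra phi.
Implicit Types A B M N P : lmodType L.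

(** Over an artin algebra this is finite generation, by [flen_fin_gen], but in a form that visibly
    passes to submodules. *)
Definition flen M := ranked (restrict_scalars phi M).
Definition len M := comp_length (restrict_scalars phi M).

Lemma restrict_linear M N (f : {linear M -> N}) :
  linear (f : restrict_scalars phi M -> restrict_scalars phi N).
Proof. by move=> a x y; rewrite (linearP f). Qed.

Lemma restrict_prod_linear M N :
  linear (id : (restrict_scalars phi M * restrict_scalars phi N)%type ->
    restrict_scalars phi (M * N)%type).
Proof. by []. Qed.

Lemma iso_restrict M N : iso_mod M N ->
  iso_mod (restrict_scalars phi M) (restrict_scalars phi N).
Proof. by move=> [f f_bij]; exists (mklin (restrict_linear f)). Qed.

Lemma iso_restrict_prod M N :
  iso_mod (restrict_scalars phi M * restrict_scalars phi N)%type
    (restrict_scalars phi (M * N)%type).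
Proof. by exists (mklin (@restrict_prod_linear M N)); exists id. Qed.

Lemma flen_inj M N (f : {linear M -> N}) : injective f -> flen N -> flen M.
Proof. by move=> f_inj; apply: (ranked_inj (f := mklin (restrict_linear f))). Qed.

Lemma flen_surj M N (f : {linear M -> N}) :
  (forall y, exists x, f x = y) -> flen M -> flen N.
Proof. by move=> f_surj; apply: (ranked_surj (f := mklin (restrict_linear f))). Qed.

Lemma flen_iso M N : iso_mod M N -> flen M -> flen N.
Proof.
by move=> [f [g fK gK]]; apply: (flen_surj (f := f)) => y; exists (g y).
Qed.

Lemma flen_prod M N : flen M -> flen N -> flen (M * N)%type.
Proof.
move=> Mr Nr; have [f [g fK gK]] := iso_restrict_prod M N.
by apply: (ranked_surj (f := f)); [move=> y; exists (g y)|apply: ranked_prod].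
Qed.

Lemma len_iso M N : iso_mod M N -> len M = len N.
Proof. by move=> /iso_restrict/comp_length_iso. Qed.

Lemma len_prod M N : flen M -> flen N -> len (M * N)%type = (len M + len N)%N.
Proof.
by move=> Mr Nr; rewrite /len -(comp_length_iso (iso_restrict_prod M N)) comp_length_prod.
Qed.

Lemma len0P M : flen M -> len M = 0%N <-> forall x : M, x = 0.
Proof. exact: comp_length0P. Qed.

Lemma submodule_restrict M (U : set M) :
  submodule U -> submodule (U : set (restrict_scalars phi M)).
Proof.
move=> sU; apply/submoduleP; split; first exact: (sub0 sU).
by move=> a x y Ux Uy; apply: (subZD (phi a) sU Ux Uy).
Qed.

Lemma flen_ranked M : flen M -> ranked M.
Proof.
move=> [rho rhoP]; exists rho => U V sU sV UV.
by apply: rhoP => //; apply: submodule_restrict.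
Qed.

Lemma flen_fin_gen M : fin_gen M <-> flen M.
Proof.
split=> [|/flen_ranked/ranked_fin_gen //].
case: artL => k_art _ L_fg Mfg.
have Lr : flen L^o := fin_gen_ranked (artinian_ranked k_art) L_fg.
have rVr n : flen 'rV[L]_n.
  elim: n => [|n IHn]; first exact/ranked_zero/rV0_eq0.
  exact: (flen_surj (f := mklin (@row_cons_linear L n)) (@row_cons_surj L n)
    (flen_prod Lr IHn)).
by have [n [f f_surj]] := fin_gen_surj Mfg; apply: flen_surj f_surj (rVr n).
Qed.

Lemma flen_direct_sum (I : Type) (X : I -> lmodType L) s :
  (forall i, flen (X i)) -> flen (direct_sum X s).
Proof.
move=> Xf; elim: s => [|i s IHs] /=; first exact/ranked_zero/rV0_eq0.
exact: flen_prod.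
Qed.

Lemma len_direct_sum (I : Type) (X : I -> lmodType L) s :
  (forall i, flen (X i)) -> len (direct_sum X s) = (\sum_(i <- s) len (X i))%N.
Proof.
move=> Xf; elim: s => [|i s IHs] /=.
  by rewrite big_nil; apply/len0P; [apply/ranked_zero/rV0_eq0|apply: rV0_eq0].
by rewrite big_cons len_prod ?IHs //; apply: flen_direct_sum.
Qed.

Lemma retract_flen M N : retract M N -> flen N -> flen M.
Proof. by move=> [i [p ipK]]; apply: (flen_inj (f := i)); apply: can_inj ipK. Qed.

(** Iterates [indec_retract_prod] along the sum. The quantified [i0] is only the default of [nth],
    irrelevant for an index in range. Combined with [indec_retract_iso] it identifies [B] with a
    summand when the summands are indecomposable. *)
Lemma indec_retract_sum B (I : Type) (X : I -> lmodType L) s : flen B ->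
  indecomposable B -> retract B (direct_sum X s) ->
  exists2 j : nat, (j < size s)%N & forall i0, retract B (X (nth i0 s j)).
Proof.
move=> Bf Bi; elim: s => [|i s IHs] /= BX.
  have [i' [p ipK]] := BX; case: Bi => -[x x0] _; case: x0.
  by rewrite -[x]ipK [i' x]rV0_eq0 linear0.
case: (indec_retract_prod (flen_ranked Bf) Bi BX) => [BXi|/IHs[j ltj BXj]].
  by exists 0%N.
by exists j.+1.
Qed.

Lemma indec_retract_iso B M : indecomposable B -> indecomposable M ->
  retract B M -> iso_mod M B.
Proof.
move=> [[b b0] _] [_ Mi] [i [p ipK]].
have [|||||] := Mi (range i) (p @^-1` [set 0]).
- exact/submodule_im/submoduleT.
- exact/submodule_preim/submodule0.
- by move=> _ [x _ <-]; rewrite /preimage /set1 /= ipK => ->; rewrite linear0.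
- apply/seteqP; split=> // x _; exists (i (p x)), (x - i (p x)); split.
  + by exists (p x).
  + by rewrite /preimage /set1 /= linearB ipK subrr.
  + by rewrite addrC subrK.
- by move=> /(_ (i b)) ib0; case: b0; rewrite -[b]ipK ib0 ?linear0 //; exists b.
move=> p0; exists p; apply: bij_inj_surj; last by move=> y; exists (i y).
by apply: linear_injP => x px; apply: p0.
Qed.

Lemma indec_decomposition M : flen M -> exists s : seq (lmodType L),
  all_prop (fun X => indecomposable X /\ flen X) s /\ iso_mod M (direct_sum id s).
Proof.
have [n] := ubnP (len M); elim: n M => // n IHn M; rewrite ltnS => leM Mf.
case: (pselect (forall x : M, x = 0)) => [M0|].
  by exists [::]; split=> //=; apply: iso_zero M0 (@rV0_eq0 L).
move=> /existsNP Mn0; case: (pselect (indecomposable M)) => [Mi|].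
  exists [:: M]; split=> //=.
  apply: iso_sym; have [f [g fK gK]] := @iso_prod0l L 'rV[L]_0 M (@rV0_eq0 L).
  exists (mklin (@fst_linear L M 'rV[L]_0)).
  by exists (fun x => (x, 0)) => // -[x y] /=; rewrite [y]rV0_eq0.
move=> /not_andP[//|/existsNP[U /existsNP[V /not_implyP[sU /not_implyP[sV]]]]].
move=> /not_implyP[UV0 /not_implyP[UVT /not_orP[U0 V0]]].
have MUV := iso_complement sU sV UV0 UVT.
have Uf : flen (sub_lmod sU) := flen_inj (@sub_incl_inj _ _ _ sU) Mf.
have Vf : flen (sub_lmod sV) := flen_inj (@sub_incl_inj _ _ _ sV) Mf.
have lenUV := len_prod Uf Vf; rewrite -(len_iso MUV) in lenUV.
have pos W (sW : submodule W) : flen (sub_lmod sW) -> ~ (forall x : M, W x -> x = 0) ->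
    (0 < len (sub_lmod sW))%N.
  move=> Wf W0; rewrite lt0n; apply/negP => /eqP /(len0P Wf) W0'; apply: W0 => x Wx.
  by rewrite -(sub_mkK sW Wx) [sub_mk _ _]W0'.
have pU := pos _ sU Uf U0; have pV := pos _ sV Vf V0.
have [|//|s [sP Us]] := IHn (sub_lmod sU).
  by apply: leq_trans leM; rewrite lenUV -addn1 leq_add2l.
have [|//|t [tP Vt]] := IHn (sub_lmod sV).
  by apply: leq_trans leM; rewrite lenUV -add1n leq_add2r.
exists (s ++ t); split; first exact: all_prop_cat.
apply: iso_trans MUV _; apply: iso_trans (iso_prod Us Vt) _.
exact/iso_sym/direct_sum_cat.
Qed.

End ArtinAlgebra.

(** * Projective covers and syzygies *)

Section ProjectiveCovers.
Variable L : pzRingType.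
Implicit Types A B M N P Q S T : lmodType L.

Lemma projective_retract P Q : retract Q P -> projective P -> projective Q.
Proof.
move=> [i [p ipK]] Pproj M N g h g_surj.
have [h' h'E] := Pproj M N g (h \o p : {linear _ -> _}) g_surj.
by exists (h' \o i : {linear _ -> _}) => x /=; rewrite h'E /= ipK.
Qed.

Lemma projective_prod P Q : projective P -> projective Q -> projective (P * Q)%type.
Proof.
move=> Pproj Qproj M N g h g_surj.
have [u uE] := Pproj M N g (h \o mklin (@inl_linear L P Q) : {linear _ -> _}) g_surj.
have [v vE] := Qproj M N g (h \o mklin (@inr_linear L P Q) : {linear _ -> _}) g_surj.
exists (mklin (copair_linear u v)) => -[x y] /=.
by rewrite linearD uE vE /= -linearD pair_addE addr0 add0r.
Qed.

Lemma lincomb_delta n (v : 'rV[L]_n) : v = lincomb (fun i => delta_mx 0 i) v.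
Proof. exact: row_sum_delta. Qed.

Lemma linear_lincomb M N n (f : {linear M -> N}) (g : 'I_n -> M) v :
  f (lincomb g v) = lincomb (fun i => f (g i)) v.
Proof. by rewrite /lincomb linear_sum; apply: eq_bigr => i _; rewrite linearZ. Qed.

Lemma projective_rV n : projective 'rV[L]_n.
Proof.
move=> M N g h g_surj.
pose x i := sval (cid (g_surj (h (delta_mx 0 i)))).
have xE i : g (x i) = h (delta_mx 0 i) by rewrite /x; case: cid.
exists (mklin (lincomb_linear x)) => v.
rewrite [LHS](linear_lincomb g) [in RHS](lincomb_delta v) (linear_lincomb h).
by apply: eq_bigr => i _; rewrite xE.
Qed.

Lemma is_syzygy_ker A P (f : {linear P -> A}) : projective_cover f ->
  is_syzygy A (sub_lmod (submodule_preim f (@submodule0 L A))).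
Proof.
move=> fP; exists P, f, (sub_incl (submodule_preim f (@submodule0 L A))).
split=> //; first exact: sub_incl_inj.
exact: range_sub_incl.
Qed.

Lemma superfluousI M (U V : set M) : superfluous V -> U `<=` V -> superfluous U.
Proof.
move=> supV UV W sW H; apply: supV => // x.
by have [u [w [Uu Ww ->]]] := H x; exists u, w; split=> //; apply: UV.
Qed.

(** Two stages. The sum [W'] of [W] and [0 * V] meets [M] in a submodule that together with [U]
    spans [M], so it contains [M], and [W'] is everything. Consequently the intersection of [W] with
    [N] spans [N] together with [V], so [W] contains [N], and then [W = W']. *)
Lemma superfluous_prod M N (U : set M) (V : set N) : submodule V ->
  superfluous U -> superfluous V -> superfluous (U `*` V : set (M * N)%type).
Proof.
move=> sV supU supV W sW H.
have sV' : submodule ([set 0] `*` V : set (M * N)%type).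
  apply/submoduleP; split; first by split=> //; apply: sub0.
  move=> a [x y] [x' y'] [/= -> Vy] [/= -> Vy']; split; last exact: subZD.
  by rewrite /set1 /= scaler0 addr0.
pose W' := sum_set W ([set 0] `*` V).
have sW' : submodule W' by apply: submodule_sum.
have WW' : W `<=` W'.
  by move=> x Wx; exists x, 0; rewrite addr0; split=> //; apply: sub0.
have sA : submodule [set x : M | W' (x, 0)].
  exact: (submodule_preim (mklin (@inl_linear L M N)) sW').
have AT : [set x : M | W' (x, 0)] = setT.
  apply: supU => // x; have [[u v] [[wx wy] [[/= Uu Vv] Ww xE]]] := H (x, 0).
  exists u, (x - u); split=> //; last by rewrite addrC subrK.
  exists (wx, wy), (0, v); split=> //.
  by case: xE => -> ->; rewrite pair_addE [u + _]addrC addrK addr0 [wy + v]addrC.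
have sB : submodule [set y : N | W (0, y)].
  exact: (submodule_preim (mklin (@inr_linear L M N)) sW).
have W'T x y : W' (x, y).
  have [[u v] [[wx wy] [[/= Uu Vv] Ww xE]]] := H (x, y).
  have A1 : W' (u, 0) by have: [set x : M | W' (x, 0)] u by rewrite AT.
  have A2 : W' (0, v) by exists 0, (0, v); rewrite add0r; split=> //; apply: sub0.
  rewrite xE; apply: subD => //; last exact: WW'.
  by have := subD sW' A1 A2; rewrite pair_addE addr0 add0r.
have BT : [set y : N | W (0, y)] = setT.
  apply: supV => // y; have [[wx wy] [[z v] [Ww [/= -> Vv] yE]]] := W'T 0 y.
  exists v, wy; split=> //; last by case: yE => _ ->; rewrite addrC.
  by case: yE => x0 _; rewrite addr0 in x0; rewrite /= x0.
apply/seteqP; split=> // -[x y] _.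
have [[wx wy] [[z v] [Ww [/= -> Vv] ->]]] := W'T x y.
apply: subD => //.
by have: [set y : N | W (0, y)] v by rewrite BT.
Qed.

Lemma projective_cover_prod A B P Q (f : {linear P -> A}) (g : {linear Q -> B}) :
  fin_gen (P * Q)%type -> projective_cover f -> projective_cover g ->
  projective_cover (mklin (prod_map_linear f g)).
Proof.
move=> PQfg [_ Pproj f_surj Ksup] [_ Qproj g_surj K'sup].
split=> //; first exact: projective_prod.
  by move=> [a b]; have [x <-] := f_surj a; have [y <-] := g_surj b; exists (x, y).
have sK' : submodule (g @^-1` [set 0]) by apply/submodule_preim/submodule0.
apply: superfluousI (superfluous_prod sK' Ksup K'sup) _.
by move=> [x y] [/= fx gy]; split.
Qed.

Lemma is_syzygy_prod A B S T :
  (forall P Q, fin_gen P -> fin_gen Q -> @fin_gen L (P * Q)%type) ->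
  is_syzygy A S -> is_syzygy B T -> is_syzygy (A * B)%type (S * T)%type.
Proof.
move=> fgP [P [f [i [fP i_inj iK]]]] [Q [g [j [gQ j_inj jK]]]].
exists (P * Q)%type, (mklin (prod_map_linear f g)), (mklin (prod_map_linear i j)).
split.
- by apply: projective_cover_prod => //; apply: fgP; [case: fP|case: gQ].
- by move=> [x y] [x' y'] /= [/i_inj -> /j_inj ->].
apply/seteqP; split=> [_ [[x y] _ <-]|[x y]].
  have fix0 : (f @^-1` [set 0]) (i x) by rewrite -iK; exists x.
  have gjy0 : (g @^-1` [set 0]) (j y) by rewrite -jK; exists y.
  by rewrite /preimage /set1 /=; congr pair.
move=> [fx gy].
have : (f @^-1` [set 0]) x by [].
rewrite -iK => -[x' _ <-].
have : (g @^-1` [set 0]) y by [].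
by rewrite -jK => -[y' _ <-]; exists (x', y').
Qed.

Lemma is_syzygy_zero A : (forall x : A, x = 0) -> @is_syzygy L A 'rV[L]_0.
Proof.
move=> A0; have lin : linear (fun _ : 'rV[L]_0 => 0 : A).
  by move=> a x y; rewrite scaler0 addr0.
exists 'rV[L]_0, (mklin lin), idfun; split=> //.
  split=> [||y|].
  - by exists 0%N, (fun=> 0) => x; exists (fun=> 0); rewrite [LHS]rV0_eq0 [RHS]rV0_eq0.
  - exact: projective_rV.
  - by exists 0; rewrite [LHS]A0 [RHS]A0.
  - move=> V sV _; apply/seteqP; split=> // x _.
    by rewrite [x]rV0_eq0; apply: sub0.
by apply/seteqP; split=> // x _; exists x.
Qed.

Lemma proj_cover_lift_surj A P Q (f : {linear P -> A}) (g : {linear Q -> A})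
    (h : {linear P -> Q}) : projective_cover g -> (forall y, exists x, f x = y) ->
  (forall x, g (h x) = f x) -> forall y, exists x, h x = y.
Proof.
move=> [_ _ _ gsup] f_surj ghf y.
have : range h y; last by move=> [x _ <-]; exists x.
rewrite (_ : range h = setT) //; apply: gsup.
  exact/submodule_im/submoduleT.
move=> z; have [x fx] := f_surj (g z); exists (z - h x), (h x); split.
- by rewrite /preimage /set1 /= linearB ghf fx subrr.
- by exists x.
- by rewrite subrK.
Qed.

(* Mutually lifting the two covers gives surjections P -> Q -> P, which are
   bijective because P has finite length. *)
Lemma is_syzygy_iso A A' S S' :
  (forall P : lmodType L, fin_gen P -> ranked P) ->
  iso_mod A A' -> is_syzygy A S -> is_syzygy A' S' -> iso_mod S S'.
Proof.
move=> fgr [a a_bij] [P [f [i [fP i_inj iK]]]] [Q [g [j [gQ j_inj jK]]]].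
have [Pfg Pproj f_surj _] := fP; have [_ Qproj g_surj _] := gQ.
have [b aK bK] := a_bij.
have b_lin : linear b by move=> c x y; apply: (can_inj aK); rewrite linearP !bK.
pose b' := mklin b_lin.
have [h hE] := Pproj Q A' g (a \o f : {linear _ -> _}) g_surj.
have [u uE] := Qproj P A f (b' \o g : {linear _ -> _}) f_surj.
have af_surj y : exists x, (a \o f : {linear _ -> _}) x = y.
  by have [x fx] := f_surj (b y); exists x; rewrite /= fx bK.
have bg_surj y : exists x, (b' \o g : {linear _ -> _}) x = y.
  by have [x fx] := g_surj (a y); exists x; rewrite /= fx aK.
have h_surj := proj_cover_lift_surj gQ af_surj hE.
have u_surj := proj_cover_lift_surj fP bg_surj uE.
have h_inj : injective h.
  apply: (@inj_compr _ _ _ u); apply: (surj_endo_inj (f := u \o h : {linear _ -> _}) (fgr _ Pfg)).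
  by move=> y; have [z <-] := u_surj y; have [x <-] := h_surj z; exists x.
have fi s : f (i s) = 0.
  by have: (f @^-1` [set 0]) (i s) by rewrite -iK; exists s.
have gj s : g (j s) = 0.
  by have: (g @^-1` [set 0]) (j s) by rewrite -jK; exists s.
have ex s : exists s', j s' = h (i s).
  have : (g @^-1` [set 0]) (h (i s)) by rewrite /preimage /set1 /= hE /= fi linear0.
  by rewrite -jK => -[s' _ s'E]; exists s'.
pose t s := sval (cid (ex s)).
have tE s : j (t s) = h (i s) by rewrite /t; case: cid.
have t_lin : linear t by move=> c x y; apply: j_inj; rewrite linearP !tE !linearP.
exists (mklin t_lin); apply: bij_inj_surj => [x y /= txy|s'].
  by apply/i_inj/h_inj; rewrite -!tE txy.
have [p hp] := h_surj (j s').
have : (f @^-1` [set 0]) p.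
  apply: (bij_inj a_bij); rewrite linear0 -[LHS]hE hp.
  exact: gj.
rewrite -iK => -[s _ sE]; exists s; apply: j_inj.
by rewrite /= tE sE hp.
Qed.

End ProjectiveCovers.

(** * Syzygies over an artin algebra and the graph they form *)

Section Syzygies.
Variables (k : comPzRingType) (L : pzRingType) (phi : {rmorphism k -> L}).
Hypothesis artL : artin_algebra phi.
Implicit Types A B M N P S : lmodType L.
Local Notation flen := (flen phi).
Local Notation len := (len phi).

(** A projective [P] of least length mapping onto [A] works. If [V] and the kernel of [f] span [P],
    lifting [f] through its restriction to [V] gives an endomorphism [e] of [P] with values in [V]
    and [f \o e = f]. By Fitting's lemma the image of an iterate of [e] is a projective summand that
    still maps onto [A]; minimality kills the complementary kernel, so [e] is bijective and [V] is
    everything. *)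
Lemma projective_cover_exists A : flen A ->
  exists P (f : {linear P -> A}), projective_cover f.
Proof.
move=> /(flen_fin_gen artL)/fin_gen_surj[n0 [f0 f0_surj]].
pose Q m := `[< exists P (f : {linear P -> A}),
  [/\ flen P, projective P, forall y, exists x, f x = y & len P = m] >].
have exQ : exists m, Q m.
  exists (len 'rV[L]_n0); apply/asboolP; exists 'rV[L]_n0, f0; split=> //.
    apply/(flen_fin_gen artL); exists n0, (fun i => delta_mx 0 i) => x.
    by exists (x 0); apply: lincomb_delta.
  exact: projective_rV.
case: (ex_minnP exQ) => _ /asboolP[P [f [Pf Pproj f_surj <-]]] Pmin.
exists P, f; split=> //; first exact/(flen_fin_gen artL).
move=> V sV KV.
have fV_surj y : exists x, (f \o sub_incl sV : {linear _ -> _}) x = y.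
  have [x <-] := f_surj y; have [u [v [fu Vv ->]]] := KV x.
  exists (sub_mk sV Vv); rewrite linearD [f u]fu add0r //.
have [h hE] := Pproj _ _ (f \o sub_incl sV : {linear _ -> _}) f fV_surj.
pose e := sub_incl sV \o h : {linear P -> P}.
have fe x : f (e x) = f x := hE x.
have [n [ker im]] := fitting e (flen_ranked Pf).
pose g := iter_lin e n.+1.
have gE x : g x = iter n.+1 e x by rewrite /g iter_linE.
have fg x : f (g x) = f x.
  by rewrite gE; elim: n.+1 => //= j IHj; rewrite fe.
have sU : submodule (g @^-1` [set 0]) by apply/submodule_preim/submodule0.
have sW : submodule (range g) by apply/submodule_im/submoduleT.
have [||] := iso_complement sU sW.
- move=> x gx [y _ yE]; move: gx; rewrite -yE; change (g (g y) = 0 -> g y = 0).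
  by rewrite !gE; apply: ker.
- apply/seteqP; split=> // x _; have [y xy] := im x.
  exists (x - g y), (g y); split; [|by exists y|by rewrite subrK].
  by change (g (x - g y) = 0); rewrite linearB !gE xy; exact: subrr.
move=> iso isob; have PUW : iso_mod P (sub_lmod sU * sub_lmod sW)%type by exists iso.
have Uf : flen (sub_lmod sU) := flen_inj (@sub_incl_inj _ _ _ sU) Pf.
have Wf : flen (sub_lmod sW) := flen_inj (@sub_incl_inj _ _ _ sW) Pf.
have : (len P <= len (sub_lmod sW))%N.
  apply: Pmin; apply/asboolP; exists (sub_lmod sW), (f \o sub_incl sW : {linear _ -> _}).
  split=> //.
    apply: projective_retract Pproj.
    exact: retract_trans (retract_prodr _ _) (retract_iso (iso_sym PUW)).
  move=> y; have [x <-] := f_surj y.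
  have Wgx : range g (g x) by exists x.
  by exists (sub_mk sW Wgx); rewrite -fg.
rewrite (len_iso phi PUW) (len_prod Uf Wf) -{2}[len (sub_lmod sW)]add0n leq_add2r leqn0.
move=> /eqP/(len0P Uf) U0.
have e_inj : injective e.
  apply: (linear_injP (f := e)) => x ex.
  have gx : (g @^-1` [set 0]) x.
    by change (g x = 0); rewrite gE iterSr ex -iter_linE linear0.
  by rewrite -(sub_mkK sU gx) [sub_mk _ _]U0.
apply/seteqP; split=> // x _.
have [y <-] := inj_endo_surj (flen_ranked Pf) e_inj x.
exact: sub_valP.
Qed.

Lemma Omega_spec A : flen A -> is_syzygy A (Omega A).
Proof.
move=> /projective_cover_exists[P [f /is_syzygy_ker AK]].
rewrite /Omega; case: pselect => [ex|[]]; last by eexists; apply: AK.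
exact: (svalP (cid ex)).
Qed.

Lemma is_syzygy_flen A S : is_syzygy A S -> flen S.
Proof.
move=> [P [f [i [[/(flen_fin_gen artL) Pf _ _ _] i_inj _]]]].
exact: flen_inj i_inj Pf.
Qed.

Lemma flen_Omega A : flen A -> flen (Omega A).
Proof. by move=> /Omega_spec/is_syzygy_flen. Qed.

Lemma fin_gen_prod P Q : fin_gen P -> fin_gen Q -> @fin_gen L (P * Q)%type.
Proof. by rewrite !(flen_fin_gen artL) => *; apply: flen_prod. Qed.

Lemma syzygy_unique A A' S S' : iso_mod A A' -> is_syzygy A S ->
  is_syzygy A' S' -> iso_mod S S'.
Proof. by apply: is_syzygy_iso => P /(flen_fin_gen artL)/flen_ranked. Qed.

Lemma Omega_iso A B : flen A -> iso_mod A B -> iso_mod (Omega A) (Omega B).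
Proof.
move=> Af AB; apply: (syzygy_unique AB (Omega_spec Af) (Omega_spec _)).
exact: flen_iso AB Af.
Qed.

Lemma Omega_prod A B : flen A -> flen B ->
  iso_mod (Omega (A * B)%type) (Omega A * Omega B)%type.
Proof.
move=> Af Bf; apply: syzygy_unique (iso_refl _) (Omega_spec (flen_prod Af Bf)) _.
by apply: is_syzygy_prod fin_gen_prod _ _; apply: Omega_spec.
Qed.

Lemma Omega_zero A : (forall x : A, x = 0) -> iso_mod (Omega A) 'rV[L]_0.
Proof.
move=> A0; apply: syzygy_unique (iso_refl _) (Omega_spec _) (is_syzygy_zero A0).
exact: ranked_zero.
Qed.

Lemma syzygyS n A : syzygy n.+1 A = syzygy n (Omega A).
Proof. by elim: n => //= n ->. Qed.

Lemma syzygyD m n A : syzygy (m + n) A = syzygy m (syzygy n A).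
Proof. by elim: m => //= m ->. Qed.

Lemma flen_syzygy n A : flen A -> flen (syzygy n A).
Proof. by move=> Af; elim: n => //= n; apply: flen_Omega. Qed.

Lemma syzygy_iso n A B : flen A -> iso_mod A B -> iso_mod (syzygy n A) (syzygy n B).
Proof.
by move=> Af AB; elim: n => //= n IHn; apply: Omega_iso => //; apply: flen_syzygy.
Qed.

Lemma syzygy_prod n A B : flen A -> flen B ->
  iso_mod (syzygy n (A * B)%type) (syzygy n A * syzygy n B)%type.
Proof.
move=> Af Bf; elim: n => [|n IHn] /=; first exact: iso_refl.
apply: iso_trans (Omega_iso _ IHn) _; first exact/flen_syzygy/flen_prod.
by apply: Omega_prod; apply: flen_syzygy.
Qed.

Lemma syzygy_zero n A : (forall x : A, x = 0) -> iso_mod (syzygy n A) 'rV[L]_0.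
Proof.
move=> A0; elim: n => [|n IHn] /=; first exact: iso_zero A0 (@rV0_eq0 L).
apply: iso_trans (Omega_iso _ IHn) (Omega_zero (@rV0_eq0 L)).
exact/flen_syzygy/ranked_zero.
Qed.

Lemma syzygy_direct_sum n (I : Type) (X : I -> lmodType L) s :
  (forall i, flen (X i)) ->
  iso_mod (syzygy n (direct_sum X s)) (direct_sum (fun i => syzygy n (X i)) s).
Proof.
move=> Xf; elim: s => [|i s IHs] /=; first exact/syzygy_zero/rV0_eq0.
apply: iso_trans (syzygy_prod _ _ _) (iso_prod (iso_refl _) IHs) => //.
exact: flen_direct_sum.
Qed.

Lemma retract_syzygy n A M : flen M -> retract A M ->
  retract (syzygy n A) (syzygy n M).
Proof.
move=> Mf AM; have Af := retract_flen AM Mf.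
have [C MAC] := (retract_sumP A M).1 AM.
have Cf : flen C.
  apply: retract_flen Mf; apply: retract_trans (retract_prodr A C) _.
  exact/retract_iso/iso_sym.
apply: retract_trans (retract_prodl _ (syzygy n C)) _.
apply/retract_iso/iso_sym; apply: iso_trans (syzygy_iso n Mf MAC) _.
exact: syzygy_prod.
Qed.

Lemma retract_len A M : flen M -> retract A M -> (len A <= len M)%N.
Proof.
move=> Mf AM; have Af := retract_flen AM Mf.
have [C MAC] := (retract_sumP A M).1 AM.
rewrite (len_iso phi MAC) len_prod ?leq_addr //.
have /retract_flen : retract C M; last exact.
by apply: retract_trans (retract_prodr A C) (retract_iso (iso_sym MAC)).
Qed.

Lemma retract_summands M t : retract (direct_sum id t) M ->
  all_prop (fun B => retract B M) t.
Proof.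
elim: t => //= B t IHt BtM; split; last apply: IHt.
  exact: retract_trans (retract_prodl _ _) BtM.
exact: retract_trans (retract_prodr _ _) BtM.
Qed.

Lemma retract_flatten (I : eqType) (d : I -> seq (lmodType L)) s i : i \in s ->
  retract (direct_sum id (d i)) (direct_sum id (flatten (map d s))).
Proof.
elim: s => // j s IHs; rewrite inE => /orP[/eqP ->|/IHs is_] /=.
  apply: retract_trans (retract_prodl _ _) (retract_iso (iso_sym _)).
  exact: direct_sum_cat.
apply: retract_trans is_ (retract_trans (retract_prodr _ _) _).
exact/retract_iso/iso_sym/direct_sum_cat.
Qed.

Lemma all_prop_flatten (I : Type) T (P : T -> Prop) (d : I -> seq T) s :
  (forall i, all_prop P (d i)) -> all_prop P (flatten (map d s)).
Proof. by move=> dP; elim: s => //= i s IHs; apply: all_prop_cat. Qed.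

(** The vertices are [A] and those indecomposable summands of the given [As i] that are retracts of
    some syzygy of [A]. The last restriction makes every vertex an admissible summand [B] and bounds
    its lengths by shifted lengths of [A]. Nonvanishing is claimed away from [v0] only, since [A]
    may be zero. *)
Lemma syzygy_graph A : flen A -> finite_syzygy_type A ->
  exists (V : finType) (X : V -> lmodType L) (s : V -> seq V) (v0 : V),
    [/\ X v0 = A,
        forall v, flen (X v),
        forall v, exists m, retract (X v) (syzygy m A),
        forall v, iso_mod (Omega (X v)) (direct_sum X (s v)) &
        forall v, v != v0 -> ~ (forall x : X v, x = 0)].
Proof.
move=> Af [r [As [Asfg Asyz]]].
have [d dP] : exists d : 'I_r -> seq (lmodType L), forall i,
    all_prop (fun X => indecomposable X /\ flen X) (d i) /\
    iso_mod (As i) (direct_sum id (d i)).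
  have ex i := indec_decomposition ((flen_fin_gen artL _).1 (Asfg i)).
  by exists (fun i => sval (cid (ex i))) => i; apply: svalP (cid (ex i)).
pose S := flatten (map d (enum 'I_r)).
have SP : all_prop (fun X => indecomposable X /\ flen X) S.
  by apply: all_prop_flatten => i; case: (dP i).
(* Every indecomposable retract of a syzygy already occurs, up to isomorphism, in the finite list
   [S]; so decomposing the first syzygy of a vertex leads back to vertices. *)
have ranS m B : flen B -> indecomposable B -> retract B (syzygy m A) ->
    exists2 j, (j < size S)%N & iso_mod (nth A S j) B.
  move=> Bf Bi BA; have [t At] := Asyz m.
  have [j ltj BAj] := indec_retract_sum Bf Bi (retract_trans BA (retract_iso At)).
  case: t ltj BAj {At} => // i0 t ltj /(_ i0); set i := nth i0 _ j => BAi.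
  have [_ Ai] := dP i.
  have BS : retract B (direct_sum id S).
    apply: retract_trans (retract_trans BAi (retract_iso Ai)) _.
    by apply: retract_flatten; rewrite mem_enum.
  have [j' ltj' /(_ A) BSj'] := indec_retract_sum Bf Bi BS.
  exists j' => //; apply: indec_retract_iso BSj' => //.
  by have [] := all_prop_nth A SP ltj'.
pose p (j : 'I_(size S)) := `[< exists m, retract (nth A S j) (syzygy m A) >].
pose V : finType := option {j : 'I_(size S) | p j}.
pose X (v : V) := if v is Some j then nth A S (val j) else A.
have Xf v : flen (X v).
  by case: v => [j|] //=; case: (all_prop_nth A SP (ltn_ord (val j))).
have XA v : exists m, retract (X v) (syzygy m A).
  case: v => [[j /= /asboolP //]|]; exists 0%N; exact/retract_iso/iso_refl.
have ex v : exists s : seq V, iso_mod (Omega (X v)) (direct_sum X s).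
  have [m XvA] := XA v.
  have [t [tP Ot]] := indec_decomposition (flen_Omega (Xf v)).
  have OA : retract (Omega (X v)) (syzygy m.+1 A).
    exact: (retract_syzygy 1 (flen_syzygy m Af) XvA).
  have tA : retract (direct_sum id t) (syzygy m.+1 A).
    exact: retract_trans (retract_iso (iso_sym Ot)) OA.
  suff [s ts] : exists s, iso_mod (direct_sum id t) (direct_sum X s).
    by exists s; apply: iso_trans Ot ts.
  move: (retract_summands tA) tP; elim: t {Ot tA} => [|B t IHt] /=.
    by exists [::]; apply: iso_refl.
  move=> [BA tA] [[Bi Bf] tP]; have [s ts] := IHt tA tP.
  have [j ltj jB] := ranS m.+1 _ Bf Bi BA.
  have pj : p (Ordinal ltj).
    by apply/asboolP; exists m.+1; apply: retract_trans (retract_iso jB) BA.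
  exists (Some (Sub (Ordinal ltj) pj) :: s) => /=.
  by apply: iso_prod ts; apply: iso_sym.
exists V, X, (fun v => sval (cid (ex v))), None; split=> //.
- by move=> v; apply: svalP (cid (ex v)).
- move=> [j|] // _ /=; have [[[x x0] _] _] := all_prop_nth A SP (ltn_ord (val j)).
  by move=> all0; apply: x0.
Qed.

End Syzygies.

(** * Growth of orbits of nonnegative integer matrices *)

Section Growth.
Variable R : realType.
Implicit Types (f g h : nat -> R) (b r : R).

Lemma root_exists (n : nat) (a : R) : 0 <= a -> exists2 y : R, 0 <= y & y ^+ n.+1 = a.
Proof.
move=> a0; have [||x /andP[x0 _]] := @poly_ivt R ('X^(n.+1) - a%:P) 0 (1 + a).
- by rewrite addr_ge0.
- rewrite !hornerE /= expr0n /= sub0r oppr_le0 a0 /= subr_ge0.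
  rewrite exprS; apply: (@le_trans _ _ (1 + a)); first by rewrite lerDr.
  by rewrite ler_peMr ?addr_ge0 // exprn_ege1 // lerDl.
by rewrite rootE !hornerE subr_eq0 => /eqP <-; exists x.
Qed.

(** Fekete's argument. The sequence [a n = S n / K] is supermultiplicative and lies below the
    submultiplicative [S], so each n-th root of [a n] is at most each m-th root of [S m]. The
    supremum of the former separates the two families; [E] is written with powers in place of
    roots. *)
Lemma fekete (S : nat -> R) (K : R) : 1 <= K -> (forall n, 0 < S n) ->
  (forall m n, S (m + n)%N <= S m * S n) -> (forall m n, S m * S n <= K * S (m + n)%N) ->
  exists2 r, 0 < r & forall n, r ^+ n <= S n <= K * r ^+ n.
Proof.
move=> K1 S0 subM supM; have K0 : 0 < K by apply: lt_le_trans K1.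
pose a n := S n / K.
have a0 n : 0 < a n by rewrite divr_gt0.
have aM n m : a n ^+ m.+1 <= a (n * m.+1)%N.
  elim: m => [|m IHm]; first by rewrite expr1 muln1.
  rewrite exprS mulnS; apply: le_trans (ler_wpM2l (ltW (a0 n)) IHm) _.
  rewrite /a mulrACA mulrA ler_pM2r ?invr_gt0 // ler_pdivrMr // [leRHS]mulrC.
  exact: supM.
have SM n m : S (n * m.+1)%N <= S n ^+ m.+1.
  elim: m => [|m IHm]; first by rewrite expr1 muln1.
  rewrite exprS mulnS; apply: le_trans (subM _ _) _.
  by rewrite ler_pM2l.
pose E := [set x : R | 0 <= x /\ exists n, x ^+ n.+1 <= a n.+1].
have aS n : a n <= S n by rewrite /a ler_pdivrMr // ler_peMr // ltW.
have Eub x m : E x -> x ^+ m.+1 <= S m.+1.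
  move=> [x0 [n xn]]; rewrite -(@ler_pXn2r _ n.+1) ?nnegrE ?exprn_ge0 ?(ltW (S0 _)) //.
  apply: le_trans (SM _ _); rewrite -exprM mulnC; apply: le_trans (aS _).
  by apply: le_trans (aM _ _); rewrite exprM; apply: lerXn2r;
    rewrite ?nnegrE ?exprn_ge0 ?(ltW (a0 _)).
have E0 : E 0 by split=> //; exists 0%N; rewrite expr1 ltW.
have Esup : has_sup E.
  by split; [exists 0|exists (S 1%N) => x /(Eub _ 0%N); rewrite expr1].
have Ea n y : 0 <= y -> y ^+ n.+1 = a n.+1 -> y <= sup E.
  by move=> y0 ya; apply: ub_le_sup; [case: Esup|split=> //; exists n; rewrite ya].
have a1 : a 1%N <= sup E by apply: (Ea 0%N); rewrite ?expr1 // ltW.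
have r0 : 0 < sup E by apply: lt_le_trans a1.
exists (sup E) => // -[|n].
  rewrite expr0 mulr1; apply/andP; split.
    by have := subM 0%N 0%N; rewrite addn0 ler_pMl.
  by have := supM 0%N 0%N; rewrite addn0 ler_pM2r.
apply/andP; split.
  have [y y0 yS] := root_exists n (ltW (S0 n.+1)).
  rewrite -yS; apply: lerXn2r; rewrite ?nnegrE ?(ltW r0) //.
  apply: ge_sup; first by exists 0.
  move=> x Ex; rewrite -(@ler_pXn2r _ n.+1) ?nnegrE ?yS //; last by case: Ex.
  exact: Eub.
have [y y0 ya] := root_exists n (ltW (a0 n.+1)).
rewrite mulrC -ler_pdivrMr // -[_ / _]/(a n.+1) -ya.
by apply: lerXn2r; rewrite ?nnegrE ?(ltW r0) //; apply: Ea ya.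
Qed.

(** With [n.+1] in place of [n] the comparison sequence is positive at 0 too, so estimates can be
    stated for all [n] and proved by induction from 0. *)
Definition exp_poly b (l n : nat) : R := b ^+ n * n.+1%:R ^+ l.

Definition growth f b l := 0 < b /\ exists c1 c2, [/\ 0 < c1, 0 < c2 &
  forall n, c1 * exp_poly b l n <= f n <= c2 * exp_poly b l n].

Definition ev_zero f := exists N, forall n, (N <= n)%N -> f n = 0.

Lemma exp_poly_gt0 b l n : 0 < b -> 0 < exp_poly b l n.
Proof. by move=> b0; rewrite mulr_gt0 ?exprn_gt0 ?ltr0n. Qed.

Lemma growth_gt0 f b l n : growth f b l -> 0 < f n.
Proof.
move=> [b0 [c1 [c2 [c10 _ /(_ n)/andP[+ _]]]]].
by apply: lt_le_trans; rewrite mulr_gt0 ?exp_poly_gt0.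
Qed.

Lemma bernoulli (t : R) n : 0 <= t -> 1 + n%:R * t <= (1 + t) ^+ n.
Proof.
move=> t0; elim: n => [|n IHn]; first by rewrite mul0r addr0.
rewrite exprS; apply: le_trans (ler_wpM2l _ IHn); rewrite ?addr_ge0 //.
rewrite mulrDl mul1r mulrDr mulr1 -natr1 mulrDl mul1r.
have : 0 <= t * (n%:R * t) by rewrite !mulr_ge0.
lra.
Qed.

(** Bernoulli's inequality makes the powers of a root [y > 1] of [t] dominate a linear function;
    raising this to a power gives the claim. *)
Lemma poly_exp (t : R) l : 1 < t -> exists2 M, 0 < M & forall n, n.+1%:R ^+ l <= M * t ^+ n.
Proof.
move=> t1; case: l => [|l].
  exists 1 => // n; rewrite expr0 mul1r; apply: exprn_ege1; exact: ltW.
have t0 : 0 <= t by apply/ltW/(lt_trans _ t1).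
have [y y0 yt] := root_exists l t0.
have y1 : 1 < y.
  rewrite ltNge; apply/negP => yle; move: t1; rewrite -yt ltNge.
  by rewrite exprn_ile1.
pose s := y - 1; have s0 : 0 < s by rewrite subr_gt0.
(* Chosen so that [M * (1 + n%:R * s)] is at least [n.+1%:R]: the product of [s^-1] and [n%:R * s]
   contributes [n%:R]. *)
pose M := 1 + s^-1; have M0 : 0 < M by rewrite addr_gt0 // invr_gt0.
exists (M ^+ l.+1) => [|n]; first by rewrite exprn_gt0.
rewrite -yt exprAC -exprMn; apply: lerXn2r; rewrite ?nnegrE ?mulr_ge0 ?exprn_ge0 ?(ltW M0) //.
have := bernoulli n (ltW s0); rewrite [1 + s]addrC subrK => By.
apply: le_trans (ler_wpM2l (ltW M0) By).
have -> : M * (1 + n%:R * s) = 1 + n%:R * s + s^-1 + n%:R * (s^-1 * s) by rewrite /M; ring.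
rewrite mulVf ?gt_eqF // mulr1 -natr1.
have : 0 <= n%:R * s by rewrite mulr_ge0 // ltW.
have : 0 < s^-1 by rewrite invr_gt0.
lra.
Qed.

Lemma exp_poly_dom b l b' l' : 0 < b -> b < b' \/ (b = b' /\ (l <= l')%N) ->
  exists2 M, 0 < M & forall n, exp_poly b l n <= M * exp_poly b' l' n.
Proof.
move=> b0 [bb'|[<- ll']]; last first.
  exists 1 => // n; rewrite mul1r /exp_poly ler_pM2l ?exprn_gt0 //.
  by apply: ler_weXn2l; rewrite ?ler1n.
have b'0 := lt_trans b0 bb'.
have [|M M0 MP] := @poly_exp (b' / b) l; first by rewrite ltr_pdivlMr ?mul1r.
exists M => // n; rewrite /exp_poly; apply: le_trans (ler_wpM2l (exprn_ge0 _ (ltW b0)) (MP n)) _.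
rewrite expr_div_n mulrCA [b ^+ n * _]mulrC divfK ?gt_eqF ?exprn_gt0 // ler_pM2l //.
by rewrite ler_peMr ?exprn_ge0 ?(ltW b'0) // exprn_ege1 // ler1n.
Qed.

Lemma ev_zero_dom f b l : 0 < b -> ev_zero f ->
  exists2 M, 0 < M & forall n, f n <= M * exp_poly b l n.
Proof.
move=> b0 [N fN]; exists (1 + \sum_(i < N) `|f i| / exp_poly b l i) => [|n].
  rewrite ltr_wpDr // sumr_ge0 // => i _.
  by rewrite divr_ge0 // ltW // exp_poly_gt0.
case: (ltnP n N) => [ltn|/fN ->]; last first.
  rewrite mulr_ge0 // ?addr_ge0 ?(ltW (exp_poly_gt0 _ _ b0)) // sumr_ge0 // => i _.
  by rewrite divr_ge0 // ltW // exp_poly_gt0.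
rewrite -ler_pdivrMr ?exp_poly_gt0 // (bigD1 (Ordinal ltn)) //=.
apply: (@le_trans _ _ (`|f n| / exp_poly b l n)).
  by rewrite ler_pM2r ?invr_gt0 ?exp_poly_gt0 // ler_norm.
rewrite addrCA lerDl addr_ge0 // sumr_ge0 // => i _.
by rewrite divr_ge0 // ltW // exp_poly_gt0.
Qed.

Lemma growth_addl f g b l : growth f b l -> (forall n, 0 <= g n) ->
  (exists2 M, 0 < M & forall n, g n <= M * exp_poly b l n) -> growth (fun n => f n + g n) b l.
Proof.
move=> [b0 [c1 [c2 [c10 c20 fP]]]] g0 [M M0 gM]; split=> //.
exists c1, (c2 + M); split=> // [|n]; first by rewrite addr_gt0.
have /andP[f1 f2] := fP n; rewrite (le_trans f1) ?lerDl //=.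
by rewrite mulrDl lerD.
Qed.

Lemma growth_scale f b l (c : R) : 0 < c -> growth f b l -> growth (fun n => c * f n) b l.
Proof.
move=> c0 [b0 [c1 [c2 [c10 c20 fP]]]]; split=> //.
exists (c * c1), (c * c2); split; rewrite ?mulr_gt0 // => n.
by rewrite -!mulrA !ler_pM2l.
Qed.

Lemma growth_dom f b l b' l' : growth f b l -> 
  b < b' \/ (b = b' /\ (l <= l')%N) -> exists2 M, 0 < M & forall n, f n <= M * exp_poly b' l' n.
Proof.
move=> [b0 [c1 [c2 [c10 c20 fP]]]] /(exp_poly_dom b0)[M M0 MP].
exists (c2 * M) => [|n]; first by rewrite mulr_gt0.
by have /andP[_] := fP n; move=> /le_trans; apply; rewrite -mulrA ler_pM2l.
Qed.

Lemma growth_equiv f g b l (K K' : R) : 0 < K -> 0 < K' -> growth f b l ->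
  (forall n, f n <= K * g n) -> (forall n, g n <= K' * f n) -> growth g b l.
Proof.
move=> K0 K'0 [b0 [c1 [c2 [c10 c20 fP]]]] fg gf; split=> //.
exists (c1 / K), (K' * c2); split; rewrite ?divr_gt0 ?mulr_gt0 // => n.
have /andP[f1 f2] := fP n; apply/andP; split.
  by rewrite mulrAC ler_pdivrMr // mulrC [g n * K]mulrC (le_trans _ (fg n)) // mulrC.
by apply: le_trans (gf n) _; rewrite -mulrA ler_pM2l.
Qed.

Lemma growth_shift f g b l : 0 < f 0%N -> (forall n, f n.+1 = g n) ->
  growth g b l -> growth f b l.
Proof.
move=> f0 fg [b0 [c1 [c2 [c10 c20 gP]]]]; split=> //.
have two n : n.+2%:R <= 2 * n.+1%:R :> R by rewrite -natrM ler_nat mul2n doubleS !ltnS -addnn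
  leq_addr.
have sh1 n : exp_poly b l n <= exp_poly b l n.+1 / b.
  rewrite /exp_poly exprS mulrAC [b * _]mulrC mulfK ?gt_eqF // ler_pM2l ?exprn_gt0 //.
  by apply: lerXn2r; rewrite ?nnegrE ?ler_nat.
have sh2 n : exp_poly b l n.+1 <= (b * 2 ^+ l) * exp_poly b l n.
  rewrite /exp_poly exprS mulrACA ler_pM2l ?mulr_gt0 ?exprn_gt0 // -exprMn.
  by apply: lerXn2r; rewrite ?nnegrE ?mulr_ge0.
pose d1 := c1 / (b * 2 ^+ l); pose d2 := c2 / b.
have d10 : 0 < d1 by rewrite divr_gt0 // mulr_gt0 ?exprn_gt0.
have d20 : 0 < d2 by rewrite divr_gt0.
have s0 : exp_poly b l 0 = 1 by rewrite /exp_poly expr0 expr1n mulr1.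
exists (Num.min d1 (f 0%N)), (Num.max d2 (f 0%N)); split.
- by rewrite lt_min d10.
- by rewrite lt_max d20.
move=> [|n]; first by rewrite s0 !mulr1 ge_min le_max !lexx !orbT.
rewrite fg; have /andP[g1 g2] := gP n; apply/andP; split.
  apply: (@le_trans _ _ (d1 * exp_poly b l n.+1)).
    by rewrite ler_pM2r ?exp_poly_gt0 // ge_min lexx.
  apply: le_trans g1; rewrite /d1 -mulrA ler_pM2l // mulrC ler_pdivrMr ?mulr_gt0 ?exprn_gt0 //.
  by rewrite [leRHS]mulrC.
apply: (@le_trans _ _ (d2 * exp_poly b l n.+1)).
  by apply: le_trans g2 _; rewrite /d2 -mulrA ler_pM2l // mulrC.
by rewrite ler_pM2r ?exp_poly_gt0 // le_max lexx.
Qed.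

Section Convolution.
Variables (r : R) (G h : nat -> R).
Hypotheses (r0 : 0 < r) (h0 : h 0%N = 1) (hS : forall n, h n.+1 = r * h n + G n)
  (G0 : forall n, 0 <= G n).

Let h_ge n : r ^+ n <= h n.
Proof.
elim: n => [|n IHn]; first by rewrite h0.
by rewrite hS exprS ler_wpDr // ler_pM2l.
Qed.

(** An inflow of smaller exponential order changes only the constant. Any [t] strictly between [b]
    and [r] absorbs the polynomial factor. *)
Lemma convolution_lt b l (M : R) : 0 < b -> b < r -> 0 < M ->
  (forall n, G n <= M * exp_poly b l n) -> growth h r 0.
Proof.
move=> b0 br M0 GM; split=> //.
pose t := (b + r) / 2.
have [bt tr] : b < t /\ t < r by rewrite /t; split; lra.
have [N N0 NP] := @exp_poly_dom b l t 0 b0 (or_introl bt).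
(* With [D * (r - t) = M * N], the sequence [(1 + D) * r ^+ n - D * t ^+ n] satisfies exactly the
   recursion with inflow [M * N * t ^+ n]. *)
pose D := M * N / (r - t).
have D0 : 0 < D by rewrite divr_gt0 ?mulr_gt0 // subr_gt0.
exists 1, (1 + D); split=> //; first by rewrite addr_gt0.
have rt0 : r - t != 0 by rewrite gt_eqF // subr_gt0.
have U n : h n <= (1 + D) * r ^+ n - D * t ^+ n.
  elim: n => [|n IHn]; first by rewrite h0 !expr0 !mulr1 addrK.
  rewrite hS; apply: le_trans (lerD (ler_wpM2l (ltW r0) IHn) (le_trans (GM n) (ler_wpM2l (ltW
    M0) (NP n)))) _.
  rewrite /exp_poly expr0 mulr1 mulrA.
  have -> : M * N = D * (r - t) by rewrite /D divfK.
  by rewrite !exprS le_eqVlt; apply/orP; left; apply/eqP; ring.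
move=> n; rewrite /exp_poly expr0 mulr1 mul1r h_ge /=.
apply: le_trans (U n) _; rewrite gerBl mulr_ge0 ?(ltW D0) // exprn_ge0 //.
by apply/ltW/(lt_trans b0).
Qed.

(** The inflow dominates: [h n.+1] is at least [G n], and a multiple of [exp_poly b l] bounds [h]
    from above. The growth is read off the shifted sequence and moved back by [growth_shift]. *)
Lemma convolution_gt b l : r < b -> growth G b l -> growth h b l.
Proof.
move=> rb [b0 [c1 [c2 [c10 c20 GP]]]]; split=> //.
have G_growth : growth (fun n => h n.+1) b l; last first.
  have [_ [d1 [d2 [d10 d20 dP]]]] := G_growth.
  have h00 : 0 < h 0%N by rewrite h0.
  by have [] := growth_shift h00 (fun n => erefl) G_growth.
(* [C] satisfies [r * C + c2 <= b * C], which is what the inductive step of the upper bound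
   requires. *)
split=> //; pose C := 1 + c2 / (b - r).
have br : 0 < b - r by rewrite subr_gt0.
have br0 : b - r != 0 by rewrite gt_eqF.
have C0 : 0 < C by rewrite addr_gt0 // divr_gt0.
have sh n : b * exp_poly b l n <= exp_poly b l n.+1.
  rewrite /exp_poly exprS -mulrA !ler_pM2l ?exprn_gt0 //.
  by apply: lerXn2r; rewrite ?nnegrE ?ler_nat.
have U n : h n <= C * exp_poly b l n.
  elim: n => [|n IHn].
    by rewrite h0 /exp_poly expr0 expr1n !mulr1 lerDl divr_ge0 ?(ltW br) // ltW.
  have /andP[_ GC] := GP n.
  rewrite hS; apply: le_trans (lerD (ler_wpM2l (ltW r0) IHn) GC) _.
  apply: le_trans (ler_wpM2l (ltW C0) (sh n)).
  have := exp_poly_gt0 l n b0; move: (exp_poly b l n) => S S0.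
  rewrite !mulrA -mulrDl ler_pM2r //.
  have e : c2 = (C - 1) * (b - r) by rewrite /C addrC addKr divfK.
  by clearbody C; nra.
exists c1, (r * C + c2); split=> // [|n]; first by rewrite addr_gt0 // mulr_gt0.
have /andP[g1 g2] := GP n; rewrite hS; apply/andP; split.
  apply: le_trans g1 _; rewrite lerDr mulr_ge0 ?(ltW r0) //.
  by apply: le_trans (h_ge n); rewrite exprn_ge0 // ltW.
by rewrite mulrDl lerD // -mulrA ler_pM2l.
Qed.

Lemma expr_succ_sub (y : R) m : 0 <= y -> (y + 1) ^+ m.+1 - y ^+ m.+1 <= m.+1%:R * (y + 1) ^+ m.
Proof.
move=> y0; elim: m => [|m IHm]; first by rewrite !expr1 expr0 mulr1 addrC addKr.
have y1 : 0 <= y + 1 by rewrite addr_ge0.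
rewrite exprS [y ^+ m.+2]exprS.
have -> : (y + 1) * (y + 1) ^+ m.+1 - y * y ^+ m.+1 =
  (y + 1) ^+ m.+1 + y * ((y + 1) ^+ m.+1 - y ^+ m.+1) by ring.
rewrite -[m.+2%:R]natr1 mulrDl mul1r addrC lerD2r.
apply: le_trans (ler_wpM2l y0 IHm) _.
rewrite mulrCA ler_wpM2l // exprS ler_wpM2r ?exprn_ge0 // lerDl //.
Qed.

(** In the resonant case [h n / r ^+ n] increases at each step by an amount of order [n ^ l], and
    the partial sums have order [n ^ (l + 1)]. *)
Lemma convolution_eq l : growth G r l -> growth h r l.+1.
Proof.
move=> [_ [c1 [c2 [c10 c20 GP]]]]; split=> //.
(* Bounds the increment of the (l+1)-st power from [n + 1] to [n + 2]: [l.+1] comes from the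
   difference, [2 ^+ l] from comparing [n + 2] with [n + 1]. *)
pose K : R := l.+1%:R * 2 ^+ l; have K0 : 0 < K by rewrite mulr_gt0 ?exprn_gt0 ?ltr0n.
pose d1 := Num.min 1 (c1 / (r * K)); pose d2 := Num.max 1 (c2 / r).
have d10 : 0 < d1 by rewrite lt_min ltr01 divr_gt0 // mulr_gt0.
have d20 : 0 < d2 by rewrite lt_max ltr01.
exists d1, d2; split=> //.
elim=> [|n /andP[IH1 IH2]].
  by rewrite h0 /exp_poly expr0 expr1n !mulr1 ge_min le_max !lexx.
have /andP[G1 G2] := GP n; rewrite hS; apply/andP; split.
  apply: le_trans (lerD (ler_wpM2l (ltW r0) IH1) G1); rewrite /exp_poly.
  have A : d1 * K * r <= c1.
    have d1le : d1 <= c1 / (r * K) by rewrite ge_min lexx orbT.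
    have rK0 : 0 < r * K by rewrite mulr_gt0.
    have e : c1 = c1 / (r * K) * (r * K) by rewrite divfK // gt_eqF.
    rewrite [leRHS]e -mulrA [K * r]mulrC; apply: ler_wpM2r d1le; exact: ltW.
  have B : n.+2%:R ^+ l.+1 - n.+1%:R ^+ l.+1 <= K * n.+1%:R ^+ l :> R.
    rewrite -[n.+2%:R]natr1; apply: le_trans (expr_succ_sub _ _) _ => //.
    rewrite /K -mulrA ler_pM2l ?ltr0n // -exprMn; apply: lerXn2r;
      rewrite ?nnegrE ?addr_ge0 ?mulr_ge0 //.
    by rewrite natr1 -natrM ler_nat mul2n doubleS !ltnS -addnn leq_addr.
  have : d1 * r * r ^+ n * (n.+2%:R ^+ l.+1 - n.+1%:R ^+ l.+1) <=
      d1 * r * r ^+ n * (K * n.+1%:R ^+ l).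
    by rewrite ler_wpM2l // !mulr_ge0 ?exprn_ge0 // ltW.
  have : d1 * K * r * (r ^+ n * n.+1%:R ^+ l) <= c1 * (r ^+ n * n.+1%:R ^+ l).
    by rewrite ler_wpM2r // mulr_ge0 ?exprn_ge0 // ltW.
  rewrite [r ^+ n.+1]exprS; set x := n.+2%:R ^+ l.+1; set y := n.+1%:R ^+ l.+1;
    set z := n.+1%:R ^+ l; set p := r ^+ n.
  set q := c1 * _; clearbody d1 K x y z p q; lra.
apply: le_trans (lerD (ler_wpM2l (ltW r0) IH2) G2) _; rewrite /exp_poly.
have A : c2 <= d2 * r by rewrite -ler_pdivrMr // le_max lexx orbT.
have B : n.+1%:R ^+ l.+1 + n.+1%:R ^+ l <= n.+2%:R ^+ l.+1 :> R.
  have -> : n.+1%:R ^+ l.+1 + n.+1%:R ^+ l = n.+1%:R ^+ l * n.+2%:R :> R.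
    by rewrite exprSr -[n.+2%:R]natr1 mulrDr mulr1.
  by rewrite [leRHS]exprSr ler_wpM2r //; apply: lerXn2r; rewrite ?nnegrE ?ler_nat.
have : d2 * r * r ^+ n * (n.+1%:R ^+ l.+1 + n.+1%:R ^+ l) <= d2 * r * r ^+ n * n.+2%:R ^+ l.+1.
  by rewrite ler_wpM2l // !mulr_ge0 ?exprn_ge0 // ltW.
have : c2 * (r ^+ n * n.+1%:R ^+ l) <= d2 * r * (r ^+ n * n.+1%:R ^+ l).
  by rewrite ler_wpM2r // mulr_ge0 ?exprn_ge0 // ltW.
rewrite [r ^+ n.+1]exprS; set x := n.+2%:R ^+ l.+1; set y := n.+1%:R ^+ l.+1; set z := n.+1%:R ^+ l.
set p := r ^+ n; clearbody d2 x y z p; lra.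
Qed.

End Convolution.
End Growth.

(** * Growth of orbits along the strongly connected classes of a graph *)

Section GraphGrowth.
Variable R : realType.

Section Orbits.
Variables (V : finType) (T : V -> V -> nat).
Implicit Types f g : V -> nat -> R.

Definition step_rel : rel V := [rel v u | (0 < T v u)%N].

Definition is_orbit f := forall v n, f v n.+1 = \sum_u (T v u)%:R * f u n.

Lemma orbit_shift f m : is_orbit f -> is_orbit (fun v n => f v (m + n)%N).
Proof. by move=> fT v n; rewrite addnS fT. Qed.

Lemma orbit_scale f (c : R) : is_orbit f -> is_orbit (fun v n => c * f v n).
Proof.
by move=> fT v n; rewrite fT mulr_sumr; apply: eq_bigr => u _; rewrite mulrCA.
Qed.

Lemma orbit_le f g : is_orbit f -> is_orbit g -> (forall v, f v 0%N <= g v 0%N) ->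
  forall n v, f v n <= g v n.
Proof.
move=> fT gT fg0; elim=> // n IHn v; rewrite fT gT; apply: ler_sum => u _.
by rewrite ler_wpM2l.
Qed.

Lemma orbit_ge0 f : is_orbit f -> (forall v, 0 <= f v 0%N) -> forall n v, 0 <= f v n.
Proof.
move=> fT f0; elim=> // n IHn v; rewrite fT; apply: sumr_ge0 => u _.
by rewrite mulr_ge0.
Qed.

(** [D] bounds every ratio [f v 1 / f v 0], so by comparison of orbits one time step multiplies by
    at most [D]. An edge from [v] to [u] gives [f u n <= f v n.+1 <= D * f v n]; then follow a
    path. *)
Lemma connect_comparable f : is_orbit f -> (forall v, 0 < f v 0%N) ->
  forall v u, connect step_rel v u -> exists2 K, 0 < K & forall n, f u n <= K * f v n.
Proof.
move=> fT f0; have fge0 := orbit_ge0 fT (fun v => ltW (f0 v)).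
pose D := 1 + \sum_v f v 1%N / f v 0%N.
have D0 : 0 < D.
  by rewrite ltr_wpDr // sumr_ge0 // => v _; rewrite divr_ge0 // ltW.
have fD n v : f v n.+1 <= D * f v n.
  rewrite -add1n; apply: (orbit_le (orbit_shift 1 fT) (orbit_scale D fT)) => w.
  rewrite addn0 -ler_pdivrMr // /D (bigD1 w) //= addrCA lerDl addr_ge0 // sumr_ge0 // => u _.
  by rewrite divr_ge0 // ltW.
have edge v u n : step_rel v u -> f u n <= D * f v n.
  move=> /= Tvu; apply: le_trans (fD n v); rewrite fT (bigD1 u) //=.
  apply: (@le_trans _ _ ((T v u)%:R * f u n)); first by rewrite ler_peMl // ler1n.
  by rewrite lerDl sumr_ge0 // => w _; rewrite mulr_ge0.
move=> v u /connectP[p]; elim: p v => [|w p IHp] v /=.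
  by move=> _ ->; exists 1 => // n; rewrite mul1r.
move=> /andP[vw wp] /(IHp _ wp)[K K0 KP]; exists (K * D) => [|n]; first exact: mulr_gt0.
by apply: le_trans (KP n) _; rewrite -mulrA ler_pM2l //; apply: edge.
Qed.

(** As [f] starts at the constant 1, the total [S n] is the sum of the entries of the n-th power of
    [T]. Comparing the orbit shifted by [m] with [S m] times the orbit gives submultiplicativity;
    the reverse inequality up to [Q] holds because connectedness makes each [f v] comparable to the
    total. *)
Lemma irreducible_growth f : is_orbit f -> (forall v, f v 0%N = 1) -> #|V| != 0%N ->
  (forall v u, connect step_rel v u) -> (forall v, exists u, (0 < T v u)%N) ->
  exists r c1 c2, [/\ 0 < r, 0 < c1, 0 < c2 &
    forall v n, c1 * r ^+ n <= f v n <= c2 * r ^+ n].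
Proof.
move=> fT f1 V0 conn succ.
have f0 v : 0 < f v 0%N by rewrite f1.
have fge0 := orbit_ge0 fT (fun v => ltW (f0 v)).
have fgt0 n v : 0 < f v n.
  elim: n v => // n IHn v; have [u Tu] := succ v.
  rewrite fT (bigD1 u) //= ltr_pwDl ?mulr_gt0 ?ltr0n // sumr_ge0 // => w _.
  by rewrite mulr_ge0.
have [v0 _] : exists v0 : V, true.
  by case: (pickP (fun _ : V => true)) => [v|/eq_card0/eqP]; [exists v|rewrite (negPf V0)].
have cK v u := connect_comparable fT f0 (conn v u).
pose K v u := s2val (cid2 (cK v u)).
have K0 v u : 0 < K v u by rewrite /K; case: cid2.
have KP v u n : f u n <= K v u * f v n by rewrite /K; case: cid2.
pose S n := \sum_v f v n.
pose Q := 1 + \sum_v \sum_u K v u.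
have Kge0 v : 0 <= \sum_u K v u by apply: sumr_ge0 => u _; apply: ltW.
have Q1 : 1 <= Q by rewrite lerDl sumr_ge0.
have Q0 : 0 < Q by apply: lt_le_trans Q1.
have SQ v n : S n <= Q * f v n.
  apply: (@le_trans _ _ ((\sum_u K v u) * f v n)).
    by rewrite mulr_suml; apply: ler_sum => u _.
  rewrite ler_pM2r // /Q [X in _ <= 1 + X](bigD1 v) //= addrCA lerDl addr_ge0 // sumr_ge0 //.
have fS v n : f v n <= S n by rewrite /S (bigD1 v) //= lerDl sumr_ge0.
have S0 n : 0 < S n by apply: lt_le_trans (fS v0 n).
have subM m n : S (m + n)%N <= S m * S n.
  rewrite /S mulr_sumr; apply: ler_sum => v _.
  apply: (orbit_le (orbit_shift m fT) (orbit_scale (S m) fT)) => u.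
  by rewrite addn0 f1 mulr1.
have supM m n : S m * S n <= Q * S (m + n)%N.
  rewrite /S !mulr_sumr; apply: ler_sum => v _.
  apply: (orbit_le (orbit_scale (S m) fT) (orbit_scale Q (orbit_shift m fT))) => u.
  by rewrite addn0 f1 mulr1.
have [r r0 rP] := fekete Q1 S0 subM supM.
exists r, Q^-1, Q; split; rewrite ?invr_gt0 // => v n; have /andP[r1 r2] := rP n.
apply/andP; split; last by apply: le_trans (fS v n) r2.
by rewrite ler_pdivrMl //; apply: le_trans (SQ v n).
Qed.

End Orbits.

Section Classes.
Variables (V : finType) (T : V -> V -> nat) (f : V -> nat -> R).
Hypotheses (fT : is_orbit T f) (f0 : forall v, 0 < f v 0%N).
Local Notation e := (step_rel T).

(** The invariant of the recursion over classes. Besides the growth of [h] it carries, for each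
    smaller exponent, a vertex that attains it; these vertices become the summands [B]. *)
Definition good (h : nat -> R) := ev_zero h \/ exists b l, growth h b l /\
  forall s, (s <= l)%N -> exists u, growth (f u) b s.

Lemma good_zero : good (fun=> 0).
Proof. by left; exists 0%N. Qed.

Lemma goodD h h' : (forall n, 0 <= h n) -> (forall n, 0 <= h' n) -> good h -> good h' ->
  good (fun n => h n + h' n).
Proof.
move=> h0 h'0.
have addC (g1 g2 : nat -> R) : (fun n => g1 n + g2 n) = (fun n => g2 n + g1 n).
  by apply/funext => n; rewrite addrC.
have key g1 g2 b l : (forall n, 0 <= g2 n) -> ev_zero g2 -> growth g1 b l ->
    growth (fun n => g1 n + g2 n) b l.
  move=> g20 g2z g1b; apply: growth_addl => //; apply: ev_zero_dom => //.
  by case: g1b.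
case=> [hz|[b [l [hb hw]]]] [h'z|[b' [l' [h'b h'w]]]].
- left; have [N NP] := hz; have [N' N'P] := h'z; exists (N + N')%N => n len.
  rewrite NP ?N'P ?addr0 //; first exact: leq_trans (leq_addl _ _) len.
  exact: leq_trans (leq_addr _ _) len.
- by right; exists b', l'; split=> //; rewrite addC; apply: key.
- by right; exists b, l; split=> //; apply: key.
right; have [lt|gt|eqb] := ltgtP b b'.
- exists b', l'; split=> //; rewrite addC; apply: growth_addl => //.
  by apply: growth_dom hb _; left.
- exists b, l; split=> //; apply: growth_addl => //.
  by apply: growth_dom h'b _; left.
rewrite -eqb in h'b h'w *; case: (leqP l l') => ll'.
  exists b, l'; split=> //; rewrite addC; apply: growth_addl => //.
  by apply: growth_dom hb _; right.
exists b, l; split=> //; apply: growth_addl => //.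
by apply: growth_dom h'b _; right; split=> //; apply: ltnW.
Qed.

Lemma good_sum (I : Type) (r : seq I) (P : pred I) (h : I -> nat -> R) :
  (forall i n, P i -> 0 <= h i n) -> (forall i, P i -> good (h i)) ->
  good (fun n => \sum_(i <- r | P i) h i n).
Proof.
move=> h0 hg; elim: r => [|i r IHr].
  by rewrite (_ : (fun n => _) = (fun=> 0)); [apply: good_zero|apply/funext => n; rewrite big_nil].
rewrite (_ : (fun n => _) = (fun n => (if P i then h i n else 0) + \sum_(j <- r | P j) h j n)).
  apply: goodD => // [n|n|]; first by case: ifP => // /h0.
    by apply: sumr_ge0 => j /h0.
  case: (boolP (P i)) => [Pi|_]; [exact: hg|exact: good_zero].
by apply/funext => n; rewrite big_cons; case: ifP; rewrite ?add0r.
Qed.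

Lemma good_scale h (c : nat) : ((0 < c)%N -> good h) -> good (fun n => c%:R * h n).
Proof.
case: c => [|c] hg.
  by rewrite (_ : (fun n => _) = (fun=> 0)); [apply: good_zero|apply/funext => n; rewrite mul0r].
have c0 : 0 < c.+1%:R :> R by rewrite ltr0n.
case: (hg isT) => [[N hz]|[b [l [hb hw]]]].
  by left; exists N => n /hz ->; rewrite mulr0.
by right; exists b, l; split=> //; apply: growth_scale.
Qed.

Let fge0 : forall n v, 0 <= f v n := orbit_ge0 fT (fun v => ltW (f0 v)).

Section OneClass.
Variable v0 : V.
Definition in_class : pred V := fun u => connect e v0 u && connect e u v0.
Local Notation C := {u : V | in_class u}.

Lemma class_refl : in_class v0.
Proof. by rewrite /in_class !connect0. Qed.

(** Transposed: the sums over powers of [Tr] are the column sums of powers of [T] on the class, to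
    be paired with the values of [f]. *)
Let Tr : C -> C -> nat := fun w u => T (val u) (val w).

Lemma class_connect (w u : C) : connect (step_rel Tr) w u.
Proof.
have H p : forall x y : C, path e (val x) p -> last (val x) p = val y ->
    connect (fun x y : C => e (val x) (val y)) x y.
  elim: p => [|z p IHp] x y /=; first by move=> _ /val_inj ->; apply: connect0.
  move=> /andP[xz zp] lasty.
  have zC : in_class z.
    have /andP[vx xv] := valP x; have /andP[vy yv] := valP y.
    rewrite /in_class (connect_trans vx (connect1 xz)) /=.
    by apply: connect_trans yv; apply/connectP; exists p.
  have xz' : connect (fun x y : C => e (val x) (val y)) x (Sub z zC).
    by apply: connect1; rewrite SubK.
  by apply: connect_trans xz' _; apply: IHp; rewrite SubK.
suff uw : connect (fun x y : C => e (val x) (val y)) u w.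
  have := connect_rev (fun x y : C => e (val x) (val y)) w u.
  by rewrite /= uw.
have /andP[vu uv] := valP u; have /andP[vw wv] := valP w.
have /connectP[p up pw] := connect_trans uv vw.
exact: H up (esym pw).
Qed.

Lemma class_pred : (exists2 u, in_class u & (0 < T v0 u)%N) ->
  forall w : C, exists u : C, (0 < Tr w u)%N.
Proof.
move=> [u uC Tu].
have last_edge (a b : C) : a = b \/ exists c : C, (0 < Tr b c)%N.
  have /connectP[p] := class_connect b a; case: p => [|c p] /=; first by left.
  by move=> /andP[bc _] _; right; exists c.
have v0C := class_refl; move=> w.
case: (last_edge (Sub v0 v0C) w) => [<-|//].
case: (last_edge (Sub u uC) (Sub v0 v0C)) => [uv|//].
exists (Sub v0 v0C); rewrite /Tr SubK.
by have /(congr1 val) := uv; rewrite !SubK => uv0; rewrite -{2}uv0.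
Qed.

Lemma sum_class (F : V -> R) :
  \sum_u F u = \sum_(u : C) F (val u) + \sum_(u | ~~ in_class u) F u.
Proof.
rewrite (bigID in_class) /=; congr (_ + _).
rewrite (reindex_onto (val : C -> V) (insubd (Sub v0 class_refl))) /=.
  by apply: eq_bigl => u; rewrite (valP u) /= [insubd _ _](valKd _ u) eqxx.
by move=> u uC; apply: insubdK.
Qed.

(** If [v0] lies on no cycle, one step leads to lower classes only. Otherwise [E j n] pairs the
    column sums [s j], of order [r ^+ j], with [f] on the class, and is comparable to
    [r ^+ j * h n], where [h] convolves [r] with the total inflow [G] from lower classes. At [j = 0]
    this is comparable to [f v0 n], and the three convolution lemmas apply. *)
Lemma class_good : (forall u, connect e v0 u -> ~~ connect e u v0 -> good (f u)) ->
  good (f v0).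
Proof.
move=> IH.
have IHo w u : in_class w -> (0 < T w u)%N -> ~~ in_class u -> good (f u).
  move=> /andP[v0w wv0] Twu nu.
  have vu : connect e v0 u by apply: connect_trans v0w _; apply: connect1.
  by apply: IH => //; move: nu; rewrite /in_class vu.
case: (pselect (exists2 u, in_class u & (0 < T v0 u)%N)) => [nontriv|triv]; last first.
  have G_good : good (fun n => \sum_u (T v0 u)%:R * f u n).
    apply: good_sum => [u n _|u _]; first by rewrite mulr_ge0.
    apply: good_scale => Tu; apply: (IHo v0) => //; first exact: class_refl.
    by apply/negP => uC; apply: triv; exists u.
  case: G_good => [[N NP]|[b [l [Gb w]]]].
    by left; exists N.+1 => -[//|n]; rewrite ltnS fT => /NP.
  by right; exists b, l; split=> //; apply: growth_shift Gb.
pose s := fix s n (w : C) : R := if n is n'.+1 then \sum_u (Tr w u)%:R * s n' u else 1.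
have sT : is_orbit Tr (fun w n => s n w) by [].
have [|r [c1 [c2 [r0 c10 c20 sP]]]] := irreducible_growth sT (fun=> erefl) _
    class_connect (class_pred nontriv).
  by rewrite -lt0n; apply/card_gt0P; exists (Sub v0 class_refl).
pose g w n := \sum_(u | ~~ in_class u) (T w u)%:R * f u n.
pose G n := \sum_(w : C) g (val w) n.
have g0 w n : 0 <= g w n by apply: sumr_ge0 => u _; rewrite mulr_ge0.
have G0 n : 0 <= G n by apply: sumr_ge0.
have G_good : good G.
  apply: good_sum => // w _; apply: good_sum => [u n _|u nu]; first by rewrite mulr_ge0.
  by apply: good_scale => Tu; apply: (IHo (val w) u) => //; exact: (valP w).
pose h := fix h n := if n is n'.+1 then r * h n' + G n' else 1.
pose E j n := \sum_(w : C) s j w * f (val w) n.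
have ES j n : E j n.+1 = E j.+1 n + \sum_(w : C) s j w * g (val w) n.
  rewrite /E -[X in X + _](_ : \sum_(w : C) s j w * \sum_(u : C) (T (val w) (val u))%:R * f
    (val u) n = _).
    by rewrite -big_split; apply: eq_bigr => w _; rewrite fT sum_class mulrDr.
  under eq_bigr do rewrite mulr_sumr.
  rewrite exchange_big /=; apply: eq_bigr => u _; rewrite mulr_suml.
  by apply: eq_bigr => w _; rewrite /Tr mulrCA mulrA.
pose F0 := \sum_(w : C) f (val w) 0%N.
have F00 : 0 < F0.
  rewrite /F0 (bigD1 (Sub v0 class_refl)) //= ltr_pwDl // sumr_ge0 //.
(* [F0] serves the case [n = 0], while the bound 1 makes the same constants valid for the inflow
   term. *)
pose d1 := c1 * Num.min 1 F0; pose d2 := c2 * Num.max 1 F0.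
have d10 : 0 < d1 by rewrite mulr_gt0 // lt_min ltr01.
have d20 : 0 < d2 by rewrite mulr_gt0 // lt_max ltr01.
have d1c : d1 <= c1 by rewrite /d1 ler_piMr ?(ltW c10) // ge_min lexx.
have d2c : c2 <= d2 by rewrite /d2 ler_peMr ?(ltW c20) // le_max lexx.
(* The claim is uniform in [j] because [ES] trades one step in [n] for one step in [j]. *)
have EP n : forall j, d1 * r ^+ j * h n <= E j n <= d2 * r ^+ j * h n.
  have r0' m : 0 < r ^+ m by rewrite exprn_gt0.
  elim: n => [|n IHn] j.
    rewrite !mulr1; apply/andP; split.
      apply: (@le_trans _ _ (c1 * r ^+ j * F0)).
        rewrite /d1 -!mulrA ler_pM2l // [leLHS]mulrC ler_pM2l // ge_min lexx orbT //.
      rewrite /F0 mulr_sumr; apply: ler_sum => w _; rewrite ler_wpM2r //.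
      by have /andP[] := sP w j.
    apply: (@le_trans _ _ (c2 * r ^+ j * F0)).
      rewrite /F0 mulr_sumr; apply: ler_sum => w _; rewrite ler_wpM2r //.
      by have /andP[] := sP w j.
    by rewrite /d2 -!mulrA ler_pM2l // [leRHS]mulrC ler_pM2l // le_max lexx orbT.
  have /andP[E1 E2] := IHn j.+1; rewrite ES /=.
  have A1 : d1 * r ^+ j * G n <= \sum_(w : C) s j w * g (val w) n.
    rewrite /G mulr_sumr; apply: ler_sum => w _; rewrite ler_wpM2r //.
    have /andP[s1 _] := sP w j; apply: le_trans s1.
    by rewrite ler_pM2r.
  have A2 : \sum_(w : C) s j w * g (val w) n <= d2 * r ^+ j * G n.
    rewrite /G mulr_sumr; apply: ler_sum => w _; rewrite ler_wpM2r //.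
    have /andP[_ s2] := sP w j; apply: le_trans s2 _.
    by rewrite ler_pM2r.
  have X d : d * r ^+ j * (r * h n + G n) = d * r ^+ j.+1 * h n + d * r ^+ j * G n.
    by rewrite mulrDr exprSr !mulrA.
  by rewrite !X !lerD.
have [K K0 KP] : exists2 K, 0 < K & forall n, E 0%N n <= K * f v0 n.
  have ex (w : C) : exists2 K, 0 < K & forall n, f (val w) n <= K * f v0 n.
    by apply: (connect_comparable fT f0); case/andP: (valP w).
  exists (1 + \sum_(w : C) s2val (cid2 (ex w))) => [|n].
    rewrite ltr_pwDl // sumr_ge0 // => w _; case: cid2 => K /= K0 _; exact: ltW.
  rewrite mulrDl mul1r ler_wpDl // /E mulr_suml; apply: ler_sum => w _.
  by rewrite mul1r; case: cid2.
have fE n : f v0 n <= E 0%N n.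
  rewrite /E (bigD1 (Sub v0 class_refl)) //= mul1r lerDl sumr_ge0 // => w _.
  by rewrite mul1r.
have hf b l : growth h b l -> growth (f v0) b l.
  move=> hb; apply: (growth_equiv (K := K / d1) (K' := d2) _ _ hb) => // [|n|n].
  - by rewrite divr_gt0.
  - rewrite mulrAC ler_pdivlMr //; apply: le_trans (KP n).
    by have /andP[] := EP n 0%N; rewrite expr0 mulr1 mulrC.
  by have /andP[_ E2] := EP n 0%N; apply: le_trans (fE n) _; rewrite expr0 mulr1 in E2.
have hS n : h n.+1 = r * h n + G n by [].
have small b l (M : R) : 0 < b -> b < r -> 0 < M -> (forall n, G n <= M * exp_poly b l n) ->
    good (f v0).
  move=> b0 br M0 GM; have hr := convolution_lt r0 erefl hS G0 b0 br M0 GM.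
  right; exists r, 0%N; split=> [|s']; first exact: hf.
  by rewrite leqn0 => /eqP ->; exists v0; apply: hf.
case: G_good => [Gz|[b [l [Gb w]]]].
  (* An eventually zero inflow is bounded by any exponential; [r / 2] is a base below [r]. *)
  have r20 : 0 < r / 2 by rewrite divr_gt0.
  have [M M0 GM] := ev_zero_dom 0%N r20 Gz.
  by apply: small r20 _ M0 GM; rewrite ltr_pdivrMr // ltr_pMr // ltr1n.
have [b0 [e1 [e2 [e10 e20 eP]]]] := Gb.
have [br|rb|eqb] := ltgtP b r.
- by apply: (small b l e2) => // n; case/andP: (eP n).
- by right; exists b, l; split=> //; apply/hf/(convolution_gt r0 erefl hS G0).
rewrite eqb in Gb w; right; exists r, l.+1.
have hr : growth h r l.+1 by apply: (convolution_eq r0 erefl hS).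
split; first exact: hf.
(* The new exponent [l.+1] is attained at [v0], the smaller ones at the vertices recorded for
   [G]. *)
move=> s'; rewrite leq_eqVlt => /orP[/eqP ->|/w //].
by exists v0; apply: hf.
Qed.
End OneClass.

(** Induction on the number of vertices reachable from [v], which drops strictly on leaving its
    class. *)
Theorem orbit_good v : good (f v).
Proof.
have [n] := ubnP #|connect e v|; elim: n v => // n IHn v; rewrite ltnS => len.
apply: class_good => u vu nuv; apply: IHn; apply: leq_trans len.
apply: proper_card; rewrite properE; apply/andP; split.
  by apply/fintype.subsetP => w; rewrite !unfold_in; apply: connect_trans.
apply/negP => /fintype.subsetP sub; have uv : connect e u v := sub v (connect0 e v).
by rewrite uv in nuv.
Qed.

End Classes.
End GraphGrowth.

(** * Minimal polynomials and the spectral radius *)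

Section RationalMinimalPolynomials.
Variable F : numFieldType.
Implicit Types (p q mu : {poly rat}) (x y : F).
Local Notation "p ^@" := (map_poly (ratr : rat -> F) p) (at level 2, format "p ^@").

Definition min_poly_of x mu := [/\ mu \is monic, root mu^@ x &
  forall q, root q^@ x -> mu %| q].

Lemma min_poly_of_exists x q : q != 0 -> root q^@ x -> exists mu, min_poly_of x mu.
Proof.
move=> q0 qx.
pose P n := `[< exists p, [/\ p != 0, root p^@ x & size p = n] >].
have exP : exists n, P n by exists (size q); apply/asboolP; exists q.
case: (ex_minnP exP) => _ /asboolP[p [p0 px <-]] pmin.
have lc0 : (lead_coef p)^-1 != 0 by rewrite invr_eq0 lead_coef_eq0.
exists ((lead_coef p)^-1 *: p); split.
- by rewrite monicE lead_coefZ mulVf // lead_coef_eq0.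
- by rewrite map_polyZ rootZ // fmorph_eq0.
move=> r rx; rewrite dvdpZl // /dvdp; apply: contraT => rp0.
have rpx : root (r %% p)^@ x.
  have /eqP := rx; rewrite {1}(divp_eq r p) rmorphD rmorphM hornerD hornerM.
  by rewrite (eqP px) mulr0 add0r => /eqP.
have : P (size (r %% p)) by apply/asboolP; exists (r %% p).
by move/pmin; rewrite leqNgt ltn_modp p0.
Qed.

Lemma min_poly_of_size x mu : min_poly_of x mu -> (1 < size mu)%N.
Proof.
move=> [mu_mon mux _]; have := root_size_gt1 _ mux.
by rewrite size_map_poly; apply; rewrite map_poly_eq0 monic_neq0.
Qed.

(** If [q] vanishes at [y], then [mu] and [q] share a nonconstant factor [d]. Should [x] be a root
    of the cofactor, [mu] would divide it, making [d] constant; so [x] is a root of [d]. *)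
Lemma min_poly_of_conj x y mu q : min_poly_of x mu -> root mu^@ y ->
  root q^@ x = root q^@ y.
Proof.
move=> muP muy; have [mu_mon mux mu_dvd] := muP; apply/idP/idP => [/mu_dvd/dvdpP[r ->]|qy].
  by rewrite rmorphM rootM muy orbT.
set d := gcdp mu q.
have [e muE] : exists e, mu = e * d by apply/dvdpP/dvdp_gcdl.
have : root e^@ x || root d^@ x by rewrite -rootM -rmorphM -muE.
case/orP => [/mu_dvd mue|dx]; last first.
  have /dvdpP[r ->] : d %| q by apply: dvdp_gcdr.
  by rewrite rmorphM rootM dx orbT.
have mu0 : mu != 0 by rewrite monic_neq0.
have : e * d != 0 by rewrite -muE.
rewrite mulf_eq0 negb_or => /andP[e0 d0].
have d1 : coprimep mu q.
  rewrite /coprimep -/d; have := dvdp_leq e0 mue; rewrite {1}muE size_mul //.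
  have : (0 < size d)%N by rewrite size_poly_gt0.
  have : (0 < size e)%N by rewrite size_poly_gt0.
  by move=> a1 a2 a3; apply/eqP; lia.
have := coprimep_root (p := mu^@) (q := q^@); rewrite coprimep_map => /(_ y d1 muy).
by rewrite (eqP (qy : q^@.[y] == 0)) eqxx.
Qed.

Lemma primitive_element (s : seq F) : (forall x, x \in s -> algebraicOver (ratr : rat -> F) x) ->
  exists2 t, algebraicOver (ratr : rat -> F) t & forall x, x \in s -> exists p, p^@.[t] = x.
Proof.
elim: s => [_|x s IHs sP]; first by exists 0 => //; apply: algebraic0.
have [t t_alg tP] := IHs (fun y ys => sP y (mem_behead (s := x :: s) ys)).
have x_alg := sP x (mem_head _ _).
have [qx qx0 qxx] := x_alg; have [qt qt0 qtt] := t_alg.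
have [n [[px pxE] [pt ptE]]] := pchar0_PET qx0 qxx qt0 qtt (pchar_num _).
exists (t *+ n - x) => [|y].
  apply: algebraic_sub => //; rewrite -mulr_natr; apply: algebraic_mul => //.
  by rewrite -[n%:R](ratr_nat F); apply: algebraic_id.
rewrite inE => /orP[/eqP ->|/tP[p pE]]; first by exists px.
by exists (p \Po pt); rewrite map_comp_poly horner_comp ptE.
Qed.

End RationalMinimalPolynomials.


Section ComplexAbs.
Variable R : realType.
Implicit Types (z w : R[i]) (x : R).

(** The modulus as an element of [R]; the norm of [R[i]] takes its values in [R[i]]. *)
Definition cabs z : R := Normc.normc z.

Lemma cabsE z : `|z| = (cabs z)%:C%C.
Proof. by case: z => a b; rewrite normc_def. Qed.

Lemma cabs_ge0 z : 0 <= cabs z.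
Proof. by have := normr_ge0 z; rewrite cabsE ler0c. Qed.

Lemma cabsM z w : cabs (z * w) = cabs z * cabs w.
Proof. exact: Normc.normcM. Qed.

Lemma cabsD z w : cabs (z + w) <= cabs z + cabs w.
Proof. by have := ler_normD z w; rewrite !cabsE -rmorphD lecR. Qed.

Lemma cabs_real x : cabs x%:C%C = `|x|.
Proof. by rewrite /cabs /= expr0n /= addr0 sqrtr_sqr. Qed.

Lemma cabs0 : cabs 0 = 0.
Proof. by have := cabs_real 0; rewrite normr0. Qed.

Lemma cabs_eq0 z : cabs z = 0 -> z = 0.
Proof. exact: Normc.eq0_normc. Qed.

Lemma cabs1 : cabs 1 = 1.
Proof. by have := cabs_real 1; rewrite normr1. Qed.

Lemma cabsX z n : cabs (z ^+ n) = cabs z ^+ n.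
Proof. by elim: n => [|n IHn]; rewrite ?expr0 ?cabs1 // !exprS cabsM IHn. Qed.

Lemma cabs_sum (I : Type) (r : seq I) (P : pred I) (F : I -> R[i]) :
  cabs (\sum_(i <- r | P i) F i) <= \sum_(i <- r | P i) cabs (F i).
Proof.
elim/big_rec2: _ => [|i y1 y2 _ IH]; first by rewrite cabs0.
by apply: le_trans (cabsD _ _) _; rewrite lerD2l.
Qed.

End ComplexAbs.

Section MinimalPolynomial.
Variable R : realType.
Implicit Types (b : R) (p q : {poly rat}).
Local Notation QtoR := (ratr : rat -> R).

Lemma minimal_poly_dvd b p q : is_minimal_poly b p ->
  root (map_poly QtoR q) b -> p %| q.
Proof.
move=> [p_mon pb pmin] qb; rewrite /dvdp; apply: contraT => r0.
have rb : root (map_poly QtoR (q %% p)) b.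
  rewrite /root; have /eqP <- := qb; rewrite {2}(divp_eq q p) rmorphD rmorphM.
  by rewrite hornerD hornerM (eqP pb) mulr0 add0r.
have := pmin _ r0 rb; rewrite leqNgt ltn_modp.
by rewrite monic_neq0.
Qed.

Lemma min_poly_of_minimal b p : min_poly_of b p -> is_minimal_poly b p.
Proof.
by move=> [p_mon pb pdvd]; split=> // q q0 /pdvd; apply: dvdp_leq.
Qed.

End MinimalPolynomial.

(** * The growth rate as an eigenvalue of largest modulus *)

Section Spectral.
Variable R : realType.
Variables (V : finType) (T : V -> V -> nat) (f : V -> nat -> R) (v0 : V) (b : R) (l : nat).
Hypotheses (fT : is_orbit T f) (f0 : forall v, 0 < f v 0%N).
Hypothesis f_growth : growth (f v0) b l.
Hypothesis f_shift : forall v, exists m, forall n, f v n <= f v0 (n + m)%N.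

Let b0 : 0 < b. Proof. by case: f_growth. Qed.

(** A delay by [m] costs only the constant factor [b ^+ m * m.+1%:R ^+ l]. *)
Lemma orbit_bound v : exists2 C, 0 < C & forall n, f v n <= C * exp_poly b l n.
Proof.
have [_ [c1 [c2 [_ c20 fP]]]] := f_growth; have [m fm] := f_shift v.
exists (c2 * (b ^+ m * m.+1%:R ^+ l)) => [|n].
  by rewrite !mulr_gt0 ?exprn_gt0 ?ltr0n.
apply: le_trans (fm n) _; have /andP[_ f2] := fP (n + m)%N; apply: le_trans f2 _.
rewrite -mulrA ler_pM2l // /exp_poly mulrACA -exprD [(m + n)%N]addnC ler_pM2l ?exprn_gt0 //.
rewrite -exprMn; apply: lerXn2r; rewrite ?nnegrE ?mulr_ge0 // -natrM ler_nat.
by rewrite mulSn mulnS; lia.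
Qed.

(** The transpose of [T], because [eigenvalue] refers to row vectors. *)
Let M : 'M[int]_#|V| := \matrix_(i, j) (T (enum_val j) (enum_val i))%:Z.

Lemma orbit_dominated (x : V -> nat -> R) : (forall v n, 0 <= x v n) ->
  (forall v n, x v n.+1 <= \sum_u (T v u)%:R * x u n) ->
  exists2 K, 0 < K & forall v n, x v n <= K * f v n.
Proof.
move=> x0 xT; have K0 : 0 <= \sum_v x v 0%N / f v 0%N.
  by apply: sumr_ge0 => v _; rewrite divr_ge0 // ltW.
exists (1 + \sum_v x v 0%N / f v 0%N) => [|v n]; first by rewrite ltr_pwDl.
elim: n v => [|n IHn] v.
  rewrite -ler_pdivrMr // (bigD1 v) //= addrCA lerDl addr_ge0 // sumr_ge0 // => u _.
  by rewrite divr_ge0 // ltW.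
apply: le_trans (xT v n) _; rewrite fT mulr_sumr; apply: ler_sum => u _.
by rewrite mulrCA ler_wpM2l.
Qed.

Lemma poly_unbounded (c C : R) k : 0 < c ->
  ~ (forall n, c * n.+1%:R ^+ k.+1 <= C * n.+1%:R ^+ k).
Proof.
move=> c0 H; have := archi_boundP (x := `|C / c|) (normr_ge0 _).
set n := Num.bound _ => Cn; have := H n; rewrite exprSr mulrCA ![_ * _ ^+ k]mulrC.
rewrite ler_pM2l ?exprn_gt0 ?ltr0n // leNgt => /negP; apply.
rewrite mulrC -ltr_pdivrMr //; apply: le_lt_trans (ler_norm _) _.
by apply: lt_trans Cn _; rewrite ltr_nat.
Qed.

Lemma orbit_resolvent (x : V -> R) :
  ~ forall v, b * x v - \sum_u (T v u)%:R * x u = f v 0%N.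
Proof.
move=> xE; pose X := fix X n v := if n is n'.+1 then \sum_u (T v u)%:R * X n' u else x v.
have XS n v : X n.+1 v = b * X n v - f v n.
  elim: n v => [|n IHn] v; first by rewrite -xE opprB addrC subrK.
  transitivity (\sum_u (T v u)%:R * (b * X n u - f u n)).
    by apply: eq_bigr => u _; rewrite -IHn.
  rewrite fT [X n.+1 v]/= mulr_sumr -sumrB; apply: eq_bigr => u _.
  by rewrite mulrBr mulrCA.
have [||K K0 KP] := @orbit_dominated (fun v n => `|X n v|).
- by move=> v n.
- move=> v n /=; apply: le_trans (ler_norm_sum _ _ _) _; apply: ler_sum => u _.
  by rewrite normrM ger0_norm.
pose y n := X n v0 / b ^+ n.
(* Normalized so that [h] solves a convolution recursion with ratio 1 and inflow of order [n ^ l];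
   then [convolution_eq] applies and contradicts the bound on [X]. *)
pose h n := 1 + y 0%N - y n.
pose G n := f v0 n / b ^+ n.+1.
have h0 : h 0%N = 1 by rewrite /h addrK.
have hS n : h n.+1 = 1 * h n + G n.
  rewrite /h /G mul1r -[RHS]addrA; congr (_ + _).
  rewrite /y XS mulrBl opprB [RHS]addrC; congr (_ - _).
  by rewrite exprS invfM mulrACA divff ?gt_eqF // mul1r.
have [_ [c1 [c2 [c10 c20 fP]]]] := f_growth.
have eG n : exp_poly b l n = b ^+ n * exp_poly 1 l n by rewrite /exp_poly expr1n mul1r.
have Gg : growth G 1 l.
  split=> //; exists (c1 / b), (c2 / b); split; rewrite ?divr_gt0 // => n.
  have /andP[f1 f2] := fP n; have bn : 0 < b ^+ n by rewrite exprn_gt0.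
  have -> : G n = f v0 n / b ^+ n / b by rewrite /G exprSr -mulrA -invfM.
  rewrite ![_ / b * _]mulrAC !ler_pM2r ?invr_gt0 // ler_pdivlMr // ler_pdivrMr //.
  by rewrite -(mulrA c1 (exp_poly _ _ _)) -(mulrA c2 (exp_poly _ _ _)) ![exp_poly 1 l n *
    _]mulrC -eG f1 f2.
have G0 n : 0 <= G n by apply/ltW/(growth_gt0 n Gg).
have [_ [d1 [d2 [d10 d20 dP]]]] := convolution_eq ltr01 h0 hS Gg.
apply: (poly_unbounded (C := 1 + `|y 0%N| + K * c2) (k := l) d10) => n.
have /andP[d1P _] := dP n; rewrite /exp_poly expr1n mul1r in d1P.
apply: le_trans d1P _; rewrite /h.
have n1 : 1 <= n.+1%:R ^+ l :> R by rewrite exprn_ege1 // ler1n.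
have yn : - y n <= K * c2 * n.+1%:R ^+ l.
  rewrite /y -mulNr ler_pdivrMr ?exprn_gt0 //; apply: le_trans (ler_norm _) _.
  rewrite normrN; apply: le_trans (KP v0 n) _; rewrite -!mulrA ler_pM2l //.
  have /andP[_ f2] := fP n; apply: le_trans f2 _.
  by rewrite /exp_poly [b ^+ n * _]mulrC.
rewrite [leRHS]mulrDl lerD // -[leLHS]mul1r [leRHS]mulrC [leLHS]mulrC.
have y0 : 1 + y 0%N <= 1 + `|y 0%N| by rewrite lerD2l ler_norm.
have y0' : 0 <= 1 + `|y 0%N| by rewrite addr_ge0.
apply: le_trans (ler_wpM2r _ y0) _ => //.
by rewrite mulr1 mulrC ler_peMr.
Qed.

Local Notation intC := (intr : int -> R[i]).

Lemma eigenvector (F : fieldType) (a : F) :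
  root (map_poly intr (char_poly M)) a ->
  exists x : V -> F, (exists v, x v != 0) /\
    forall v, \sum_u (T v u)%:R * x u = a * x v.
Proof.
rewrite (map_char_poly (intr : {rmorphism int -> F})) -eigenvalue_root_char => /eigenvalueP[x
  xM x0].
exists (fun v => x 0 (enum_rank v)); split.
  have /rV0Pn[i xi] := x0; exists (enum_val i); by rewrite enum_valK.
move=> v; have := congr1 (fun y : 'rV_#|V| => y 0 (enum_rank v)) xM; rewrite !mxE => <-.
rewrite (reindex (enum_val : 'I_#|V| -> V)) /=; last by apply/onW_bij/enum_val_bij.
apply: eq_bigr => i _; rewrite !mxE enum_valK enum_rankK mulrC.
by congr (_ * _); rewrite -pmulrn.
Qed.

Lemma resolvent_vector (a : R) : ~~ root (map_poly intr (char_poly M)) a ->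
  exists x : V -> R, forall v, a * x v - \sum_u (T v u)%:R * x u = f v 0%N.
Proof.
rewrite (map_char_poly (intr : {rmorphism int -> R})) -eigenvalue_root_char.
rewrite /eigenvalue /eigenspace negbK kermx_eq0 row_free_unit => Mu.
pose w : 'rV[R]_#|V| := \row_i f (enum_val i) 0%N.
pose x := - w *m invmx (map_mx intr M - a%:M).
have xE : x *m (map_mx intr M - a%:M) = - w by rewrite /x mulmxKV.
exists (fun v => x 0 (enum_rank v)) => v.
have := congr1 (fun y : 'rV_#|V| => - y 0 (enum_rank v)) xE.
rewrite mulmxBr mul_mx_scalar !mxE enum_rankK opprK opprB => <-; congr (_ - _).
rewrite (reindex (enum_val : 'I_#|V| -> V)) /=; last by apply/onW_bij/enum_val_bij.
apply: eq_bigr => i _; rewrite !mxE enum_valK enum_rankK mulrC.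
by congr (_ * _); rewrite -pmulrn.
Qed.

Lemma spectral_root : root (map_poly intr (char_poly M)) b.
Proof.
by apply: contraT => /resolvent_vector[x]; move=> /orbit_resolvent.
Qed.

(** The moduli of the coordinates of an eigenvector, times [cabs z ^+ n], grow no faster than one
    application of [T] allows, hence stay below a multiple of [f]. A modulus above [b] would outgrow
    [exp_poly b l]. *)
Lemma spectral_bound (z : R[i]) : root (map_poly intr (char_poly M)) z -> cabs z <= b.
Proof.
move=> /eigenvector[x [[v xv] xE]]; rewrite leNgt; apply/negP => bz.
have z0 : 0 < cabs z by apply: lt_trans bz.
have [||K K0 KP] := @orbit_dominated (fun u n => cabs z ^+ n * cabs (x u)).
- by move=> u n; rewrite mulr_ge0 ?exprn_ge0 ?cabs_ge0.
- move=> u n /=; rewrite exprSr -mulrA -cabsM -xE.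
  apply: le_trans (ler_wpM2l _ (cabs_sum _ _ _)) _; first by rewrite exprn_ge0 ?cabs_ge0.
  rewrite mulr_sumr; apply: ler_sum => w _; rewrite cabsM mulrCA.
  have -> : (T u w)%:R = ((T u w)%:R : R)%:C%C :> R[i] by rewrite rmorph_nat.
  by rewrite cabs_real ger0_norm.
have [C C0 CP] := orbit_bound v.
have xv0 : 0 < cabs (x v).
  by rewrite lt_neqAle cabs_ge0 andbT eq_sym; apply: contra_neq xv => /cabs_eq0.
have t1 : 1 < cabs z / b by rewrite ltr_pdivlMr // mul1r.
have [N N0 NP] := poly_exp l.+1 t1.
apply: (poly_unbounded (C := N * (K * C)) (k := l) xv0) => n.
apply: le_trans (ler_wpM2l (ltW xv0) (NP n)) _.
rewrite mulrCA -mulrA ler_pM2l // expr_div_n mulrA ler_pdivrMr ?exprn_gt0 //.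
rewrite [cabs (x v) * _]mulrC; apply: le_trans (KP v n) _.
rewrite -!mulrA ler_pM2l //; apply: le_trans (CP n) _.
by rewrite /exp_poly [b ^+ n * _]mulrC.
Qed.

Lemma spectral_algebraic_integer : algebraic_integer b /\
  exists p : {poly rat}, is_minimal_poly b p /\
    forall z : R[i], root (map_poly (ratr : rat -> R[i]) p) z -> ~ (b%:C%C < `|z|).
Proof.
have bM := spectral_root.
split; first by exists (char_poly M) => //; apply: char_poly_monic.
pose q : {poly rat} := map_poly intr (char_poly M).
have qK (F : numFieldType) : map_poly (ratr : rat -> F) q = map_poly intr (char_poly M).
  by rewrite /q -map_poly_comp; apply: eq_map_poly => i /=; rewrite ratr_int.
have qb : root (map_poly (ratr : rat -> R) q) b by rewrite qK.
have q0 : q != 0 by rewrite monic_neq0 // /q monic_map // char_poly_monic.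
have [p pP] := min_poly_of_exists q0 qb; exists p; split=> [|z pz].
  exact: min_poly_of_minimal.
rewrite cabsE ltcR; apply/negP; rewrite -leNgt; apply: spectral_bound.
have [_ _ /(_ _ qb)/dvdpP[r qE]] := pP; rewrite -qK qE.
by rewrite rmorphM rootM pz orbT.
Qed.

End Spectral.

(** * Conjugates of maximal modulus *)

Section MaximalConjugates.
Variable R : realType.
Local Notation C := R[i].
Local Notation "p ^@" := (map_poly (ratr : rat -> C) p) (at level 2, format "p ^@").

Lemma conj_rational_root (p : {poly rat}) (z : C) : root p^@ z -> root p^@ z^*%C.
Proof.
rewrite -complex_root_conj -map_poly_comp.
rewrite (_ : map_poly _ p = p^@) //; apply: eq_map_poly => a /=.
by rewrite fmorph_rat.
Qed.

(** The resultant in [x] of [f(x) - Y] and [mu(x)] is a rational polynomial in [Y] that vanishes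
    exactly at the values of [f] on the roots of [mu]. It vanishes at [f(t)], so [p] divides it, and
    it vanishes at [z]. This supplies the root that an automorphism would move [t] to. *)
Lemma conjugate_value (t : C) (mu f p : {poly rat}) (z : C) :
  min_poly_of t mu -> min_poly_of f^@.[t] p -> root p^@ z ->
  exists t', root mu^@ t' /\ f^@.[t'] = z.
Proof.
move=> muP pP pz; have [mu_mon mut _] := muP; have mu1 := min_poly_of_size muP.
(* Adding [mu] leaves the values at its roots unchanged. For nonconstant [f] the leading coefficient
   of [P] does not involve [Y], so specializing [Y] commutes with the resultant. *)
wlog f1 : f pP / (1 < size f)%N.
  move=> H; case: (ltnP 1 (size f)) => [|f1]; first exact: H.
  have fm (y : C) : root mu^@ y -> (f + mu)^@.[y] = f^@.[y].
    by move=> /eqP muy; rewrite rmorphD hornerD muy addr0.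
  have [||t' [mut' fz]] := H (f + mu); first by rewrite fm.
    by rewrite addrC size_polyDl // (leq_ltn_trans f1).
  by exists t'; rewrite -fm.
have p_min := pP; have [_ _ pdvd] := p_min.
pose ev (y : C) : {rmorphism {poly rat} -> C} := horner_eval y \o map_poly (ratr : rat -> C).
have evE y q : ev y q = q^@.[y] by [].
pose P : {poly {poly rat}} := map_poly polyC f - 'X%:P.
pose Q : {poly {poly rat}} := map_poly polyC mu.
have PE y : map_poly (ev y) P = f^@ - y%:P.
  rewrite rmorphB /= map_polyC /= -map_poly_comp; congr (_ - _).
    by apply: eq_map_poly => a /=; rewrite /horner_eval map_polyC hornerC.
  by rewrite /horner_eval map_polyX hornerX.
have QE y : map_poly (ev y) Q = mu^@.
  rewrite -map_poly_comp; apply: eq_map_poly => a /=.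
  by rewrite /horner_eval map_polyC hornerC.
have lcP : lead_coef P = (lead_coef f)%:P.
  rewrite lead_coefDl; first by rewrite lead_coef_map_inj //; apply: polyC_inj.
  rewrite size_polyN size_map_inj_poly //; last exact: polyC_inj.
  by apply: leq_ltn_trans (size_polyC_leq1 _) f1.
have lcQ : lead_coef Q = (lead_coef mu)%:P.
  by rewrite lead_coef_map_inj //; apply: polyC_inj.
have res y : (resultant P Q)^@.[y] = resultant (f^@ - y%:P) mu^@.
  rewrite -evE map_resultant ?PE ?QE //.
    rewrite lcP evE map_polyC hornerC fmorph_eq0 lead_coef_eq0 -size_poly_gt0.
    exact: ltnW.
  by rewrite lcQ evE map_polyC hornerC fmorph_eq0 lead_coef_eq0 monic_neq0.
have mu0 : mu^@ != 0 by rewrite map_poly_eq0 monic_neq0.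
have : root (resultant P Q)^@ f^@.[t].
  rewrite /root res resultant_eq0.
  have gt : root (gcdp (f^@ - (f^@.[t])%:P) mu^@) t.
    by rewrite root_gcd mut andbT /root hornerD hornerN hornerC subrr.
  by apply: root_size_gt1 gt; rewrite gcdp_eq0 negb_and mu0 orbT.
move=> /pdvd/dvdpP[r rE].
have : root (resultant P Q)^@ z by rewrite rE rmorphM rootM pz orbT.
rewrite /root res resultant_eq0 => g1.
have [|t'] := closed_rootP (gcdp (f^@ - z%:P) mu^@) _; first by rewrite gtn_eqF.
rewrite root_gcd => /andP[fz mut']; exists t'; split=> //.
by move: fz; rewrite /root hornerD hornerN hornerC subr_eq0 => /eqP.
Qed.

(* An automorphism taking b to a conjugate of maximal modulus permutes the
   conjugates of maximal modulus, because of the relations z * conj z = b ^ 2;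
   hence it fixes the square of their product, which is a power of b. *)
Lemma maximal_conjugates_roots_of_unity (b : R) (p : {poly rat}) : 0 < b ->
  min_poly_of (b%:C%C : C) p -> (forall z : C, root p^@ z -> cabs z <= b) ->
  exists2 m, (0 < m)%N & forall z : C, root p^@ z -> cabs z = b ->
    z ^+ m = (b ^+ m)%:C%C.
Proof.
move=> b0 pP pmax; have [p_mon pb _] := pP.
have p0 : p^@ != 0 by rewrite map_poly_eq0 monic_neq0.
have [rs0 pE] := closed_field_poly_normal p^@.
pose rs := undup rs0.
have rsP z : (z \in rs) = root p^@ z.
  by rewrite mem_undup pE rootZ ?root_prod_XsubC // lead_coef_eq0.
have [t t_alg tP] : exists2 t, algebraicOver (ratr : rat -> C) t &
    forall x, x \in rs -> exists q, q^@.[t] = x.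
  apply: primitive_element => z; rewrite rsP => pz.
  by exists p => //; rewrite monic_neq0.
have [mu muP] : exists mu, min_poly_of t mu.
  by have [q q0 qt] := t_alg; apply: min_poly_of_exists q0 qt.
pose f (z : C) : {poly rat} := if pselect (z \in rs) is left h then sval (cid (tP z h)) else 0.
have fP z : z \in rs -> (f z)^@.[t] = z.
  by move=> zrs; rewrite /f; case: pselect => // h; case: cid.
pose M := [seq z <- rs | cabs z == b].
have MP z : (z \in M) = (z \in rs) && (cabs z == b) by rewrite mem_filter andbC.
have M_uniq : uniq M by rewrite filter_uniq ?undup_uniq.
have Mrs z : z \in M -> z \in rs by rewrite MP => /andP[].
pose bC : C := b%:C%C.
have cb : cabs bC = b by rewrite /bC cabs_real gtr0_norm.
have bM : bC \in M by rewrite MP rsP pb cb eqxx.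
have brs := Mrs _ bM.
have M_conj z : z \in M -> z^*%C \in M.
  rewrite !MP !rsP => /andP[pz zb]; rewrite conj_rational_root //=.
  by have := normcJ z; rewrite !cabsE => /complexI ->.
have mulC z : z \in M -> z * z^*%C = bC ^+ 2.
  rewrite MP => /andP[_ /eqP zb]; rewrite -sqr_normc cabsE zb.
  by [].
(* Conjugation permutes [M] and each [z] times its conjugate is [bC ^+ 2], so the squared product
   over [M] is [bC] to the power [2 * size M]. *)
pose m := (2 * size M)%N.
exists m; first by rewrite muln_gt0 /=; case: M bM {M_uniq Mrs MP M_conj mulC m}.
move=> zj pzj zjb.
have fbP : min_poly_of (f bC)^@.[t] p by rewrite fP.
(* Replacing the primitive element [t] by [t'] is the automorphism in question, sending [bC] to
   [zj]; [transfer] says that it preserves rational relations. *)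
have [t' [mut' ft']] := conjugate_value muP fbP pzj.
have transfer q : q^@.[t] = 0 -> q^@.[t'] = 0.
  by move=> /eqP qt; apply/eqP; have := min_poly_of_conj q muP mut'; rewrite /root qt => /esym.
have transfer' q : q^@.[t'] = 0 -> q^@.[t] = 0.
  by move=> /eqP qt; apply/eqP; have := min_poly_of_conj q muP mut'; rewrite /root qt => ->.
pose sg z := (f z)^@.[t'].
have sg_rs z : z \in rs -> sg z \in rs.
  move=> zrs; rewrite rsP /root /sg -horner_comp -map_comp_poly; apply/eqP/transfer.
  by rewrite map_comp_poly horner_comp fP //; apply/rootP; rewrite -rsP.
have sg_inj : {in rs &, injective sg}.
  move=> z w zrs wrs /eqP; rewrite -subr_eq0 => /eqP zw.
  apply/eqP; rewrite -subr_eq0 -{1}(fP z zrs) -{1}(fP w wrs); apply/eqP.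
  have := transfer' (f z - f w); rewrite rmorphB !hornerD !hornerN; exact.
have sg_mul z : z \in M -> sg z * sg z^*%C = zj ^+ 2.
  move=> zM; have zjM := M_conj z zM.
  apply/eqP; rewrite -subr_eq0; apply/eqP.
  have := transfer (f z * f z^*%C - f bC ^+ 2).
  rewrite !(rmorphB, rmorphM, rmorphXn) /= !hornerE ft'; apply.
  by rewrite !fP ?Mrs // mulC // subrr.
(* The images of [z] and of its conjugate have moduli at most [b] and product of modulus [b ^+ 2],
   so both moduli equal [b]. *)
have sg_M z : z \in M -> sg z \in M.
  move=> zM; rewrite MP sg_rs ?Mrs //= eq_le pmax -?rsP ?sg_rs ?Mrs //=.
  have := congr1 (@cabs R) (sg_mul z zM); rewrite cabsM cabsX zjb => e.
  have c1 : cabs (sg z) <= b by apply: pmax; rewrite -rsP sg_rs ?Mrs.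
  have c2 : cabs (sg z^*%C) <= b by apply: pmax; rewrite -rsP sg_rs ?Mrs ?M_conj.
  rewrite leNgt; apply/negP => lt; move: e; apply/eqP; rewrite lt_eqF // expr2.
  apply: le_lt_trans (ler_wpM2l (cabs_ge0 _) c2) _.
  by rewrite ltr_pM2r.
have perm_M (s : seq C) : uniq s -> {subset s <= M} -> size s = size M -> perm_eq s M.
  move=> s_uniq sM sz; apply: uniq_perm => //.
  by case: (uniq_min_size s_uniq sM _); rewrite ?sz.
have sg_perm : perm_eq (map sg M) M.
  have sgM_uniq : uniq (map sg M).
    by rewrite map_inj_in_uniq // => z w /Mrs zrs /Mrs wrs; apply: sg_inj.
  apply: perm_M; rewrite ?size_map //.
  by move=> _ /mapP[z zM ->]; apply: sg_M.
have conj_perm : perm_eq (map (fun z : C => z^*%C) M) M.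
  have cM_uniq : uniq (map (fun z : C => z^*%C) M).
    by rewrite map_inj_uniq //; apply: (can_inj (@conjcK R)).
  apply: perm_M; rewrite ?size_map //.
  by move=> _ /mapP[z zM ->]; apply: M_conj.
have prod_sq : (\prod_(z <- M) z) ^+ 2 = bC ^+ m.
  rewrite expr2 -{2}(perm_big _ conj_perm) big_map -big_split /=.
  rewrite (eq_big_seq (fun=> bC ^+ 2)); last exact: mulC.
  by rewrite big_const_seq count_predT iter_mulr_1 -exprM.
have prod_sg : (\prod_(z <- M) sg z) ^+ 2 = zj ^+ m.
  apply/eqP; rewrite -subr_eq0; apply/eqP.
  have := transfer ((\prod_(z <- M) f z) ^+ 2 - f bC ^+ m).
  have prodE (u : C) : (\prod_(z <- M) f z)^@.[u] = \prod_(z <- M) (f z)^@.[u].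
    by rewrite rmorph_prod horner_prod.
  rewrite !(rmorphB, rmorphXn) /= !hornerD !hornerN !horner_exp !prodE ft'; apply.
  rewrite fP // (eq_big_seq (fun z => z)); last by move=> z /Mrs; apply: fP.
  by rewrite prod_sq subrr.
rewrite -prod_sg -(big_map sg predT (fun z => z)) (perm_big _ sg_perm) prod_sq.
by rewrite rmorphXn.
Qed.

End MaximalConjugates.

(** * Matrices with a given Perron eigenvalue *)

Section PerronRealization.
Variable R : realType.
Local Notation C := R[i].

(** The positive eigenvector yields an orbit equal to a constant times [b ^+ n] at every vertex, to
    which orbits with other positive initial values are comparable. *)
Definition realizable (b : R) := exists (V : finType) (T : V -> V -> nat) (y : V -> R),
  [/\ exists v : V, true, forall v, 0 < y v &
      forall v, b * y v = \sum_u (T v u)%:R * y u].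

Section Perron.
Variables (g : {poly int}) (mu : R) (rs : seq C).
Hypotheses (g_mon : g \is monic) (mu0 : 0 < mu) (rs_uniq : uniq rs)
  (g_size : size g = (size rs).+1) (g_mu : root (map_poly (intr : int -> R) g) mu)
  (g_rs : forall z, z \in rs -> root (map_poly (intr : int -> C) g) z)
  (rs_lt : forall z, z \in rs -> z = mu%:C%C \/ cabs z < mu)
  (rs_neq0 : rs != [::]).

Definition int_eval (z : C) : {rmorphism {poly int} -> C} :=
  horner_eval z \o map_poly (intr : int -> C).
Definition int_evalR (x : R) : {rmorphism {poly int} -> R} :=
  horner_eval x \o map_poly (intr : int -> R).

Lemma int_eval_real (x : R) q : int_eval x%:C%C q = (int_evalR x q)%:C%C.
Proof.
rewrite /int_eval /int_evalR /= /horner_eval -horner_map -map_poly_comp.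
by congr (_.[_]); apply: eq_map_poly => i /=; rewrite rmorph_int.
Qed.

Lemma int_evalX (z : C) : int_eval z 'X = z.
Proof. by rewrite /int_eval /= /horner_eval map_polyX hornerX. Qed.

Lemma int_evalRX (x : R) : int_evalR x 'X = x.
Proof. by rewrite /int_evalR /= /horner_eval map_polyX hornerX. Qed.

Let D := size rs.
Let val q := int_evalR mu q.

Lemma int_eval_coef z (q : {poly int}) : (size q <= D)%N ->
  int_eval z q = \sum_(i < D) (q`_i)%:~R * z ^+ i.
Proof.
move=> qD; rewrite /int_eval /= /horner_eval (@horner_coef_wide _ D).
  by apply: eq_bigr => i _; rewrite coef_map.
by apply: leq_trans (size_poly _ _) qD.
Qed.

(** The values at the [D] distinct conjugates determine the coefficients through the inverse of the
    Vandermonde matrix. This makes the vertex set of the realization finite. *)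
Lemma coef_bounded (K : R) : exists B : nat, forall q : {poly int}, (size q <= D)%N ->
  (forall z, z \in rs -> cabs (int_eval z q) <= K) -> forall i, `|q`_i| <= B%:Z.
Proof.
pose a : 'rV[C]_D := \row_j rs`_j.
have V_unit : Vandermonde D a \in unitmx.
  rewrite unitmxE det_Vandermonde unitfE; apply/prodf_neq0 => i _.
  apply/prodf_neq0 => j ij; rewrite !mxE subr_eq0.
  by rewrite nth_uniq // gt_eqF.
pose W := invmx (Vandermonde D a).
pose K' : R := \sum_(i < D) \sum_(j < D) `|K| * cabs (W j i).
exists (Num.bound K') => q qD qK i.
case: (ltnP i D) => [ltiD|leDi]; last by rewrite nth_default ?normr0 // (leq_trans qD).
pose x : 'rV[C]_D := \row_i (q`_i)%:~R.
have xV : x *m Vandermonde D a = \row_j int_eval rs`_j q.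
  apply/rowP => j; rewrite !mxE int_eval_coef //; apply: eq_bigr => k _.
  by rewrite !mxE.
have xi : (q`_i)%:~R = \sum_(j < D) int_eval rs`_j q * W j (Ordinal ltiD).
  have : x = (\row_j int_eval rs`_j q) *m W by rewrite -xV mulmxK.
  move=> /(congr1 (fun u : 'rV_D => u 0 (Ordinal ltiD))); rewrite !mxE /= => ->.
  by apply: eq_bigr => j _; rewrite mxE.
have K'0 : 0 <= K'.
  by apply: sumr_ge0 => k _; apply: sumr_ge0 => j _; rewrite mulr_ge0 ?cabs_ge0.
have qi : `|(q`_i)%:~R : R| <= K'.
  have -> : `|(q`_i)%:~R : R| = cabs ((q`_i)%:~R : C).
    by rewrite -cabs_real; congr cabs; rewrite rmorph_int.
  rewrite xi; apply: le_trans (cabs_sum _ _ _) _.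
  rewrite /K' [leRHS](bigD1 (Ordinal ltiD)) //= ler_wpDr //.
    by apply: sumr_ge0 => k _; apply: sumr_ge0 => j _; rewrite mulr_ge0 ?cabs_ge0.
  apply: ler_sum => j _; rewrite cabsM ler_wpM2r ?cabs_ge0 //.
  by apply: le_trans (qK _ _) (ler_norm _); apply: mem_nth.
rewrite -(ler_int R) intr_norm; apply: le_trans qi _.
by apply/ltW; have := archi_boundP K'0.
Qed.

Lemma gap : exists2 rho : R, 0 <= rho < 1 &
  forall z, z \in rs -> z = mu%:C%C \/ cabs z <= rho * mu.
Proof.
have : forall s : seq C, {subset s <= rs} -> exists2 rho : R, 0 <= rho < 1 &
    forall z, z \in s -> z = mu%:C%C \/ cabs z <= rho * mu.
  elim=> [_|z s IHs sub]; first by exists 0; rewrite ?lexx ?ltr01.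
  have [|rho /andP[r0 r1] rP] := IHs; first by move=> w ws; apply: sub; rewrite inE ws orbT.
  have [zmu|zlt] := rs_lt (sub z (mem_head _ _)).
    by exists rho; rewrite ?r0 // => w; rewrite inE => /orP[/eqP ->|/rP]; [left|].
  exists (Num.max rho (cabs z / mu)).
    by rewrite le_max r0 /= gt_max r1 ltr_pdivrMr // mul1r.
  move=> w; rewrite inE => /orP[/eqP ->|/rP[|h]]; [right|by left|right].
    by rewrite -ler_pdivrMr // le_max lexx orbT.
  by apply: le_trans h _; rewrite ler_pM2r // le_max lexx.
by apply.
Qed.

Lemma rem_bound (N : nat) : (0 < N)%N -> exists2 c : R, 0 < c &
  forall z (q : {poly int}), z \in rs -> (size q <= D)%N ->
    (forall i, 0 <= q`_i < N%:Z) -> cabs (int_eval z q) <= c.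
Proof.
move=> N0; exists (N%:R * (1 + \sum_(i < D) mu ^+ i)).
  rewrite mulr_gt0 ?ltr0n // ltr_pwDl // sumr_ge0 // => i _.
  by rewrite exprn_ge0 // ltW.
move=> z q zrs qD qN; rewrite int_eval_coef // mulrDr mulr1 mulr_sumr ler_wpDl //.
apply: le_trans (cabs_sum _ _ _) _; apply: ler_sum => i _; rewrite cabsM cabsX.
have /andP[q0 qlt] := qN i.
have zmu : cabs z <= mu.
  by case: (rs_lt zrs) => [->|/ltW //]; rewrite cabs_real gtr0_norm.
have -> : cabs ((q`_i)%:~R : C) = (q`_i)%:~R.
  have -> : (q`_i)%:~R = ((q`_i)%:~R : R)%:C%C :> C by rewrite rmorph_int.
  by rewrite cabs_real ger0_norm // ler0z.
apply: ler_pM; rewrite ?ler0z ?exprn_ge0 ?cabs_ge0 //.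
  by rewrite -[N%:R]/(N%:Z%:~R) ler_int ltW.
by apply: lerXn2r; rewrite ?nnegrE ?cabs_ge0 ?(ltW mu0).
Qed.

(** As [rs] consists of as many distinct roots as the degree of [g], it contains all of them. *)
Lemma mu_rs : mu%:C%C \in rs.
Proof.
have gE : map_poly (intr : int -> C) g = \prod_(z <- rs) ('X - z%:P).
  have g_mon' : map_poly (intr : int -> C) g \is monic by rewrite monic_map.
  have d : \prod_(z <- rs) ('X - z%:P) %| map_poly (intr : int -> C) g.
    apply: uniq_roots_dvdp; first by apply/allP => z /g_rs.
    by rewrite uniq_rootsE.
  apply/esym/eqP; rewrite -eqp_monic ?monic_prod_XsubC // -dvdp_size_eqp //.
  by rewrite size_prod_XsubC size_map_poly_id0 ?g_size // (monicP g_mon) rmorph1 oner_neq0.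
rewrite -root_prod_XsubC -gE /root -[_.[_]]/(int_eval mu%:C%C g) int_eval_real.
by rewrite [int_evalR mu g](eqP (g_mu : _ == 0)).
Qed.

Theorem perron_realizable : realizable mu.
Proof.
have [rho /andP[rho0 rho1] rhoP] := gap.
have D0 : (0 < D)%N by rewrite lt0n size_eq0.
(* With [N > 2 * mu], dividing a value at most [mu * K] by [N] leaves at most [K / 2], so there is
   room for an error [c <= K / 2]. *)
have [N Np N_gt] : exists2 N, (0 < N)%N & 2 * mu < N%:R.
  exists (Num.bound (2 * mu)).+1 => //.
  have := archi_boundP (x := 2 * mu); rewrite mulr_ge0 ?(ltW mu0) // => /(_ isT).
  by move=> /lt_trans; apply; rewrite ltr_nat.
have [c c0 cP] := rem_bound Np.
have N0 : 0 < N%:R :> R by rewrite ltr0n.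
(* For a value above [K] the gap [1 - rho] between [mu] and its other conjugates, divided by [N],
   exceeds [2 * c]: one [c] for the error at [mu] and one for the error at the conjugate. *)
pose K : R := 1 + 2 * c * N%:R / (1 - rho).
have r10 : 0 < 1 - rho by rewrite subr_gt0.
have K2c : 2 * c * N%:R <= (1 - rho) * K.
  have -> : (1 - rho) * K = (1 - rho) + 2 * c * N%:R.
    by rewrite /K; field; rewrite gt_eqF.
  by rewrite lerDr ltW.
have K1 : 1 <= K by rewrite lerDl divr_ge0 ?(ltW r10) // mulr_ge0 ?(ltW N0) // mulr_ge0 ?(ltW c0).
have K0 : 0 < K by apply: lt_le_trans K1.
have cK : 2 * c <= K.
  have : 2 * c * 1 <= 2 * c * N%:R by rewrite ler_pM2l ?mulr_gt0 // ler1n.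
  have : (1 - rho) * K <= 1 * K by rewrite ler_pM2r // gerBl.
  by move: K2c; rewrite mulr1 mul1r; lra.
pose inY (q : {poly int}) := [/\ (size q <= D)%N, 0 < val q, val q <= K &
  forall z, z \in rs -> cabs (int_eval z q) <= val q].
have [B BP] := coef_bounded K.
have inYB q : inY q -> forall i, `|q`_i| <= B%:Z.
  by move=> [qD _ qK qz]; apply: BP => // z /qz /le_trans; apply.
(* Coefficients between [- B] and [B] are stored shifted by [B]. *)
pose dec (f : {ffun 'I_D -> 'I_(B + B).+1}) : {poly int} :=
  \poly_(i < D) (if insub i is Some j then (f j : nat)%:Z - B%:Z else 0).
pose enc (q : {poly int}) : {ffun 'I_D -> 'I_(B + B).+1} :=
  [ffun i : 'I_D => inord (absz (q`_i + B%:Z))].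
have encK q : inY q -> dec (enc q) = q.
  move=> qY; have [qD _ _ _] := qY; apply/polyP => i; rewrite coef_poly.
  case: ltnP => [ltiD|leDi]; last by rewrite nth_default // (leq_trans qD).
  rewrite insubT /= ffunE /=; have := inYB q qY i; rewrite ler_norml => /andP[q1 q2].
  have p0 : 0 <= q`_i + B%:Z by rewrite -lerBlDr sub0r.
  rewrite inordK ?gez0_abs ?addrK //.
  by rewrite ltnS -lez_nat gez0_abs // PoszD lerD2r.
pose V : finType := {f : {ffun 'I_D -> 'I_(B + B).+1} | `[< inY (dec f) >]}.
pose pol (v : V) := dec (\val v).
have polY (v : V) : inY (pol v) by apply/asboolP; apply: (valP v).
have ofY q : inY q -> exists v : V, pol v = q.
  move=> qY; have qV : `[< inY (dec (enc q)) >] by apply/asboolP; rewrite encK.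
  by exists (Sub (enc q) qV); rewrite /pol SubK encK.
have reduce (q : {poly int}) : exists q' : {poly int}, [/\ (size q' <= D)%N, val q' = val q &
    forall z, z \in rs -> int_eval z q' = int_eval z q].
  exists (Pdiv.CommonRing.rmodp q g).
  have qE := Pdiv.RingMonic.rdivp_eq g_mon q; split.
  - by rewrite -ltnS -g_size Pdiv.Ring.ltn_rmodpN0 // monic_neq0.
  - rewrite {2}qE /val rmorphD rmorphM /= [X in _ * X + _](_ : _ = 0) ?mulr0 ?add0r //.
    exact/eqP.
  - move=> z zrs; rewrite {2}qE rmorphD rmorphM [int_eval z g](_ : _ = 0) ?mulr0 ?add0r //.
    exact/eqP/g_rs.
have step (v : V) : exists t : V -> nat, mu * val (pol v) = \sum_u (t u)%:R * val (pol u).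
  have [vD v0 vK vz] := polY v.
  have [q [qD qval qz]] := reduce ('X * pol v).
  have qvalE : val q = mu * val (pol v) by rewrite qval /val rmorphM int_evalRX.
  have qzE z : z \in rs -> int_eval z q = z * int_eval z (pol v).
    by move=> zrs; rewrite qz // rmorphM int_evalX.
  have q0 : 0 < val q by rewrite qvalE mulr_gt0.
  have zmu z : z \in rs -> cabs z <= mu.
    by move=> /rs_lt[->|/ltW //]; rewrite cabs_real gtr0_norm.
  case: (lerP (val q) K) => [qK|Kq].
    have [|u uE] := ofY q.
      split=> // z zrs; rewrite qzE // cabsM qvalE.
      by apply: ler_pM; rewrite ?cabs_ge0 ?zmu ?vz.
    exists (fun u' => nat_of_bool (u' == u)).
    rewrite (bigD1 u) //= eqxx mul1r big1 ?addr0 ?uE ?qvalE // => w /negPf ->.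
    by rewrite mul0r.
  (* Split q as (N - 1) q1 + (q1 + r), by dividing the coefficients by N. *)
  pose q1 : {poly int} := \poly_(i < D) (q`_i %/ N%:Z)%Z.
  pose r : {poly int} := \poly_(i < D) (q`_i %% N%:Z)%Z.
  have Nz : N%:Z != 0 by rewrite eqz_nat -lt0n.
  have qE : q = q1 *+ N + r.
    apply/polyP => i; rewrite coefD coefMn !coef_poly.
    case: ltnP => [_|leDi]; last by rewrite mul0rn addr0 nth_default // (leq_trans qD).
    by rewrite -mulr_natr {1}(divz_eq q`_i N%:Z) natz.
  have rb z : z \in rs -> cabs (int_eval z r) <= c.
    move=> zrs; apply: cP; rewrite ?size_poly // => i; rewrite coef_poly.
    by case: ifP => _; rewrite ?lexx // modz_ge0 //= ltz_pmod.
  have rb' : `|val r| <= c by have := rb _ mu_rs; rewrite int_eval_real cabs_real.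
  have ev1 z : int_eval z q = int_eval z q1 *+ N + int_eval z r.
    by rewrite {1}qE rmorphD rmorphMn.
  have val1 : val q = val q1 *+ N + val r by rewrite /val {1}qE rmorphD rmorphMn.
  have valD : val (q1 + r) = val q1 + val r by rewrite /val rmorphD.
  have big : 2 * c * N%:R <= (1 - rho) * val q.
    by apply: le_trans K2c _; rewrite ler_pM2l // ltW.
  have qz_bound z : z \in rs -> z = mu%:C%C \/ cabs (int_eval z q) <= rho * val q.
    move=> zrs; case: (rhoP z zrs) => [->|zr]; [by left|right].
    rewrite qzE // cabsM qvalE mulrA; apply: ler_pM; rewrite ?cabs_ge0 //.
    exact: vz.
  (* Anything within [c] of [q / N] at all conjugates belongs to [inY]. The remainder [r] alone need
     not; this is why it is added to one of the [N] copies of [q1]. *)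
  have part (q' : {poly int}) : (size q' <= D)%N -> (exists2 e : R, `|e| <= c & val q' = val q
    / N%:R + e) ->
      (forall z, z \in rs -> cabs (int_eval z q') <= cabs (int_eval z q) / N%:R + c) -> inY q'.
    move=> q'D [e ec q'val] q'z.
    have /andP[e1 e2] : - c <= e <= c by rewrite -ler_norml.
    have low : 2 * c <= (1 - rho) * (val q / N%:R).
      by rewrite mulrA ler_pdivlMr.
    have qN0 : 0 < val q / N%:R by rewrite divr_gt0.
    have rq : 0 <= rho * (val q / N%:R) by rewrite mulr_ge0 // ltW.
    have q'0 : 0 < val q'.
      by rewrite q'val; move: low; rewrite mulrBl mul1r; lra.
    split=> //.
      have up : val q / N%:R <= K / 2.
        rewrite ler_pdivrMr // qvalE.
        have : mu * val (pol v) <= mu * K by rewrite ler_pM2l.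
        have : 2 * mu * K <= N%:R * K by rewrite ler_pM2r // ltW.
        lra.
      by rewrite q'val; lra.
    move=> z zrs; case: (qz_bound z zrs) => [->|zb].
      by rewrite int_eval_real cabs_real gtr0_norm.
    apply: le_trans (q'z z zrs) _.
    have : cabs (int_eval z q) / N%:R <= rho * (val q / N%:R).
      by rewrite mulrA ler_pM2r ?invr_gt0.
    by rewrite q'val; move: low; rewrite mulrBl mul1r; lra.
  have ev1' z : int_eval z q1 = (int_eval z q - int_eval z r) / N%:R.
    by rewrite ev1 addrK -mulr_natr mulfK // pnatr_eq0.
  have cabsN w : cabs (w / N%:R : C) = cabs w / N%:R.
    have -> : (N%:R : C)^-1 = ((N%:R : R)^-1)%:C%C by rewrite fmorphV rmorph_nat.
    by rewrite cabsM cabs_real ger0_norm // invr_ge0 ltW.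
  have N1 : 1 <= N%:R :> R by rewrite ler1n.
  have Ninv1 : N%:R^-1 <= 1 :> R by rewrite invf_le1.
  have cabsNN (w : C) : cabs (- w) = cabs w.
    by apply: complexI; rewrite -!cabsE normrN.
  have q1Y : inY q1.
    apply: part; first exact: size_poly.
      exists (- (val r / N%:R)).
        rewrite normrN normrM [`|N%:R^-1|]ger0_norm ?invr_ge0 ?(ltW N0) //.
        by apply: le_trans rb'; rewrite ler_piMr.
      by rewrite val1 -mulr_natr mulrDl mulfK ?gt_eqF // addrK.
    move=> z zrs; rewrite ev1' cabsN.
    apply: (@le_trans _ _ ((cabs (int_eval z q) + cabs (int_eval z r)) / N%:R)).
      rewrite ler_pM2r ?invr_gt0 //; apply: le_trans (cabsD _ _) _.
      by rewrite cabsNN.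
    rewrite mulrDl lerD2l; apply: le_trans _ (rb z zrs).
    by rewrite ler_piMr ?cabs_ge0.
  have q2Y : inY (q1 + r).
    apply: part.
    - apply: leq_trans (size_polyD _ _) _.
      by rewrite geq_max !size_poly.
    - exists (val r * (1 - N%:R^-1)).
        rewrite normrM [`|1 - _|]ger0_norm ?subr_ge0 //.
        by apply: le_trans rb'; rewrite ler_piMr // gerBl invr_ge0 ltW.
      rewrite valD val1 -mulr_natr mulrDl mulfK ?gt_eqF //; ring.
    move=> z zrs; rewrite rmorphD ev1'.
    have -> : (int_eval z q - int_eval z r) / N%:R + int_eval z r =
      int_eval z q / N%:R + int_eval z r * ((1 - N%:R^-1 : R)%:C)%C.
      rewrite rmorphB rmorph1 fmorphV rmorph_nat; ring.
    apply: le_trans (cabsD _ _) _; rewrite cabsN lerD2l cabsM cabs_real.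
    rewrite ger0_norm ?subr_ge0 //; apply: le_trans (rb z zrs).
    by rewrite ler_piMr ?cabs_ge0 // gerBl invr_ge0 ltW.
  have [u1 u1E] := ofY _ q1Y; have [u2 u2E] := ofY _ q2Y.
  exists (fun u => ((u == u1) * N.-1 + (u == u2))%N).
  rewrite -qvalE.
  have delta (w : V) (F : V -> R) : \sum_u (u == w)%:R * F u = F w.
    rewrite (bigD1 w) //= eqxx mul1r big1 ?addr0 // => u /negPf ->.
    by rewrite mul0r.
  under eq_bigr do rewrite natrD mulrDl natrM mulrAC.
  rewrite big_split /= -mulr_suml !delta u1E u2E valD val1.
  have -> : val q1 *+ N = val q1 * (N.-1%:R + 1) by rewrite natr1 prednK // mulr_natr.
  ring.
pose t v := sval (cid (step v)).
have tP v : mu * val (pol v) = \sum_u (t v u)%:R * val (pol u) by apply: svalP (cid (step v)).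
exists V, t, (fun v => val (pol v)); split=> [|v|//].
  have [|v _] := ofY 1; last by exists v.
  have val_1 : val 1 = 1 by rewrite /val rmorph1.
  by split=> //; rewrite ?size_poly1 ?val_1 // => z _; rewrite rmorph1 cabs1.
by have [] := polY v.
Qed.

End Perron.
End PerronRealization.

(** * From strictly dominant to weakly dominant eigenvalues, and polynomial factors *)

Section WeakPerron.
Variable R : realType.
Local Notation C := R[i].
Local Notation "p ^@" := (map_poly (ratr : rat -> C) p) (at level 2, format "p ^@").

Lemma integral_min_poly (F : numFieldType) (x : F) (p : {poly rat}) :
  min_poly_of x p -> integralOver (intr : int -> F) x ->
  exists2 g : {poly int}, g \is monic & p = map_poly intr g.
Proof.
move=> [p_mon px pdvd] [q q_mon qx].
have [|g [a a0 pE] [r qE]] := dvdpP_rat_int (p := p) (q := q).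
  apply: pdvd; rewrite -map_poly_comp.
  by rewrite (eq_map_poly (g := intr)) // => i /=; rewrite ratr_int.
have lc : lead_coef g * lead_coef r = 1 by rewrite -lead_coefM -qE; apply/monicP.
have al : a * (lead_coef g)%:~R = 1.
  by have /monicP := p_mon; rewrite pE lead_coefZ lead_coef_map_inj //; apply: intr_inj.
have lcs : lead_coef g * lead_coef g = 1.
  have := congr1 absz lc; rewrite abszM => /eqP; rewrite muln_eq1 => /andP[/eqP + _].
  by case: (lead_coef g) => [[|[|]]|[|]].
have aE : a = (lead_coef g)%:~R.
  have lg0 : (lead_coef g)%:~R != 0 :> rat.
    by apply/eqP => h; move: al; rewrite h mulr0 => /esym/eqP; rewrite oner_eq0.
  by apply: (mulIf lg0); rewrite al -rmorphM lcs.
exists (lead_coef g *: g); first by rewrite monicE lead_coefZ lcs.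
by rewrite pE aE map_polyZ.
Qed.

(** Separability: a common root of [mu] and its derivative is a conjugate of [x], so the derivative
    would vanish at [x] and be divisible by [mu], against its degree. *)
Lemma min_poly_of_roots (x : C) (mu : {poly rat}) : min_poly_of x mu ->
  exists2 rs : seq C, uniq rs & mu^@ = \prod_(z <- rs) ('X - z%:P).
Proof.
move=> muP; have [mu_mon mux mudvd] := muP; have mu1 := min_poly_of_size muP.
have [rs rsE] := closed_field_poly_normal mu^@.
have mu_mon' : mu^@ \is monic by rewrite monic_map.
rewrite (monicP mu_mon') scale1r in rsE; exists rs => //.
rewrite -separable_prod_XsubC -rsE unlock /coprimep.
have [//|/closed_rootP[z]] := eqVneq (size (gcdp mu^@ mu^@^`())) 1%N.
rewrite root_gcd deriv_map => /andP[muz].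
rewrite -(min_poly_of_conj _ muP muz) => /mudvd mud.
have d0 : mu^`() != 0.
  apply/eqP => mu0.
  have := congr1 (fun p : {poly rat} => p`_(size mu).-2) mu0; rewrite coef_deriv coef0 => /eqP.
  rewrite -mulr_natr mulf_eq0 pnatr_eq0 orbF prednK; last by case: (size mu) mu1 => [|[]].
  by rewrite -lead_coefE lead_coef_eq0 (negPf (monic_neq0 mu_mon)).
have := dvdp_leq d0 mud; rewrite leqNgt lt_size_deriv // monic_neq0 //.
Qed.

(** Each vertex becomes a path of [m.+1] vertices descending to position 0, from where the old edges
    lead to the top position; the eigenvector is divided by [b] once for each position. *)
Lemma realizable_root (b : R) m : 0 < b -> realizable (b ^+ m.+1) -> realizable b.
Proof.
move=> b0 [V [T [y [[v0 _] y0 yT]]]].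
pose T' (v u : V * 'I_m.+1) : nat :=
  (if v.2 == ord0 then (u.2 == ord_max) * T v.1 u.1
   else (u.1 == v.1) && (u.2.+1 == v.2 :> nat))%N.
exists (V * 'I_m.+1)%type, T', (fun v : V * 'I_m.+1 => y v.1 / b ^+ v.2); split.
- by exists (v0, ord0).
- by move=> v; rewrite divr_gt0 // exprn_gt0.
move=> [v s] /=; rewrite /T' /=; case: eqP => [->|/eqP s0].
  rewrite expr0 divr1 -(pair_bigA _ (fun u t => ((t == ord_max) * T v u)%N%:R * (y u / b ^+ t))) /=.
  under eq_bigr => u _.
    rewrite (bigD1 ord_max) //= eqxx mul1n big1 ?addr0; last first.
      by move=> t /negPf ->; rewrite mul0n mul0r.
    rewrite mulrA; over.
  rewrite -mulr_suml -yT exprS; field.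
  by rewrite expf_neq0 // gt_eqF.
have sp : (0 < s)%N by rewrite lt0n.
have lt1 : (s.-1 < m.+1)%N by apply: leq_trans (ltn_ord s); rewrite ltnS leq_pred.
rewrite (bigD1 (v, Ordinal lt1)) //= eqxx prednK // eqxx mul1r big1 ?addr0.
  have -> : b ^+ s = b * b ^+ s.-1 by rewrite -exprS prednK.
  by field; rewrite expf_neq0 ?gt_eqF.
move=> [u t] /=; rewrite xpair_eqE; case: eqP => /= _ tn; last by rewrite mul0r.
case: eqP => // ts; last by rewrite mul0r.
by case/eqP: tn; apply: val_inj; rewrite /= -ts.
Qed.

Lemma weak_perron_realizable (b : R) (p : {poly rat}) : 0 < b -> algebraic_integer b ->
  is_minimal_poly b p ->
  (forall z : C, root p^@ z -> ~ (b%:C%C < `|z|)) -> realizable b.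
Proof.
move=> b0 b_int p_min pz.
have pmax (z : C) : root p^@ z -> cabs z <= b.
  by move=> /pz; rewrite cabsE ltcR leNgt => /negP.
have rootRC (q : {poly rat}) (x : R) :
    root q^@ x%:C%C = root (map_poly (ratr : rat -> R) q) x.
  have -> : q^@ = map_poly (real_complex R) (map_poly ratr q).
    by rewrite -map_poly_comp; apply: eq_map_poly => a /=; rewrite fmorph_rat.
  by rewrite fmorph_root.
have pP : min_poly_of (b%:C%C : C) p.
  have [p_mon pb _] := p_min; split=> // [|q]; rewrite rootRC //.
  exact: minimal_poly_dvd.
have [m m0 mP] := maximal_conjugates_roots_of_unity b0 pP pmax.
case: m m0 mP => // m _ mP; apply: (@realizable_root _ m) => //.
set mu := b ^+ m.+1 in mP *; have mu0 : 0 < mu by rewrite exprn_gt0.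
have mu_int : integralOver (intr : int -> R) mu.
  rewrite /mu; elim: m {mP mu mu0} => [|m IHm]; first by rewrite expr1.
  rewrite exprS; exact: integral_mul.
have mu_intC : integralOver (intr : int -> C) mu%:C%C.
  have [q q_mon qmu] := mu_int; exists q => //.
  have -> : map_poly (intr : int -> C) q = map_poly (real_complex R) (map_poly intr q).
    by rewrite -map_poly_comp; apply: eq_map_poly => a /=; rewrite rmorph_int.
  by rewrite fmorph_root.
have [pg pgP] : exists pg, min_poly_of (mu%:C%C : C) pg.
  have [q q_mon qmu] := mu_intC.
  apply: (@min_poly_of_exists _ _ (map_poly intr q)).
    by rewrite monic_neq0 // monic_map.
  by rewrite -map_poly_comp (eq_map_poly (g := intr)) // => i /=; rewrite ratr_int.
have [g g_mon pgE] := integral_min_poly pgP mu_intC.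
have gC : pg^@ = map_poly (intr : int -> C) g.
  by rewrite pgE -map_poly_comp; apply: eq_map_poly => i /=; rewrite ratr_int.
have [rs rs_uniq rsE] := min_poly_of_roots pgP.
have rs_root z : (z \in rs) = root pg^@ z by rewrite rsE root_prod_XsubC.
have [_ pgmu _] := pgP.
apply: (@perron_realizable R g mu rs) => //.
- have := congr1 (fun q : {poly C} => size q) rsE.
  by rewrite size_prod_XsubC gC size_map_poly_id0 // (monicP g_mon) rmorph1 oner_neq0.
- rewrite -(fmorph_root (real_complex R)) -map_poly_comp.
  move: pgmu; rewrite gC; congr (root _ _); apply: eq_map_poly => a /=.
  by rewrite rmorph_int.
- by move=> z; rewrite rs_root gC.
- move=> z; rewrite rs_root => pgz.
  (* The conjugates of [mu] are the powers of conjugates of [b]: those of modulus [b] give [mu]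
     itself, the others something strictly smaller. *)
  have XP : min_poly_of ('X^(m.+1))^@.[b%:C%C : C] pg.
    by rewrite map_polyXn hornerXn -rmorphXn.
  have [t [pt tz]] := conjugate_value pP XP pgz.
  rewrite map_polyXn hornerXn in tz; rewrite -tz cabsX.
  have tb := pmax t pt; move: tb; rewrite le_eqVlt => /orP[/eqP tb|tb]; [left|right].
    exact: mP.
  by rewrite ltrXn2r ?nnegrE ?cabs_ge0 // ltW.
- by apply/eqP => rs0; move: pgmu; rewrite -rs_root rs0.
Qed.

(** Level [s] repeats [T] and adds one edge from each vertex to its copy on level [s - 1]. The
    product of the eigenvector with the iterated convolutions [h s] is an orbit, [h s] has growth
    [b ^ n n ^ s], and the orbit starting at 1 is comparable to it. *)
Lemma realizable_growth (b : R) l : 0 < b -> realizable b ->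
  exists (V : finType) (T : V -> V -> nat) (v : V), forall f : V -> nat -> R,
    is_orbit T f -> (forall v, f v 0%N = 1) -> growth (f v) b l.
Proof.
move=> b0 [V [T [y [[v0 _] y0 yT]]]].
pose T' (v u : V * 'I_l.+1) : nat := ((v.2 == u.2) * T v.1 u.1 +
  ((u.1 == v.1) && (u.2.+1 == v.2 :> nat)))%N.
exists (V * 'I_l.+1)%type, T', (v0, ord_max) => f fT f1.
pose h := fix h (s n : nat) : R := if n is n'.+1 then
  b * h s n' + (if s is s'.+1 then h s' n' else 0) else 1.
have hgrowth s : growth (h s) b s.
  elim: s => [|s IHs]; last first.
    by apply: (convolution_eq b0 (G := h s)).
  have -> : h 0%N = (fun n => b ^+ n).
    by apply/funext; elim=> // n IHn; rewrite exprS -IHn /= addr0.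
  split=> //; exists 1, 1; split=> // n.
  by rewrite mul1r /exp_poly expr0 mulr1 lexx.
pose gg (v : V * 'I_l.+1) n := y v.1 * h v.2 n.
have gT : is_orbit T' gg.
  move=> [v s] n; rewrite /gg /T' /=.
  under eq_bigr do rewrite natrD mulrDl.
  rewrite big_split /= mulrDr; congr (_ + _).
    rewrite -(pair_bigA _ (fun u t => ((s == t) * T v u)%N%:R * (y u * h t n))) /=.
    under eq_bigr => u _.
      rewrite (bigD1 s) //= eqxx mul1n big1 ?addr0; last first.
        by move=> t; rewrite eq_sym => /negPf ->; rewrite mul0n mul0r.
      rewrite mulrA; over.
    by rewrite -mulr_suml -yT mulrA [y v * b]mulrC.
  case: s => [[|s] lts] /=.
    by rewrite mulr0 big1 // => u _; rewrite andbF mul0r.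
  have lts' : (s < l.+1)%N by apply: ltnW.
  rewrite (bigD1 (v, Ordinal lts')) //= !eqxx mul1r big1 ?addr0 // => -[u t] /=.
  rewrite xpair_eqE; case: eqP => /= _ tn; last by rewrite mul0r.
  case: eqP => [[ts]|_]; last by rewrite mul0r.
  by case/eqP: tn; apply: val_inj.
pose A : R := \sum_v y v; pose B : R := \sum_v (y v)^-1.
have yA v : y v <= A by rewrite /A (bigD1 v) //= lerDl sumr_ge0 // => u _; apply: ltW.
have yB v : (y v)^-1 <= B.
  by rewrite /B (bigD1 v) //= lerDl sumr_ge0 // => u _; rewrite invr_ge0 ltW.
have A0 : 0 < A by apply: lt_le_trans (yA v0).
have B0 : 0 < B by apply: lt_le_trans (yB v0); rewrite invr_gt0.
have ggrowth : growth (gg (v0, ord_max)) b l by apply: growth_scale.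
apply: (growth_equiv A0 B0 ggrowth) => n.
  apply: (orbit_le gT (orbit_scale A fT)) => -[v s].
  by rewrite /gg /= f1 !mulr1.
apply: (orbit_le fT (orbit_scale B gT)) => -[v s].
by rewrite f1 /gg /= mulr1 -ler_pdivrMr // mul1r.
Qed.

End WeakPerron.

(** * Quiver algebras with radical square zero *)

Section PathAlgebra.
Variables (K : fieldType) (V A : finType).

(* The path algebra of the quiver modulo all paths of length 2. *)
Definition path_alg_of (src tgt : A -> V) : Type := ({ffun V -> K} * {ffun A -> K})%type.
(** Keeping the quiver and the vertex in the type lets each vertex give [K] its own module
    structure, in which an element acts through its coefficient at [v]. *)
Definition simple_mod_of (src tgt : A -> V) (v : V) : Type := K.

Variables src tgt : A -> V.
Local Notation path_alg := (path_alg_of src tgt).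
Local Notation simple_mod := (simple_mod_of src tgt).

HB.instance Definition _ := GRing.Zmodule.on path_alg.
Implicit Types x y z : path_alg.

Definition path_one : path_alg := ([ffun=> 1], 0).
Definition path_mul x y : path_alg :=
  ([ffun v => x.1 v * y.1 v], [ffun a => x.1 (tgt a) * y.2 a + x.2 a * y.1 (src a)]).

Lemma path_ext x y : (forall v, x.1 v = y.1 v) -> (forall a, x.2 a = y.2 a) -> x = y.
Proof. by case: x y => [? ?] [? ?] /= /ffunP -> /ffunP ->. Qed.

Lemma path_add1 x y v : (x + y).1 v = x.1 v + y.1 v.
Proof. by rewrite ffunE. Qed.

Lemma path_add2 x y a : (x + y).2 a = x.2 a + y.2 a.
Proof. by rewrite ffunE. Qed.

Lemma path_mulA : associative path_mul.
Proof. by move=> x y z; apply: path_ext => i; rewrite !ffunE; ring. Qed.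

Lemma path_mul1x : left_id path_one path_mul.
Proof. by move=> x; apply: path_ext => i; rewrite !ffunE; ring. Qed.

Lemma path_mulx1 : right_id path_one path_mul.
Proof. by move=> x; apply: path_ext => i; rewrite !ffunE; ring. Qed.

Lemma path_mulDl : left_distributive path_mul +%R.
Proof. by move=> x y z; apply: path_ext => i; rewrite !ffunE; ring. Qed.

Lemma path_mulDr : right_distributive path_mul +%R.
Proof. by move=> x y z; apply: path_ext => i; rewrite !ffunE; ring. Qed.

HB.instance Definition _ := GRing.Zmodule_isPzRing.Build path_alg
  path_mulA path_mul1x path_mulx1 path_mulDl path_mulDr.

Definition path_scalar (c : K) : path_alg := ([ffun=> c], 0).

Lemma path_scalar_zmod : zmod_morphism path_scalar.
Proof. by move=> c d; apply: path_ext => i; rewrite !ffunE ?subrr. Qed.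

Lemma path_scalar_monoid : monoid_morphism path_scalar.
Proof.
by split=> // c d; apply: path_ext => i; rewrite !ffunE // ?mulr0 ?mul0r ?addr0.
Qed.

HB.instance Definition _ := GRing.isZmodMorphism.Build K path_alg path_scalar
  path_scalar_zmod.
HB.instance Definition _ := GRing.isMonoidMorphism.Build K path_alg path_scalar
  path_scalar_monoid.

Lemma field_artinian : artinian K.
Proof.
move=> I sI decI.
have full n : (exists2 x : K, I n x & x != 0) -> I n = setT.
  move=> [x Ix x0]; apply/seteqP; split=> // y _.
  by have := subZ (y / x) (sI n) Ix; rewrite /GRing.scale /= divfK.
have dec n m : I (n + m)%N `<=` I n.
  by elim: m => [|m IHm]; rewrite ?addn0 // addnS => x /decI /IHm.
case: (pselect (exists N, forall x : K, I N x -> x = 0)) => [[N N0]|nN].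
  exists N => n len; apply/seteqP; rewrite -(subnKC len); split=> x; first exact: dec.
  by move=> /N0 ->; exact: (sub0 (sI _)).
have allT n : I n = setT.
  apply: full; apply: contrapT => nx; apply: nN; exists n => x Ix.
  by apply: contrapT => /eqP x0; apply: nx; exists x.
by exists 0%N => n _; rewrite !allT.
Qed.

Lemma path_artin : artin_algebra path_scalar.
Proof.
split; first exact: field_artinian.
  move=> c x; apply: path_ext => i; rewrite !ffunE ?mulr0 ?mul0r ?addr0 ?add0r mulrC //.
pose g (i : V + A) : path_alg := match i with
  | inl v => ([ffun w => (w == v)%:R], 0) | inr a => (0, [ffun b => (b == a)%:R]) end.
pose co x (i : V + A) : K := match i with inl v => x.1 v | inr a => x.2 a end.
exists #|{: V + A}|, (fun i => g (enum_val i)) => x; exists (fun i => co x (enum_val i)).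
pose F i : restrict_scalars path_scalar path_alg^o :=
  co x i *: (g i : restrict_scalars path_scalar path_alg^o).
transitivity (\sum_i F i); last first.
  rewrite (reindex (enum_val : 'I_#|{: V + A}| -> V + A)) //.
  exact/onW_bij/enum_val_bij.
rewrite {}/F.
have E1 v (F : V + A -> path_alg) : (\sum_i F i).1 v = \sum_i (F i).1 v.
  by elim/big_rec2: _ => [|i y1 y2 _ <-]; rewrite ffunE.
have E2 a (F : V + A -> path_alg) : (\sum_i F i).2 a = \sum_i (F i).2 a.
  by elim/big_rec2: _ => [|i y1 y2 _ <-]; rewrite ffunE.
apply: path_ext => i.
  rewrite E1 big_sumType /= [X in _ + X]big1 ?addr0 => [|a _]; last first.
    by rewrite !ffunE mulr0.
  rewrite (bigD1 i) //= !ffunE eqxx mulr1 big1 ?addr0 // => v /negPf vi.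
  by rewrite !ffunE eq_sym vi mulr0.
rewrite E2 big_sumType /= [X in X + _]big1 ?add0r => [|v _]; last first.
  by rewrite !ffunE mulr0 mul0r addr0.
rewrite (bigD1 i) //= !ffunE eqxx mulr1 mul0r addr0 big1 ?addr0 // => a /negPf ai.
by rewrite !ffunE eq_sym ai mulr0 mul0r addr0.
Qed.

Section SimpleModule.
Variable v : V.
HB.instance Definition _ := GRing.Zmodule.on (simple_mod v).
Definition simple_scale (x : path_alg) (m : simple_mod v) : simple_mod v :=
  x.1 v * (m : K).

Lemma simple_scaleA x y m : simple_scale x (simple_scale y m) = simple_scale (x * y) m.
Proof. by rewrite /simple_scale !ffunE mulrA. Qed.
Lemma simple_scale1 : left_id 1 simple_scale.
Proof. by move=> m; rewrite /simple_scale ffunE mul1r. Qed.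
Lemma simple_scaleDr : right_distributive simple_scale +%R.
Proof. by move=> x m n; rewrite /simple_scale mulrDr. Qed.
Lemma simple_scaleDl m : {morph simple_scale^~ m : x y / x + y}.
Proof. by move=> x y; rewrite /simple_scale ffunE mulrDl. Qed.

HB.instance Definition _ := GRing.Zmodule_isLmodule.Build path_alg (simple_mod v)
  simple_scaleA simple_scale1 simple_scaleDr simple_scaleDl.
End SimpleModule.

Lemma simple_series v : composition_series 1
  (fun i => if i is 0%N then [set 0] else [set: restrict_scalars path_scalar (simple_mod v)]).
Proof.
split=> //.
  by move=> [|i] _; [apply: submodule0|apply: submoduleT].
move=> [|//] _; split.
  split=> // /(_ (1 : K) I) /= /eqP; exact/negP/oner_neq0.
move=> U sU _ _; case: (pselect (exists2 x, U x & x != 0)) => [[x Ux x0]|nx].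
  right; apply/seteqP; split=> // y _.
  have := subZ ((y : K) / (x : K)) sU Ux.
  have -> // : ((y : K) / (x : K)) *: x = y.
  by change ((path_scalar ((y : K) / (x : K))).1 v * (x : K) = y); rewrite ffunE divfK.
left; apply/seteqP; split=> [x Ux|_ ->]; last exact: sub0.
by apply: contrapT => /eqP x0; apply: nx; exists x.
Qed.

Lemma simple_len v : len path_scalar (simple_mod v) = 1%N.
Proof. exact: comp_lengthE (simple_series v). Qed.

Definition vertex_idem (v : V) : path_alg := ([ffun w => (w == v)%:R], 0).
(** The left ideal generated by the idempotent at [v], spanned by that idempotent and the arrows
    with source [v]. *)
Definition proj_set (v : V) : set path_alg^o := [set x | x * vertex_idem v = x].

Lemma proj_setP v x : proj_set v x <->
  (forall w, w != v -> x.1 w = 0) /\ (forall a, src a != v -> x.2 a = 0).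
Proof.
split=> [<-|[x1 x2]].
  split=> [w /negPf wv|a /negPf av]; rewrite !ffunE ?wv ?av ?mulr0 ?addr0 //.
apply: path_ext => i; rewrite !ffunE ?mulr0 ?add0r.
  by case: eqVneq => [_|/x1 ->]; rewrite ?mulr1 ?mul0r.
by case: eqVneq => [_|/x2 ->]; rewrite ?mulr1 ?mul0r.
Qed.

Lemma proj_submodule v : submodule (proj_set v).
Proof.
apply/submoduleP; split; first by rewrite /proj_set /= mul0r.
move=> a x y xv yv; rewrite /proj_set /=.
by change ((a * (x : path_alg) + (y : path_alg)) * vertex_idem v = a * (x : path_alg) + y);
  rewrite mulrDl -mulrA xv yv.
Qed.

Definition proj_mod v := sub_lmod (proj_submodule v).

Lemma proj_mul v x : proj_set v (x * vertex_idem v).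
Proof.
rewrite /proj_set /= -mulrA; congr (_ * _).
by apply: path_ext => i; rewrite !ffunE ?mulr0 ?mul0r ?addr0 // -natrM mulnb andbb.
Qed.

Lemma proj_mul_linear v : linear (fun x : path_alg^o => sub_mk (proj_submodule v) (proj_mul v x)).
Proof.
move=> a x y; apply: val_inj => /=.
by change ((a * (x : path_alg) + y) * vertex_idem v = a * (x * vertex_idem v) + y *
  vertex_idem v); rewrite mulrDl mulrA.
Qed.

Lemma regular_projective : projective path_alg^o.
Proof.
apply: projective_retract (@projective_rV path_alg 1); apply: retract_iso.
have lin : linear (fun x : path_alg^o => x%:M : 'rV[path_alg]_1).
  by move=> a x y; rewrite scale_scalar_mx -raddfD.
exists (mklin lin); exists (fun M : 'rV[path_alg]_1 => M 0 0) => [x|M] /=;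
  first by rewrite mxE mulr1n.
by apply/rowP => i; rewrite !ord1 mxE mulr1n.
Qed.

Lemma proj_retract v : retract (proj_mod v) path_alg^o.
Proof.
exists (sub_incl (proj_submodule v)), (mklin (@proj_mul_linear v)) => x.
by apply: val_inj => /=; apply: (sub_valP x).
Qed.

Lemma proj_top_linear v : linear (fun x : proj_mod v => (val x : path_alg).1 v : simple_mod v).
Proof.
move=> a x y; change ((a * (val x : path_alg) + (val y : path_alg)).1 v =
  a.1 v * (val x : path_alg).1 v + (val y : path_alg).1 v).
by rewrite !ffunE.
Qed.

Lemma proj_cover_simple v : projective_cover (mklin (@proj_top_linear v)).
Proof.
have idem_in : proj_set v (vertex_idem v).
  by have := proj_mul v 1; rewrite mul1r.
split.
- exists 1%N, (fun=> sub_mk (proj_submodule v) idem_in) => x; exists (fun=> (val x : path_alg)).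
  rewrite big_ord1; apply: val_inj => /=; exact/esym/(sub_valP x).
- exact: projective_retract (proj_retract v) regular_projective.
- move=> c; pose x : path_alg := ([ffun w => if w == v then c else 0], 0).
  have xv : proj_set v x.
    by apply/proj_setP; split=> [w /negPf wv|a _]; rewrite ffunE ?wv.
  by exists (sub_mk (proj_submodule v) xv); rewrite /= ffunE eqxx.
move=> W sW /(_ (sub_mk (proj_submodule v) idem_in))[u [w [u0 Ww uw]]].
have w1 : (val w : path_alg).1 v = 1.
  have := congr1 (fun x : proj_mod v => (val x : path_alg).1 v) uw.
  rewrite /= ffunE eqxx => h.
  transitivity (((val u : path_alg) + (val w : path_alg)).1 v); last exact: esym h.
  by rewrite path_add1 [X in _ = X + _]u0 add0r.
apply/seteqP; split=> // x _.
have /proj_setP[x1 x2] := sub_valP x; have /proj_setP[wv1 wv2] := sub_valP w.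
set xx : path_alg := val x in x1 x2; set ww : path_alg := val w in w1 wv1 wv2.
(* An element [w] of the projective with coefficient 1 at [v] generates it: the arrow part of [z] is
   corrected by what the vertex part of [xx] produces on the arrows of [w]. *)
pose z : path_alg := (xx.1, [ffun a => xx.2 a - xx.1 (tgt a) * ww.2 a]).
suff -> : x = z *: w by apply: subZ.
apply: val_inj; change (xx = z * ww); apply: path_ext => i; rewrite !ffunE /=.
  by case: (eqVneq i v) => [->|iv]; rewrite ?w1 ?mulr1 // wv1 // x1 // mul0r.
case: (eqVneq (src i) v) => [->|iv]; first by rewrite w1 mulr1 addrC subrK.
by rewrite wv1 // mulr0 addr0 wv2 // mulr0 x2.
Qed.

Lemma arrow_linear a :
  linear (fun m : simple_mod (tgt a) => (0, [ffun b => if b == a then m : K else 0]) : path_alg^o).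
Proof.
move=> c m n; apply: path_ext => i.
  by change ((0 : {ffun V -> K}) i = (c * (0, [ffun b => if b == a then m : K else 0]) +
    (0, [ffun b => if b == a then n : K else 0]) : path_alg).1 i); rewrite !ffunE mulr0 addr0.
change ([ffun b => if b == a then c.1 (tgt a) * (m : K) + (n : K) else 0] i =
    (c * (0, [ffun b => if b == a then m : K else 0]) +
    (0, [ffun b => if b == a then n : K else 0]) : path_alg).2 i).
by rewrite !ffunE mulr0 addr0; case: eqP => [->|_]; rewrite ?mulr0 ?addr0.
Qed.

Lemma arrow_zero_linear : linear (fun _ : 'rV[path_alg]_0 => 0 : path_alg^o).
Proof. by move=> a x y; rewrite scaler0 addr0. Qed.

Fixpoint arrow_sum (s : seq A) :
    {linear direct_sum (fun a => simple_mod (tgt a)) s -> path_alg^o} :=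
  if s is a :: s' return {linear direct_sum (fun a => simple_mod (tgt a)) s -> path_alg^o}
  then mklin (copair_linear (mklin (@arrow_linear a)) (arrow_sum s'))
  else mklin arrow_zero_linear.

Lemma arrow_sum_cons a s m r : arrow_sum (a :: s) (m, r) =
  ((0, [ffun b => if b == a then m : K else 0]) : path_alg) + arrow_sum s r.
Proof. by []. Qed.

Lemma arrow_sum_range s x :
  range (arrow_sum s) x <-> x.1 = 0 /\ forall a, a \notin s -> x.2 a = 0.
Proof.
elim: s x => [|a s IHs] x.
  split=> [[m _ <-]|[x1 x2]]; first by split=> // a _; rewrite ffunE.
  exists 0 => //; apply: path_ext => [v|a]; first by rewrite x1.
  by rewrite x2 // ffunE.
split=> [[[m r] _ <-]|[x1 x2]].
  have [|y1 y2] := (IHs (arrow_sum s r)).1; first by exists r.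
  rewrite arrow_sum_cons; split.
    by apply/ffunP => v; rewrite path_add1 y1 !ffunE addr0.
  move=> b; rewrite inE negb_or => /andP[/negPf ba bs].
  by rewrite path_add2 y2 // ffunE ba addr0.
pose y : path_alg := (0, [ffun b => if b == a then 0 else x.2 b]).
have [|r _ rE] := (IHs y).2.
  split=> // b bs; rewrite ffunE; case: eqP => // /eqP ba.
  by apply: x2; rewrite inE negb_or ba.
exists (x.2 a : simple_mod (tgt a), r) => //; rewrite arrow_sum_cons rE.
apply: path_ext => b; first by rewrite path_add1 x1 !ffunE addr0.
by rewrite path_add2 !ffunE; case: eqP => [->|_]; rewrite ?addr0 ?add0r.
Qed.

Lemma arrow_sum_inj s : uniq s -> injective (arrow_sum s).
Proof.
elim: s => [_ x y _|a s IHs /= /andP[as_ s_uniq]]; first by rewrite (rV0_eq0 x) (rV0_eq0 y).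
apply: (linear_injP (f := arrow_sum (a :: s))) => -[m r]; rewrite arrow_sum_cons => e.
have [|y1 y2] := (arrow_sum_range s (arrow_sum s r)).1; first by exists r.
have m0 : m = 0.
  have := congr1 (fun x : path_alg => x.2 a) e.
  by rewrite path_add2 y2 // !ffunE eqxx addr0.
congr pair => //; apply: (IHs s_uniq); rewrite linear0.
rewrite -[RHS]e m0; apply: path_ext => i; rewrite ?path_add1 ?path_add2 !ffunE ?add0r //.
by case: eqP => _; rewrite add0r.
Qed.

Definition arrows_from v := [seq a <- enum A | src a == v].

(** The kernel of the cover is spanned by the arrows leaving [v]. Since paths of length 2 vanish, it
    is semisimple, and each arrow spans a copy of the simple module at its target. *)
Lemma simple_syzygy v :
  is_syzygy (simple_mod v) (direct_sum simple_mod (map tgt (arrows_from v))).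
Proof.
have inP m : proj_set v (arrow_sum (arrows_from v) m).
  have [|y1 y2] := (arrow_sum_range (arrows_from v) (arrow_sum (arrows_from v) m)).1;
    first by exists m.
  apply/proj_setP; split=> [w _|a av]; first by rewrite y1 ffunE.
  by apply: y2; rewrite mem_filter negb_and av.
(* The two sums are equal as modules, not just isomorphic, so [arrow_sum] can be used as the
   inclusion without a transport. *)
have -> : direct_sum simple_mod (map tgt (arrows_from v)) =
    direct_sum (fun a => simple_mod (tgt a)) (arrows_from v).
  elim: (arrows_from v) => // a s IHs.
  exact: (congr1 (fun X : lmodType path_alg => (simple_mod (tgt a) * X)%type : lmodType _) IHs).
exists (proj_mod v), (mklin (@proj_top_linear v)),
  (mklin (corestrict_linear (proj_submodule v) inP)); split.
- exact: proj_cover_simple.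
- move=> m n mn; apply: (@arrow_sum_inj (arrows_from v)).
    by rewrite filter_uniq // enum_uniq.
  exact: (congr1 (sub_incl (proj_submodule v)) mn).
apply/seteqP; split=> [_ [m _ <-]|x x0].
  have [|y1 y2] := (arrow_sum_range (arrows_from v) (arrow_sum (arrows_from v) m)).1;
    first by exists m.
  by rewrite /preimage /set1 /= y1 ffunE.
have /proj_setP[x1 x2] := sub_valP x.
have [|m _ mE] := (arrow_sum_range (arrows_from v) (val x)).2.
  split=> [|a]; last first.
    by rewrite mem_filter mem_enum andbT => /x2.
  apply/ffunP => w; rewrite ffunE; case: (eqVneq w v) => [->|]; last exact: x1.
  exact: x0.
by exists m => //; apply: val_inj.
Qed.

End PathAlgebra.

(** * Complexity of modules of finite syzygy type *)

Section ComplexityClasses.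
Variable R : realType.
Implicit Types f g h : nat -> R.

Lemma complexity_class_eq f h : (exists c1 c2 : R, [/\ 0 < c1, 0 < c2 &
    exists N, forall n, (N <= n)%N -> c1 * h n <= f n <= c2 * h n]) ->
  complexity_class f = complexity_class h.
Proof.
move=> [c1 [c2 [c10 c20 [N fh]]]]; apply/seteqP; split=> g [g0].
  move=> [d1 [d2 [d10 d20 [M fg]]]]; split=> //; exists (d1 / c2), (d2 / c1).
  split; rewrite ?divr_gt0 //; exists (N + M)%N => n len.
  have /andP[f1 f2] := fh n (leq_trans (leq_addr _ _) len).
  have /andP[g1 g2] := fg n (leq_trans (leq_addl _ _) len).
  rewrite mulrAC ler_pdivrMr // mulrAC ler_pdivlMr // ![h n * _]mulrC.
  by rewrite (le_trans g1 f2) (le_trans f1 g2).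
move=> [d1 [d2 [d10 d20 [M hg]]]]; split=> //; exists (c1 * d1), (c2 * d2).
split; rewrite ?mulr_gt0 //; exists (N + M)%N => n len.
have /andP[f1 f2] := fh n (leq_trans (leq_addr _ _) len).
have /andP[g1 g2] := hg n (leq_trans (leq_addl _ _) len).
rewrite -!mulrA; apply/andP; split.
  by apply: le_trans f1; rewrite ler_pM2l.
by apply: le_trans f2 _; rewrite ler_pM2l.
Qed.

Lemma exp_poly_bounds (b : R) l n : 0 < b -> (1 <= n)%N ->
  b ^+ n * n%:R ^+ l <= exp_poly b l n <= 2 ^+ l * (b ^+ n * n%:R ^+ l).
Proof.
move=> b0 n1; rewrite /exp_poly mulrCA !ler_pM2l ?exprn_gt0 // -exprMn.
apply/andP; split; apply: lerXn2r; rewrite ?nnegrE ?mulr_ge0 // -?natrM ler_nat //.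
by rewrite mul2n -addnn -addn1 leq_add2l.
Qed.

Lemma growth_class f b l : growth f b l -> complexity_class f = exp_poly_class b l.
Proof.
move=> [b0 [c1 [c2 [c10 c20 fP]]]]; apply: complexity_class_eq.
exists c1, (c2 * 2 ^+ l); split; rewrite ?mulr_gt0 ?exprn_gt0 //; exists 1%N => n n1.
have /andP[e1 e2] := exp_poly_bounds l b0 n1; have /andP[f1 f2] := fP n.
apply/andP; split; first by apply: le_trans f1; rewrite ler_pM2l.
by apply: le_trans f2 _; rewrite -mulrA ler_pM2l.
Qed.

(** For base 0 the comparison sequence vanishes from [n = 1] on, whatever the exponent. *)
Lemma ev_zero_class f l : ev_zero f -> complexity_class f = exp_poly_class 0 l.
Proof.
move=> [N fN]; apply: complexity_class_eq; exists 1, 1; split=> //.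
exists N.+1 => n ltn; rewrite fN 1?ltnW // expr0n.
by case: n ltn => // n _; rewrite mul0r mulr0 lexx.
Qed.

Lemma eventually_dominated f g (c : R) N : 0 < c -> (forall n, 0 < f n) -> (forall n, 0 < g n) ->
  (forall n, (N <= n)%N -> f n <= c * g n) -> exists2 C, 0 < C & forall n, f n <= C * g n.
Proof.
move=> c0 f0 g0 fg; have s0 : 0 <= \sum_(i < N) f i / g i.
  by apply: sumr_ge0 => i _; rewrite divr_ge0 // ltW.
exists (c + \sum_(i < N) f i / g i) => [|n]; first by rewrite ltr_pwDl.
rewrite mulrDl; case: (ltnP n N) => [ltn|/fg fgn]; last first.
  by rewrite ler_wpDr // mulr_ge0 // ltW.
rewrite ler_wpDl ?mulr_ge0 ?(ltW c0) ?(ltW (g0 n)) //.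
rewrite (bigD1 (Ordinal ltn)) //= mulrDl divfK ?gt_eqF // lerDl mulr_ge0 ?(ltW (g0 n)) //.
by apply: sumr_ge0 => i _; rewrite divr_ge0 // ltW.
Qed.

(** A positive [f] lies in its own class, which gives bounds for large [n]; positivity lets enlarged
    constants cover the remaining finitely many [n]. *)
Lemma class_growth f b l : 0 < b -> (forall n, 0 < f n) ->
  complexity_class f = exp_poly_class b l -> growth f b l.
Proof.
move=> b0 f0 fE.
have : complexity_class f f.
  split=> [n|]; first exact: ltW.
  by exists 1, 1; split=> //; exists 0%N => n _; rewrite mul1r lexx.
rewrite fE => -[_ [c1 [c2 [c10 c20 [N ef]]]]]; split=> //.
have e0 n := exp_poly_gt0 l n b0.
have [C C0 CP] : exists2 C, 0 < C & forall n, f n <= C * exp_poly b l n.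
  apply: (@eventually_dominated _ _ c1^-1 N.+1) => // [|n ltn]; first by rewrite invr_gt0.
  have /andP[h1 _] := ef n (ltnW ltn).
  have /andP[h2 _] := exp_poly_bounds l b0 (leq_ltn_trans (leq0n _) ltn).
  by rewrite ler_pdivlMl //; apply: le_trans h1 h2.
have [D D0 DP] : exists2 D, 0 < D & forall n, exp_poly b l n <= D * f n.
  apply: (@eventually_dominated _ _ (2 ^+ l * c2) N.+1) => // [|n ltn].
    by rewrite mulr_gt0 ?exprn_gt0.
  have /andP[_ h1] := ef n (ltnW ltn).
  have /andP[_ h2] := exp_poly_bounds l b0 (leq_ltn_trans (leq0n _) ltn).
  by apply: le_trans h2 _; rewrite -mulrA ler_pM2l ?exprn_gt0.
exists D^-1, C; split; rewrite ?invr_gt0 // => n.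
by rewrite CP ler_pdivrMl // DP.
Qed.

End ComplexityClasses.

(** * From the syzygy graph to complexity *)

Section SyzygyOrbits.
Variables (k : comPzRingType) (L : pzRingType) (phi : {rmorphism k -> L}).
Hypothesis artL : artin_algebra phi.
Variables (V : finType) (X : V -> lmodType L) (s : V -> seq V).
Hypotheses (Xf : forall v, flen phi (X v))
  (XO : forall v, iso_mod (Omega (X v)) (direct_sum X (s v))).

Lemma sum_count (F : V -> nat) (t : seq V) :
  (\sum_(u <- t) F u = \sum_u count_mem u t * F u)%N.
Proof.
elim: t => [|a t IHt]; first by rewrite big_nil big1.
rewrite big_cons IHt; under [RHS]eq_bigr do rewrite /= mulnDl.
rewrite big_split /=; congr (_ + _)%N.
rewrite (bigD1 a) //= eqxx mul1n big1 ?addn0 // => u.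
by rewrite eq_sym => /negPf ->.
Qed.

Lemma len_syzygyS v n :
  len phi (syzygy n.+1 (X v)) = (\sum_u count_mem u (s v) * len phi (syzygy n (X u)))%N.
Proof.
rewrite syzygyS (len_iso phi (syzygy_iso artL n (flen_Omega artL (Xf v)) (XO v))).
rewrite (len_iso phi (syzygy_direct_sum artL n (s v) Xf)).
rewrite len_direct_sum => [|u]; first exact: sum_count.
exact: (flen_syzygy artL).
Qed.

Lemma syzygy_orbit (R : realType) :
  is_orbit (fun v u => count_mem u (s v)) (fun v n => (len phi (syzygy n (X v)))%:R : R).
Proof.
move=> v n; rewrite len_syzygyS natr_sum; apply: eq_bigr => u _.
by rewrite natrM.
Qed.

Lemma direct_sum_flatten (h : V -> seq V) t :
  iso_mod (direct_sum (fun v => direct_sum X (h v)) t) (direct_sum X (flatten (map h t))).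
Proof.
elim: t => [|v t IHt] /=; first exact: iso_refl.
apply: iso_trans (iso_prod (iso_refl _) IHt) _.
exact/iso_sym/direct_sum_cat.
Qed.

Lemma syzygy_graph_sum v n : exists t, iso_mod (syzygy n (X v)) (direct_sum X t).
Proof.
elim: n => [|n [t tE]].
  exists [:: v] => /=; apply: iso_sym.
  exists (mklin (@fst_linear L (X v) 'rV[L]_0)).
  by exists (fun x => (x, 0)) => // -[x y] /=; rewrite [y]rV0_eq0.
exists (flatten (map s t)) => /=.
apply: iso_trans (Omega_iso artL (flen_syzygy artL n (Xf v)) tE) _.
apply: iso_trans (syzygy_direct_sum artL 1 t Xf) _ => /=.
apply: iso_trans (direct_sum_flatten s t).
have := direct_sum_iso (h := id) (Y := fun v => direct_sum X (s v)) t XO.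
by rewrite map_id.
Qed.

Lemma graph_finite_syzygy_type v : finite_syzygy_type (X v).
Proof.
exists #|V|, (fun i => X (enum_val i)); split=> [i|n].
  exact/(flen_fin_gen artL).
have [t tE] := syzygy_graph_sum v n; exists (map enum_rank t).
apply: iso_trans tE _.
by apply: direct_sum_iso => u; rewrite enum_rankK; apply: iso_refl.
Qed.

End SyzygyOrbits.

Section MainTheorem.
Variable R : realType.

Section OneModule.
Variables (k : comPzRingType) (L : pzRingType) (phi : {rmorphism k -> L}) (A : lmodType L).
Hypotheses (artL : artin_algebra phi) (A_fg : fin_gen A).

Let Af : flen phi A := (flen_fin_gen artL A).1 A_fg.
Let lenS (B : lmodType L) n : R := (len phi (syzygy n B))%:R.

Lemma zero_ev_zero (B : lmodType L) : (forall x : B, x = 0) -> ev_zero (lenS B).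
Proof.
move=> B0; exists 0%N => n _; rewrite /lenS (len_iso phi (syzygy_zero artL n B0)).
have Zf : flen phi 'rV[L]_0 by apply: ranked_zero => x; apply: rV0_eq0.
by rewrite ((len0P Zf).2 (@rV0_eq0 L)).
Qed.

Lemma zero_cx (B : lmodType L) l : (forall x : B, x = 0) -> cx phi B = exp_poly_class (0 : R) l.
Proof. by move=> /zero_ev_zero; apply: ev_zero_class. Qed.

Lemma syzygy_shift (B : lmodType L) m : retract B (syzygy m A) ->
  forall n, lenS B n <= lenS A (n + m)%N.
Proof.
move=> BA n; rewrite ler_nat syzygyD; apply: (retract_len (phi := phi)).
  exact: (flen_syzygy artL n (flen_syzygy artL m Af)).
exact: (retract_syzygy artL n (flen_syzygy artL m Af) BA).
Qed.

Hypothesis A_fst : finite_syzygy_type A.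

Lemma len_gt0 (B : lmodType L) : flen phi B -> ~ (forall x : B, x = 0) -> 0 < lenS B 0.
Proof.
by move=> Bf B0; rewrite ltr0n lt0n; apply/negP => /eqP /(len0P Bf).
Qed.

Theorem complexity_exp_poly : exists (l : nat) (b : R),
  [/\ 0 <= b, cx phi A = exp_poly_class b l &
    forall s : nat, (s <= l)%N -> exists (m : nat) (B : lmodType L),
      direct_summand B (syzygy m A) /\ cx phi B = exp_poly_class b s].
Proof.
have AA : direct_summand A (syzygy 0 A) by apply/retract_sumP/retract_iso/iso_refl.
have small : ev_zero (lenS A) -> exists (l : nat) (b : R),
  [/\ 0 <= b, cx phi A = exp_poly_class b l &
    forall s : nat, (s <= l)%N -> exists (m : nat) (B : lmodType L),
      direct_summand B (syzygy m A) /\ cx phi B = exp_poly_class b s].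
  move=> A0; exists 0%N, 0; split=> // [|s _]; first exact: ev_zero_class.
  by exists 0%N, A; split=> //; apply: ev_zero_class.
case: (pselect (forall x : A, x = 0)) => [/zero_ev_zero//|A0].
have [V [X [s [v0 [Xv0 Xf XA XO X0]]]]] := syzygy_graph artL Af A_fst.
have fT := syzygy_orbit artL Xf XO R.
have f0 v : 0 < lenS (X v) 0.
  by apply: len_gt0 => //; case: (eqVneq v v0) => [->|/X0 //]; rewrite Xv0.
have : good (fun v => lenS (X v)) (lenS (X v0)) := orbit_good fT f0 v0.
rewrite Xv0 => -[|[b [l [fb w]]]]; first exact: small.
exists l, b; split=> [||s' s'l]; first by apply: ltW; case: fb.
  exact: growth_class.
have [u fu] := w s' s'l; have [m XuA] := XA u.
by exists m, (X u); split; [apply/retract_sumP|apply: growth_class fu].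
Qed.

Theorem complexity_base (b : R) l : 0 <= b -> cx phi A = exp_poly_class b l ->
  algebraic_integer b /\ exists p : {poly rat}, is_minimal_poly b p /\
    forall z : R[i], root (map_poly (ratr : rat -> R[i]) p) z -> ~ (b%:C%C < `|z|).
Proof.
rewrite le_eqVlt => /orP[/eqP <- _|b0 Acx].
  split; first by exists 'X; rewrite ?monicX // map_polyX rootX.
  exists 'X; split; last first.
    by move=> z; rewrite map_polyX rootX => /eqP ->; rewrite normr0 ltxx.
  split; rewrite ?monicX // ?map_polyX ?rootX // => q q0.
  move=> /root_size_gt1; rewrite size_polyX size_map_poly; apply.
  by rewrite map_poly_eq0.
have nz : ~ ev_zero (lenS A).
  move=> [N A0]; have : cx phi A (lenS A).
    split=> [n|]; first exact: ler0n.
    by exists 1, 1; split=> //; exists 0%N => n _; rewrite mul1r lexx.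
  rewrite Acx => -[_ [c1 [c2 [_ _ [M bM]]]]].
  have /andP[_] := bM (N + M).+1 (leqW (leq_addl _ _)).
  rewrite A0 ?mulr0; last exact: leqW (leq_addr _ _).
  by rewrite leNgt mulr_gt0 ?exprn_gt0 ?ltr0n.
have A0 : ~ (forall x : A, x = 0) by move=> /zero_ev_zero.
have [V [X [s [v0 [Xv0 Xf XA XO X0]]]]] := syzygy_graph artL Af A_fst.
have fT := syzygy_orbit artL Xf XO R.
have f0 v : 0 < lenS (X v) 0.
  by apply: len_gt0 => //; case: (eqVneq v v0) => [->|/X0 //]; rewrite Xv0.
(* Being not eventually zero, the sequence falls in the growth case of [orbit_good], which excludes
   zeros at every [n]; so [class_growth] applies to the given [b] and [l]. *)
have fv0_gt0 n : 0 < lenS (X v0) n.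
  have : good (fun v => lenS (X v)) (lenS (X v0)) := orbit_good fT f0 v0.
  by case=> [|[b' [l' [/growth_gt0 fb _]]]]; first by rewrite Xv0.
have fg : growth (lenS (X v0)) b l by apply: class_growth => //; rewrite Xv0.
apply: (spectral_algebraic_integer fT f0 fg) => v.
by have [m /syzygy_shift XvA] := XA v; exists m; rewrite Xv0.
Qed.

End OneModule.

Lemma quiver_count (V : finType) (T : V -> V -> nat) (v u : V) :
  let A : finType := {x : V * V & 'I_(T x.1 x.2)} in
  count_mem u (map (fun a : A => (tag a).2) (arrows_from (fun a : A => (tag a).1) v)) = T v u.
Proof.
move=> A; rewrite count_map count_filter -sum1_count big_enum_cond /=.
pose P := [pred x : V * V | (x.2 == u) && (x.1 == v)].
transitivity (\sum_(x : V * V | P x) \sum_(i < T x.1 x.2) 1)%N.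
  rewrite (sig_big_dep P (fun x (i : 'I_(T x.1 x.2)) => true) (fun x i => 1%N)).
  by apply: eq_bigl => a; rewrite andbT.
rewrite (big_pred1 (v, u)); first by rewrite sum1_card card_ord.
by move=> [x y]; rewrite /= xpair_eqE andbC.
Qed.

Theorem realizable_complexity (b : R) l : 0 < b -> realizable b ->
  exists (k : comPzRingType) (L : pzRingType) (phi : {rmorphism k -> L}) (A : lmodType L),
    [/\ artin_algebra phi, fin_gen A, finite_syzygy_type A & cx phi A = exp_poly_class b l].
Proof.
move=> b0 b_real; have [V [T [v vP]]] := realizable_growth l b0 b_real.
pose E : finType := {x : V * V & 'I_(T x.1 x.2)}.
pose src (a : E) := (tag a).1; pose tgt (a : E) := (tag a).2.
pose phi : {rmorphism rat -> path_alg_of rat src tgt} := @path_scalar rat V E src tgt.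
have artL : artin_algebra phi := @path_artin rat V E src tgt.
pose X (u : V) : lmodType (path_alg_of rat src tgt) := simple_mod_of rat src tgt u.
have Xf u : flen phi (X u).
  exists (series_rank 1 (fun i => if i is 0%N then [set 0] else setT)).
  exact: series_rankP (@simple_series rat V E src tgt u).
pose s u := map tgt (arrows_from src u).
have XO u : iso_mod (Omega (X u)) (direct_sum X (s u)).
  exact: (syzygy_unique artL (iso_refl _) (Omega_spec artL (Xf u)) (@simple_syzygy rat V E src
    tgt u)).
exists rat, (path_alg_of rat src tgt), phi, (X v); split=> //.
- exact/(flen_fin_gen artL).
- exact: (graph_finite_syzygy_type artL Xf XO v).
apply: growth_class; apply: (vP (fun u n => (len phi (syzygy n (X u)))%:R)) => [u n|u].
  have := syzygy_orbit artL Xf XO R u n; rewrite /= => ->.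
  by apply: eq_bigr => w _; rewrite quiver_count.
by rewrite [len _ _]simple_len.
Qed.

(** The zero module serves for every exponent. *)
Lemma zero_complexity l :
  exists (k : comPzRingType) (L : pzRingType) (phi : {rmorphism k -> L}) (A : lmodType L),
    [/\ artin_algebra phi, fin_gen A, finite_syzygy_type A & cx phi A = exp_poly_class (0 : R) l].
Proof.
pose f (a : unit) := tt.
pose phi : {rmorphism rat -> path_alg_of rat f f} := @path_scalar rat unit unit f f.
have artL : artin_algebra phi := @path_artin rat unit unit f f.
have Z0 := @rV0_eq0 (path_alg_of rat f f).
exists rat, (path_alg_of rat f f), phi, 'rV[path_alg_of rat f f]_0; split=> //.
- by exists 0%N, (fun=> 0) => x; exists (fun=> 0); rewrite [LHS]Z0 [RHS]Z0.
- exists 0%N, (fun=> 'rV[path_alg_of rat f f]_0); split=> [[]//|n].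
  by exists [::]; apply: (syzygy_zero artL).
exact: zero_cx.
Qed.

End MainTheorem.

Theorem theorem3p9 (R : realType) :
  (forall (k : comPzRingType) (L : pzRingType) (phi : {rmorphism k -> L})
      (A : lmodType L),
    artin_algebra phi -> fin_gen A -> finite_syzygy_type A ->
    exists (l : nat) (b : R),
      [/\ 0 <= b,
          cx phi A = exp_poly_class b l &
          forall s : nat, (s <= l)%N ->
            exists (m : nat) (B : lmodType L),
              direct_summand B (syzygy m A) /\
              cx phi B = exp_poly_class b s])
  /\
  (forall (l : nat) (b : R), 0 <= b ->
    ((exists (k : comPzRingType) (L : pzRingType) (phi : {rmorphism k -> L})
        (A : lmodType L),
      [/\ artin_algebra phi, fin_gen A, finite_syzygy_type A &
          cx phi A = exp_poly_class b l])
     <->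
     (algebraic_integer b /\
      exists p : {poly rat}, is_minimal_poly b p /\
        forall z : R[i], root (map_poly (ratr : rat -> R[i]) p) z ->
          ~ (b%:C%C < `|z|)))).
Proof.
split=> [k L phi A artL A_fg A_fst|l b b0]; first exact: complexity_exp_poly.
split=> [[k [L [phi [A [artL A_fg A_fst Acx]]]]]|[b_int [p [p_min pz]]]].
  exact: (complexity_base artL A_fg A_fst b0 Acx).
move: b0; rewrite le_eqVlt => /orP[/eqP <-|b0]; first exact: zero_complexity.
exact/realizable_complexity/(weak_perron_realizable b0 b_int p_min).
Qed.
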